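(* Let $A\to M$ be a Lie algebroid. The $1$-truncation $P_1(A)/P_2(A)$ of the Weinstein $2$-groupoid $2\text{-}\mathcal P(A)$ of $A$ coincides, as a groupoid over $M$, with the Weinstein groupoid $\mathcal{G}(A)$ of $A$.
   Context: $I=[0,1]$. An $A$-path is a Lie algebroid morphism $a\,dt:TI\to A$; its source and target are the base points of $a(0)$ and $a(1)$. Concatenation $b\cdot a$: $2a(2t)$ for $t\le1/2$, $2b(2t-1)$ for $t\ge1/2$ (defined smoothly after replacing paths by reparametrizations $a^\tau(t)=\tau'(t)a(\tau(t))$, $\tau:I\to I$ smooth with $\tau(0)=0,\tau(1)=1$ and all derivatives vanishing at $0,1$). An $A$-homotopy $\sigma:a_0\Rightarrow a_1$ is a Lie algebroid morphism $\sigma=a\,dt+b\,ds:TI^2\to A$ with $a|_{s=0}=a_0$, $a|_{s=1}=a_1$, $b|_{t=0,1}=0$. It is thin if $\wedge^2\sigma:\wedge^2TI^2\to\wedge^2A$ vanishes. A $3$-homotopy between $A$-homotopies $\sigma_0,\sigma_1$ is a Lie algebroid morphism $H_1dt+H_2ds+H_3du:TI^3\to A$ with $H_3=0$ on $\{t=0,1\}\cup\{s=0,1\}$ and $(H_1dt+H_2ds)|_{u=i}=\sigma_i$. The Weinstein $2$-groupoid $2\text{-}\mathcal P(A)$ is the strict $2$-groupoid with objects $M$, $1$-morphisms $P_1(A)$ = thin homotopy classes of $A$-paths, $2$-morphisms $P_2(A)$ = $3$-homotopy classes of $A$-homotopies (understood also up to vertical concatenation with thin $A$-homotopies), with horizontal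 and vertical compositions given by concatenation in the variables $t$ and $s$ respectively. The $1$-truncation of a strict $2$-groupoid is the groupoid, over the same objects, obtained from the groupoid of $1$-morphisms by identifying two $1$-morphisms whenever there is a $2$-morphism between them. The Weinstein groupoid $\mathcal G(A)$ is the groupoid of $A$-paths modulo $A$-homotopy, with composition induced by concatenation. *)

(* Defs.v *)
From HB Require Import structures.
From mathcomp Require Import all_boot all_order all_algebra.
From mathcomp Require Import all_classical all_reals all_analysis.
From Stdlib Require Import Relation_Operators.
Set Implicit Arguments.
Unset Strict Implicit.
Unset Printing Implicit Defensive.
Import Order.TTheory GRing.Theory Num.Theory.
Import numFieldNormedType.Exports.
Local Open Scope classical_set_scope.
Local Open Scope ring_scope.

Section Smooth.
Variables (R : realType) (n : nat).

Definition basis_vec (i : 'I_n) : 'rV[R]_n := delta_mx 0 i.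

(* class C^m on the open set U, by iterated partial derivatives *)
Fixpoint Cm_on (m : nat) (U : set 'rV[R]_n) (f : 'rV[R]_n -> R) : Prop :=
  (forall x, U x -> {for x, continuous f}) /\
  (if m is m'.+1 then
     forall i, (forall x, U x -> derivable f x (basis_vec i)) /\
               Cm_on m' U (fun x => 'D_(basis_vec i) f x)
   else True).

Definition smooth_on (U : set 'rV[R]_n) (f : 'rV[R]_n -> R) : Prop :=
  forall m, Cm_on m U f.

(* D is not assumed open: local smooth extensions are required. *)
Definition smooth_within (D : set 'rV[R]_n) (f : 'rV[R]_n -> R) : Prop :=
  forall x, D x -> exists (U : set 'rV[R]_n) (g : 'rV[R]_n -> R),
    [/\ open U, U x, smooth_on U g & forall y, D y -> U y -> f y = g y].

Definition cube : set 'rV[R]_n :=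
  [set x | forall i, 0 <= x ord0 i <= 1].

(* i-th partial derivative of a function on the cube I^n (one-sided at the
   faces); values outside of the cube are never used *)
Definition partial (i : 'I_n) (f : 'rV[R]_n -> R) (x : 'rV[R]_n) : R :=
  lim ((fun h : R => h^-1 * (f (x + h *: basis_vec i) - f x)) @
       within [set h : R | cube (x + h *: basis_vec i)] (0 : R)^').

Definition set_coord (i : 'I_n) (c : R) (x : 'rV[R]_n) : 'rV[R]_n :=
  \row_j (if j == i then c else x ord0 j).

End Smooth.

Record manifold (R : realType) := Manifold {
  carrier :> topologicalType;
  dim : nat;
  chart_index : Type;
  chart_dom : chart_index -> set carrier;
  chart : chart_index -> carrier -> 'rV[R]_dim;
  chart_inv : chart_index -> 'rV[R]_dim -> carrier;
  manifold_hausdorff : hausdorff_space carrier;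
  manifold_second_countable : @second_countable carrier;
  chart_cover : forall x, exists c, chart_dom c x;
  chart_dom_open : forall c, open (chart_dom c);
  chart_img_open : forall c, open (chart c @` chart_dom c);
  chartK : forall c x, chart_dom c x -> chart_inv c (chart c x) = x;
  chart_continuous :
    forall c x, chart_dom c x -> {for x, continuous (chart c)};
  chart_inv_continuous :
    forall c x, chart_dom c x -> {for chart c x, continuous (chart_inv c)};
  chart_transition : forall c c' j,
    smooth_on (chart c @` (chart_dom c `&` chart_dom c'))
      (fun y => chart c' (chart_inv c y) ord0 j) }.

(* W is an open subset of M. *)
Definition smooth_fun_on (R : realType) (M : manifold R)
    (W : set M) (f : M -> R) : Prop :=
  forall c, smooth_on (@chart R M c @` (@chart_dom R M c `&` W))
              (f \o @chart_inv R M c).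

Definition smooth_fun (R : realType) (M : manifold R) (f : M -> R) : Prop :=
  smooth_fun_on setT f.

(* Tangent vectors at x are the derivations of C^oo(M) at x. *)
Definition is_tangent (R : realType) (M : manifold R) (x : M)
    (v : (M -> R) -> R) : Prop :=
  (forall c f g, smooth_fun f -> smooth_fun g ->
     v (fun y => c * f y + g y) = c * v f + v g) /\
  (forall f g, smooth_fun f -> smooth_fun g ->
     v (fun y => f y * g y) = f x * v g + v f * g x).

(* A vector bundle of rank [rank], given by its fibres and an atlas of local
   trivializations with smooth transition functions. *)
Record vector_bundle (R : realType) (M : manifold R) := VectorBundle {
  fibre :> M -> lmodType R;
  rank : nat;
  triv_index : Type;
  triv_dom : triv_index -> set M;
  triv : triv_index -> forall x, fibre x -> 'rV[R]_rank;
  triv_inv : triv_index -> forall x, 'rV[R]_rank -> fibre x;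
  triv_cover : forall x, exists t, triv_dom t x;
  triv_dom_open : forall t, open (triv_dom t);
  triv_linear : forall t x, triv_dom t x -> forall (a : R) (u v : fibre x),
    triv t (a *: u + v) = a *: triv t u + triv t v;
  trivK : forall t x, triv_dom t x -> cancel (@triv t x) (@triv_inv t x);
  triv_invK : forall t x, triv_dom t x -> cancel (@triv_inv t x) (@triv t x);
  triv_transition : forall t t' (v : 'rV[R]_rank) j,
    smooth_fun_on (triv_dom t `&` triv_dom t')
      (fun x => triv t' (triv_inv t x v) ord0 j) }.

Section Sections.
Variables (R : realType) (M : manifold R) (E : vector_bundle M).

Definition smooth_section (s : forall x, E x) : Prop :=
  forall t j, smooth_fun_on (@triv_dom R M E t)
                (fun x => triv t (s x) ord0 j).

(* smooth sections of the dual bundle *)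
Definition is_form1 (w : forall x, E x -> R) : Prop :=
  (forall x (a : R) (u v : E x), w x (a *: u + v) = a * w x u + w x v) /\
  (forall t v, smooth_fun_on (@triv_dom R M E t)
                 (fun x => w x (triv_inv t x v))).

Definition alternating (V : lmodType R) (e : V -> V -> R) : Prop :=
  [/\ forall (a : R) u u' v, e (a *: u + u') v = a * e u v + e u' v,
      forall (a : R) u v v', e u (a *: v + v') = a * e u v + e u v'
    & forall u, e u u = 0].

(* smooth sections of the second exterior power of the dual bundle *)
Definition is_form2 (e : forall x, E x -> E x -> R) : Prop :=
  (forall x, alternating (@e x)) /\
  (forall t u v, smooth_fun_on (@triv_dom R M E t)
                   (fun x => e x (triv_inv t x u) (triv_inv t x v))).

End Sections.

(* [anchor v f] is the derivative of f along the anchor of v. *)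
Record lie_algebroid (R : realType) (M : manifold R) := LieAlgebroid {
  bundle :> vector_bundle M;
  anchor : forall x, bundle x -> (M -> R) -> R;
  bracket : (forall x, bundle x) -> (forall x, bundle x) ->
            (forall x, bundle x);
  anchor_tangent : forall x (v : bundle x), is_tangent x (anchor v);
  anchor_linear : forall x (a : R) (u v : bundle x) f, smooth_fun f ->
    anchor (a *: u + v) f = a * anchor u f + anchor v f;
  anchor_smooth : forall (s : forall x, bundle x) f,
    smooth_section s -> smooth_fun f -> smooth_fun (fun x => anchor (s x) f);
  bracket_smooth : forall s t, smooth_section s -> smooth_section t ->
    smooth_section (bracket s t);
  bracket_linear : forall (a : R) s s' t,
    smooth_section s -> smooth_section s' -> smooth_section t ->
    bracket (fun x => a *: s x + s' x) t =
    (fun x => a *: bracket s t x + bracket s' t x);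
  bracket_antisym : forall s t, smooth_section s -> smooth_section t ->
    bracket s t = (fun x => - bracket t s x);
  bracket_jacobi : forall s t u,
    smooth_section s -> smooth_section t -> smooth_section u ->
    forall x, bracket s (bracket t u) x + bracket t (bracket u s) x
              + bracket u (bracket s t) x = 0;
  bracket_leibniz : forall s t f,
    smooth_section s -> smooth_section t -> smooth_fun f ->
    bracket s (fun x => f x *: t x) =
    (fun x => f x *: bracket s t x + anchor (s x) f *: t x) }.

Section Algebroid.
Variables (R : realType) (M : manifold R) (A : lie_algebroid M).

(* [is_dA w e] : e is the Lie algebroid differential d_A w (Koszul formula) *)
Definition is_dA (w : forall x, A x -> R) (e : forall x, A x -> A x -> R) :
    Prop :=
  forall s t : forall x, A x, smooth_section s -> smooth_section t ->
  forall x, e x (s x) (t x) =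
    anchor (s x) (fun y => w y (t y)) - anchor (t x) (fun y => w y (s y))
    - w x (bracket s t x).

(* A vector bundle map TI^k -> A is a map from I^k to the k-fold Whitney sum of
   A: the value at p consists of the base point and of the images of the k
   coordinate vector fields.  Such a map is encoded by a function on R^k of
   which only the restriction to I^k is relevant.  For k = 1 this is a dt, for
   k = 2 it is a dt + b ds (coordinates 0 and 1), for k = 3 it is
   H_1 dt + H_2 ds + H_3 du. *)
Definition frame (k : nat) : Type := {x : M & 'I_k -> A x}.
Definition base k (p : frame k) : M := projT1 p.
Definition vec k (p : frame k) (i : 'I_k) : A (base p) := projT2 p i.

Definition cube_map (k : nat) : Type := 'rV[R]_k -> frame k.

Definition eq_on_cube k (f g : cube_map k) : Prop :=
  forall x, cube x -> f x = g x.

Definition smooth_cube_map k (f : cube_map k) : Prop :=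
  [/\ {within @cube R k, continuous (fun x => base (f x))},
      forall c j,
        smooth_within (@cube R k `&` [set x | @chart_dom R M c (base (f x))])
          (fun x => @chart R M c (base (f x)) ord0 j)
    & forall t i j,
        smooth_within (@cube R k `&` [set x | @triv_dom R M A t (base (f x))])
          (fun x => triv t (vec (f x) i) ord0 j)].

(* Compatibility of the pullback of A-forms with d_A and the de Rham
   differential; functions and 1-forms generate the algebra of forms.  d_A of a
   function h is v |-> anchor v h. *)
Definition is_morphism k (f : cube_map k) : Prop :=
  [/\ smooth_cube_map f,
      forall h : M -> R, smooth_fun h -> forall i x, cube x ->
        partial i (fun y => h (base (f y))) x = anchor (vec (f x) i) h
    & forall w e, is_form1 w -> is_form2 e -> is_dA w e ->
        forall i j x, cube x ->
        partial i (fun y => w _ (vec (f y) j)) x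
        - partial j (fun y => w _ (vec (f y) i)) x
        = e _ (vec (f x) i) (vec (f x) j)].

Definition scale_at k (i : 'I_k) (c : R) (p : frame k) : frame k :=
  existT _ (base p) (fun j => if j == i then c *: vec p j else vec p j).

(* restriction to the face {x_i = c} *)
Definition face_point k (i : 'I_k.+1) (c : R) (x : 'rV[R]_k) : 'rV[R]_k.+1 :=
  \row_j (if unlift i j is Some j' then x ord0 j' else c).
Definition face k (i : 'I_k.+1) (c : R) (f : cube_map k.+1) : cube_map k :=
  fun x => let p := f (face_point i c x) in
           existT _ (base p) (fun j => vec p (lift i j)).

(* constant extension in a new last variable *)
Definition degenerate k (f : cube_map k) : cube_map k.+1 :=
  fun x => let p := f (\row_j x ord0 (lift ord_max j)) in
    existT _ (base p)
      (fun j => if unlift ord_max j is Some j' then vec p j' else 0).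

Definition reverse k (i : 'I_k) (f : cube_map k) : cube_map k :=
  fun x => scale_at i (-1) (f (set_coord i (1 - x ord0 i) x)).

Definition flat_reparam (tau : R -> R) : Prop :=
  [/\ forall m x, derivable (derive1n m tau) x 1,
      forall t, 0 <= t <= 1 -> 0 <= tau t <= 1,
      tau 0 = 0, tau 1 = 1
    & forall m, derive1n m.+1 tau 0 = 0 /\ derive1n m.+1 tau 1 = 0].

Definition reparam k (i : 'I_k) (tau : R -> R) (f : cube_map k) :
    cube_map k :=
  fun x => scale_at i (derive1n 1 tau (x ord0 i))
             (f (set_coord i (tau (x ord0 i)) x)).

(* concatenation g . f (first f, then g) in the i-th variable *)
Definition concat k (i : 'I_k) (g f : cube_map k) : cube_map k :=
  fun x => if x ord0 i <= 2^-1
           then scale_at i 2 (f (set_coord i (2 * x ord0 i) x))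
           else scale_at i 2 (g (set_coord i (2 * x ord0 i - 1) x)).

Definition smooth_concat k (i : 'I_k) (tau : R -> R) (g f : cube_map k) :
    cube_map k :=
  concat i (reparam i tau g) (reparam i tau f).

(* Homotopies in the last variable, relative to the other faces.  For k = 1
   these are the A-homotopies of A-paths, for k = 2 the 3-homotopies. *)
Definition homotopy k (H : cube_map k.+1) (f0 f1 : cube_map k) : Prop :=
  [/\ is_morphism H,
      eq_on_cube (face ord_max 0 H) f0,
      eq_on_cube (face ord_max 1 H) f1
    & forall x i, cube x -> i != ord_max -> x ord0 i = 0 \/ x ord0 i = 1 ->
        vec (H x) ord_max = 0].

(* u /\ v = 0 in the second exterior power of V, tested on alternating forms *)
Definition wedge_zero (V : lmodType R) (u v : V) : Prop :=
  forall e : V -> V -> R, alternating e -> e u v = 0.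

Definition thin k (f : cube_map k) : Prop :=
  forall x i j, cube x -> wedge_zero (vec (f x) i) (vec (f x) j).

Definition Apath : set (cube_map 1) := @is_morphism 1.

Definition source (a : cube_map 1) : M := base (a (const_mx 0)).
Definition target (a : cube_map 1) : M := base (a (const_mx 1)).

Definition constant_path (x : M) : cube_map 1 :=
  fun _ => existT _ x (fun _ => 0).

Definition homotopic (a b : cube_map 1) : Prop :=
  [/\ Apath a, Apath b & exists s : cube_map 2, homotopy s a b].

Definition thin_homotopic (a b : cube_map 1) : Prop :=
  [/\ Apath a, Apath b & exists s : cube_map 2, homotopy s a b /\ thin s].

Definition homotopy_class (a : cube_map 1) : set (cube_map 1) :=
  [set b | homotopic a b].
Definition thin_class (a : cube_map 1) : set (cube_map 1) :=
  [set b | thin_homotopic a b].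

Definition t_dir : 'I_2 := ord0.
Definition s_dir : 'I_2 := ord_max.

Definition Ahomotopy : set (cube_map 2) :=
  [set s | exists a0 a1, [/\ Apath a0, Apath a1 & homotopy s a0 a1]].

Definition meets (i : 'I_2) (s' s : cube_map 2) : Prop :=
  eq_on_cube (face i 1 s) (face i 0 s').

Definition step2 (s s' : cube_map 2) : Prop :=
  [/\ Ahomotopy s, Ahomotopy s' &
   [\/ exists H : cube_map 3, homotopy H s s',
       exists tau h, [/\ flat_reparam tau, Ahomotopy h, thin h,
                         meets s_dir h s & s' = smooth_concat s_dir tau h s]
     | exists tau h, [/\ flat_reparam tau, Ahomotopy h, thin h,
                         meets s_dir s h & s' = smooth_concat s_dir tau s h]]].

Definition equiv2 (s s' : cube_map 2) : Prop :=
  [/\ Ahomotopy s, Ahomotopy s' & clos_refl_sym_trans _ step2 s s'].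

Definition class2 (s : cube_map 2) : set (cube_map 2) :=
  [set s' | equiv2 s s'].

End Algebroid.

(* Set-theoretic presentation: arrows are the elements of the sets [hom x y];
   the values of the operations on non-composable elements are irrelevant. *)
Record groupoid_data (M : Type) := GroupoidData {
  arrow : Type;
  hom : M -> M -> set arrow;
  unit_ : M -> arrow;
  comp : arrow -> arrow -> arrow;   (* comp g f = g . f, first f, then g *)
  inv : arrow -> arrow }.

Record is_groupoid (M : Type) (G : groupoid_data M) : Prop := IsGroupoid {
  hom_ends : forall x y x' y' f,
    hom (g := G) x y f -> hom x' y' f -> x = x' /\ y = y';
  hom_unit : forall x, hom x x (unit_ G x);
  hom_comp : forall x y z f g,
    hom (g := G) x y f -> hom y z g -> hom x z (comp g f);
  hom_inv : forall x y f, hom (g := G) x y f -> hom y x (inv f);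
  comp_assoc : forall x y z w f g h,
    hom (g := G) x y f -> hom y z g -> hom z w h ->
    comp h (comp g f) = comp (comp h g) f;
  comp_unit_r : forall x y f, hom (g := G) x y f -> comp f (unit_ G x) = f;
  comp_unit_l : forall x y f, hom (g := G) x y f -> comp (unit_ G y) f = f;
  comp_inv_r : forall x y f, hom (g := G) x y f -> comp f (inv f) = unit_ G y;
  comp_inv_l : forall x y f, hom (g := G) x y f -> comp (inv f) f = unit_ G x }.

(* isomorphisms that are the identity on the objects M *)
Record groupoid_iso_over (M : Type) (G H : groupoid_data M)
    (F : arrow G -> arrow H) : Prop := GroupoidIsoOver {
  iso_bij : forall x y, set_bij (hom (g := G) x y) (hom (g := H) x y) F;
  iso_unit : forall x, F (unit_ G x) = unit_ H x;
  iso_comp : forall x y z f g, hom (g := G) x y f -> hom y z g ->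
    F (comp g f) = comp (F g) (F f);
  iso_inv : forall x y f, hom (g := G) x y f -> F (inv f) = inv (F f) }.

Record two_groupoid_data (M : Type) := TwoGroupoidData {
  one_mor :> groupoid_data M;
  cell : Type;
  hom2 : arrow one_mor -> arrow one_mor -> set cell;
  unit2 : arrow one_mor -> cell;
  vcomp : cell -> cell -> cell;
  hcomp : cell -> cell -> cell;
  vinv : cell -> cell;
  hinv : cell -> cell }.

Section Truncation.
Variables (M : Type) (G : two_groupoid_data M).

Definition two_connected (f g : arrow G) : Prop :=
  exists x y, [/\ hom x y f, hom x y g & exists c, hom2 (t := G) f g c].

Definition one_class (f : arrow G) : set (arrow G) :=
  [set g | two_connected f g].

(* The arrows are classes of 1-morphisms; the operations are induced. *)
Definition truncation : groupoid_data M := {|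
  arrow := set (arrow G);
  hom := fun x y => [set one_class f | f in hom x y];
  unit_ := fun x => one_class (unit_ G x);
  comp := fun Y X => [set h | exists x y z f g,
    [/\ X f, Y g, hom x y f, hom y z g & one_class (comp g f) h]];
  inv := fun X => [set h | exists2 f, X f & one_class (inv f) h] |}.

End Truncation.

Section Weinstein.
Variables (R : realType) (M : manifold R) (A : lie_algebroid M).

Let path := cube_map A 1.
Let sheet := cube_map A 2.

(* A-paths modulo the equivalence with classes cls; the product of two classes
   consists of all concatenations of composable representatives. *)
Definition path_groupoid (cls : path -> set path) : groupoid_data M := {|
  arrow := set path;
  hom := fun x y =>
    [set cls a | a in [set a | [/\ Apath a, source a = x & target a = y]]];
  unit_ := fun x => cls (constant_path A x);
  comp := fun Y X => [set c | exists tau a b,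
    [/\ flat_reparam tau, X a, Y b, target a = source b
      & cls (smooth_concat ord0 tau b a) c]];
  inv := fun X => [set c | exists2 a, X a & cls (reverse ord0 a) c] |}.

Definition weinstein_groupoid : groupoid_data M :=
  path_groupoid (@homotopy_class R M A).

Definition comp2 (i : 'I_2) (Y X : set sheet) : set sheet :=
  [set r | exists tau s s',
    [/\ flat_reparam tau, X s, Y s', meets i s' s
      & class2 (smooth_concat i tau s' s) r]].

Definition inv2 (i : 'I_2) (X : set sheet) : set sheet :=
  [set r | exists2 s, X s & class2 (reverse i s) r].

Definition weinstein_2groupoid : two_groupoid_data M := {|
  one_mor := path_groupoid (@thin_class R M A);
  cell := set sheet;
  hom2 := fun P Q =>
    [set class2 s | s in [set s : sheet |
       [/\ Ahomotopy s, P (face s_dir 0 s) & Q (face s_dir 1 s)]]];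
  unit2 := fun P => [set r | exists2 a, P a & class2 (degenerate a) r];
  vcomp := comp2 s_dir;
  hcomp := comp2 t_dir;
  vinv := inv2 s_dir;
  hinv := inv2 t_dir |}.

End Weinstein.

(* Main.v *)
(* Two facts produce all the homotopies that are needed. First, the pullback of
   a Lie algebroid morphism TI^k -> A along a smooth map I^m -> I^k is again a
   morphism (chain rule and symmetry of second derivatives), and it is thin if
   k = 1. Second, if P, Q, N are morphisms and F agrees at each point with P
   where Q = N and with Q where P = N, then every function theta of frames
   satisfies theta F = theta P + theta Q - theta N, so F is smooth and is a
   morphism; replacing a flat reparametrization by its clamped version, constant
   outside [0, 1], puts concatenations into this form. The groupoid laws then
   hold up to thin homotopy, as two reparametrizations of an A-path with the
   same end points are thinly homotopic by linear interpolation. An A-homotopy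
   fixes the end points since global smooth functions separate the points of M.
   As thinly homotopic paths are homotopic, and 2-morphisms join exactly the thin
   classes of homotopic paths, the union of the thin classes in an arrow of the
   truncation is a homotopy class, and this is the isomorphism. *)
Require Import Defs.
From HB Require Import structures.
From mathcomp Require Import all_boot all_order all_algebra.
From mathcomp Require Import all_classical all_reals all_analysis.
From mathcomp Require Import ring lra.
Import Defs.
Set Implicit Arguments.
Unset Strict Implicit.
Unset Printing Implicit Defensive.
Import Order.TTheory GRing.Theory Num.Theory.
Import numFieldNormedType.Exports.
Local Open Scope classical_set_scope.
Local Open Scope ring_scope.

(** * Differentiation in several variables *)

(** The obstacle is the seam of a concatenation: it is defined by cases at 1/2 with values in a
    manifold, and matching all derivatives there chart by chart would be painful. The identity with
    [P], [Q], [N] replaces this by the smoothness of three maps that are each defined on both sides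
    of the seam; clamping is what makes them so, as a flat reparametrization is unconstrained
    outside [0, 1]. The functions it is applied to, chart coordinates and fibre coordinates, exist
    only locally, so the base points of the three maps have to be compared first. A product of
    classes collects concatenations for all flat [tau], so independence of [tau] is part of
    well-definedness. With [fh] and [sh] the clamped reparametrizations of the two halves, the laws
    become identities between a concatenation and one path run along p fh + q sh: weights (1/2, 1/2)
    change [tau], (2/3, 1/3) and (1/3, 2/3) give associativity, (0, 1) and (1, 0) the units, (1, -1)
    the inverses. Since these hold up to thin homotopy, one relation [hrel], with a boolean for
    thinness, serves both groupoids. *)

Section Differentiation.
Variable R : realType.

Lemma continuous_sum (T : topologicalType) (I : Type) (r : seq I)
    (f : I -> T -> R) (x : T) :
  (forall i, {for x, continuous (f i)}) ->
  {for x, continuous (fun y => \sum_(i <- r) f i y)}.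
Proof.
move=> cf; elim: r => [|i r IH].
  by under [X in {for _, continuous X}]eq_fun do rewrite big_nil; exact: cvg_cst.
under [X in {for _, continuous X}]eq_fun do rewrite big_cons.
exact: (cvgD (cf i) IH).
Qed.

Lemma row_coord_continuous (n : nat) (i : 'I_n) (y : 'rV[R]_n) :
  {for y, continuous (fun x : 'rV[R]_n => x 0 i)}.
Proof. exact: coord_continuous. Qed.

Lemma derivable_line (n : nat) (g : 'rV[R]_n -> R) (z e : 'rV[R]_n) (t : R) :
  derivable g (z + t *: e) e -> is_derive t (1:R) (fun s : R => g (z + s *: e))
    ('D_e g (z + t *: e)).
Proof.
have E : (fun h : R => h^-1 *:
     (((fun s => g (z + s *: e)) \o shift t) (h *: 1) - g (z + t *: e))) =
   (fun h => h^-1 *: ((g \o shift (z + t *: e)) (h *: e) - g (z + t *: e))).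
  apply/funext => h /=; rewrite [h%:A]mulr1 scalerDl.
  by rewrite addrCA.
by move=> dg; split; [rewrite /derivable E|rewrite /derive E].
Qed.

(** Both signs of [t] are allowed, so that it applies to the signed coordinates of an increment. *)
Lemma line_mvt (n : nat) (g : 'rV[R]_n -> R) (z e : 'rV[R]_n) (t : R) :
  (forall s : R, `|s| <= `|t| -> derivable g (z + s *: e) e) ->
  exists2 s, `|s| <= `|t| & g (z + t *: e) - g z = t * 'D_e g (z + s *: e).
Proof.
move=> dg.
have D (s : R) : `|s| <= `|t| ->
    is_derive s (1:R) (fun s : R => g (z + s *: e)) ('D_e g (z + s *: e)).
  by move=> st; apply: derivable_line; exact: dg.
have C (a b : R) : (forall s : R, s \in `[a, b] -> `|s| <= `|t|) ->
    {within `[a, b], continuous (fun s : R => g (z + s *: e))}.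
  by move=> ab; apply: derivable_within_continuous => s /ab /D[].
have [t0|t0] := leP 0 t.
  have I (s : R) : s \in `[0, t] -> `|s| <= `|t|.
    by rewrite in_itv/= => /andP[s0 st]; rewrite !ger0_norm.
  have [|c ct E] := @MVT_segment R _ (fun s => 'D_e g (z + s *: e)) 0 t t0 _
      (C _ _ I).
    by move=> x /subset_itv_oo_cc /I; exact: D.
  exists c; first exact: I.
  by move: E; rewrite scale0r addr0 subr0 mulrC.
have I (s : R) : s \in `[t, 0] -> `|s| <= `|t|.
  rewrite in_itv/= => /andP[s0 st].
  by rewrite !ler0_norm ?lerN2 // ltW.
have [|c ct E] := @MVT_segment R _ (fun s => 'D_e g (z + s *: e)) t 0 (ltW t0) _
      (C _ _ I).
  by move=> x /subset_itv_oo_cc /I; exact: D.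
exists c; first exact: I.
move: E; rewrite scale0r addr0 sub0r mulrN => E.
by rewrite -opprB E mulrC opprK.
Qed.

(** The increment of [g] is split into steps along one coordinate each; the mean value theorem turns
    each step into a partial derivative at a nearby point, which is close to the one at [x]. *)
Lemma continuous_partials_differentiable (n : nat) (g : 'rV[R]_n -> R) (x : 'rV[R]_n) :
  (\forall y \near x, forall i, derivable g y (basis_vec R i)) ->
  (forall i, {for x, continuous (fun y => 'D_(basis_vec R i) g y)}) ->
  differentiable g x.
Proof.
move=> dg cg.
pose dgx (h : 'rV[R]_n) : R := (h *m (\col_i 'D_(basis_vec R i) g x)) 0 0.
have dgE h : dgx h = \sum_i h 0 i * 'D_(basis_vec R i) g x.
  by rewrite /dgx mxE; under eq_bigr do rewrite mxE.
have lin : linear dgx.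
  by move=> a u v; rewrite /dgx mulmxDl -scalemxAl !mxE.
pose L : {linear 'rV[R]_n -> R} :=
  HB.pack dgx (GRing.isLinear.Build _ _ _ _ dgx lin).
have cL : continuous L.
  move=> y; rewrite [L : _ -> _](_ : _ = fun h : 'rV[R]_n => \sum_i h 0 i * 'D_(basis_vec R i) g x).
    apply: (@continuous_sum _ _ _ (fun i (h : 'rV[R]_n) => h 0 i * 'D_(basis_vec R i) g x)) => i.
    by apply: continuousM; [exact: row_coord_continuous|exact: cst_continuous].
  by apply/funext => h; exact: dgE.
have inc : (g : 'rV[R]_n -> R^o) \o shift x =
    (cst (g x) : 'rV[R]_n -> R^o) + (L : 'rV[R]_n -> R^o) +o_ (0 : 'rV[R]_n) id.
  apply/(@eqaddoP R 'rV[R]_n R^o 'rV[R]_n (nbhs_filter_on (0 : 'rV[R]_n))) => _/posnumP[eps].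
  (* The n coordinate steps each contribute an error of at most e |h|, in total at most eps |h|;
     adding 1 covers n = 0. *)
  pose e := eps%:num / (n%:R + 1).
  have n1 : 0 < n%:R + 1 :> R by rewrite ltr_wpDl.
  have e0 : 0 < e by rewrite divr_gt0.
  have : \forall y \near x, forall i, derivable g y (basis_vec R i) /\
      `|'D_(basis_vec R i) g y - 'D_(basis_vec R i) g x| <= e.
    have : \forall y \near x, forall i,
      `|'D_(basis_vec R i) g y - 'D_(basis_vec R i) g x| <= e.
      apply: (@filter_forall _ _ _ (nbhs x) (nbhs_filter x)) => i.
      have /cvgrPdist_le /(_ _ e0) := cg i.
      by apply: filterS => y; rewrite distrC.
    move: dg; apply: filterS2 => y d c i; split; [exact: d|exact: c].
  case/nbhs_ballP => r /= r0 rP.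
  apply/nbhs_ballP; exists r => //= h; rewrite -ball_normE /= sub0r normrN => hr.
  (* The corners of the path from [x] to [h + x]: at [z k] the first k coordinates have been
     moved. *)
  pose z (k : nat) : 'rV[R]_n := x + \row_i (if (i < k)%N then h 0 i else 0).
  have z0 : z 0%N = x.
    by apply/rowP => i; rewrite !mxE ltn0 addr0.
  have zn : z n = h + x.
    by apply/rowP => i; rewrite !mxE ltn_ord addrC.
  have zS (i : 'I_n) : z i.+1 = z i + h 0 i *: basis_vec R i.
    apply/rowP => j; rewrite !mxE /= ltnS leq_eqVlt -addrA; congr (_ + _).
    have [/val_inj ->|ji] := eqVneq (j : nat) i.
      by rewrite ltnn eqxx mulr1 add0r.
    rewrite /=; have -> : (j == i) = false by apply/eqP => E; rewrite E eqxx in ji.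
    by rewrite mulr0 addr0.
  have step (i : 'I_n) :
      `|g (z i.+1) - g (z i) - h 0 i * 'D_(basis_vec R i) g x| <= e * `|h|.
    have hi : `|h 0 i| <= `|h|.
      rewrite [leRHS]/Num.norm /= mx_normrE.
      exact: (le_bigmax _ (fun ij => `|h ij.1 ij.2|) (0, i)).
    have B s : `|s| <= `|h 0 i| -> ball x r (z i + s *: basis_vec R i).
      move=> sh; rewrite -ball_normE /=; apply: le_lt_trans hr.
      rewrite opprD addrA /z opprD addrA subrr add0r -opprD normrN.
      rewrite [leLHS]/Num.norm /= mx_normrE; apply: bigmax_le => // -[a j] _ /=.
      rewrite [a]ord1 !mxE.
      have hj : `|h 0 j| <= `|h|.
        rewrite [leRHS]/Num.norm /= mx_normrE.
        exact: (le_bigmax _ (fun ij => `|h ij.1 ij.2|) (0, j)).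
      have [->|ji] := eqVneq j i.
        by rewrite ltnn eqxx mulr1 add0r (le_trans sh).
      by rewrite /= mulr0 addr0; case: ifP; rewrite ?normr0.
    have [|s sh E] := @line_mvt n g (z i) (basis_vec R i) (h 0 i).
      by move=> s /B /rP /(_ i)[].
    rewrite zS E -mulrBr normrM mulrC ler_pM //.
    by have [] := rP _ (B _ sh) i.
  rewrite -[(g \o shift x - _) _]/(g (h + x) - (g x + dgx h)) dgE -zn -{1}z0.
  have -> : g (z n) - (g (z 0%N) + \sum_i h 0 i * 'D_(basis_vec R i) g x) =
      \sum_(i < n) (g (z i.+1) - g (z i) - h 0 i * 'D_(basis_vec R i) g x).
    rewrite big_split /= -(big_mkord xpredT (fun i => g (z i.+1) - g (z i))).
    rewrite (@telescope_sumr _ 0 n (fun i => g (z i))) // opprD addrA.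
    by rewrite sumrN.
  apply: le_trans (ler_norm_sum _ _ _) _.
  apply: le_trans (ler_sum _ (fun i _ => step i)) _.
  rewrite sumr_const card_ord -mulr_natl mulrA ler_wpM2r //.
  rewrite /e mulrCA ger_pMr //.
  by rewrite ler_pdivrMr // mul1r lerDl.
have dE := diff_unique cL inc.
by apply/diff_locallyP; rewrite dE.
Qed.

End Differentiation.

Section ChainRule.
Variable R : realType.
Local Notation "''d_' i" := (basis_vec R i) (at level 10, i at level 2).

Lemma derive_line (n : nat) (f : 'rV[R]_n -> R) (x v : 'rV[R]_n) :
  'D_1 (fun h : R => f (h *: v + x)) 0 = 'D_v f x.
Proof.
rewrite /derive; set g1 := fun h => h^-1 *: _; set g2 := fun h => h^-1 *: _.
suff -> : g1 = g2 by [].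
by apply/funext => h; rewrite /g1 /g2 /= addr0 scale0r add0r [_%:A]mulr1.
Qed.

Lemma diff_basis (n : nat) (g : 'rV[R]_n -> R) (y u : 'rV[R]_n) :
  differentiable g y -> 'd g y u = \sum_j 'D_('d_ j) g y * u 0 j.
Proof.
move=> dg; rewrite {1}(row_sum_delta u) linear_sum; apply: eq_bigr => j _.
by rewrite linearZ /= mulrC; congr (_ * _); rewrite (deriveE _ dg).
Qed.

(** Derivatives of [phi] along [v] suffice: on the line through [x] it is a curve, and for curves
    derivability and differentiability coincide. *)
Lemma chain_rule (k n : nat) (phi : 'rV[R]_k -> 'rV[R]_n) (g : 'rV[R]_n -> R)
    (x v : 'rV[R]_k) :
  (forall j, derivable (fun y => phi y 0 j) x v) ->
  differentiable g (phi x) ->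
  is_derive x v (g \o phi)
    (\sum_j 'D_('d_ j) g (phi x) * 'D_v (fun y => phi y 0 j) x).
Proof.
move=> dphi dg.
pose c (h : R) := phi (h *: v + x).
have dc : derivable c 0 1.
  apply/derivable_mxP => i j; rewrite [i]ord1.
  by have /derivable1P := dphi j.
have c0 : c 0 = phi x by rewrite /c scale0r add0r.
have dcd : differentiable c 0 by apply/derivable1_diffP.
have dgc : differentiable g (c 0) by rewrite c0.
have dgcc : differentiable (g \o c) 0 by exact: differentiable_comp.
split; first by apply/derivable1P/derivable1_diffP.
rewrite -derive_line (deriveE _ dgcc) diff_comp //=.
rewrite (diff_basis _ dgc) c0; apply: eq_bigr => j _; congr (_ * _).
by rewrite -(deriveE _ dcd) derive_mx // mxE -[RHS]derive_line.
Qed.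

End ChainRule.

(** * Functions of class C^m *)

Section Cm.
Variable R : realType.
Local Notation "''d_' i" := (basis_vec R i) (at level 10, i at level 2).

Lemma Cm_on_continuous (n m : nat) (U : set 'rV[R]_n) f x :
  Cm_on m U f -> U x -> {for x, continuous f}.
Proof. by case: m => [|m] [cf _]; exact: cf. Qed.

Lemma Cm_on_derivable (n m : nat) (U : set 'rV[R]_n) f i x :
  Cm_on m.+1 U f -> U x -> derivable f x ('d_ i).
Proof. by move=> [_ /(_ i)[df _]]; exact: df. Qed.

Lemma Cm_on_subset (n m : nat) (U V : set 'rV[R]_n) f :
  V `<=` U -> Cm_on m U f -> Cm_on m V f.
Proof.
move=> VU; elim: m f => [|m IH] f [cf df]; split=> //.
- by move=> x /VU; exact: cf.
- by move=> x /VU; exact: cf.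
- by move=> i; have [di Di] := df i; split; [move=> x /VU; exact: di|exact: IH].
Qed.

Lemma Cm_on_pred (n m : nat) (U : set 'rV[R]_n) f : Cm_on m.+1 U f -> Cm_on m U f.
Proof.
elim: m f => [|m IH] f [cf df]; split=> //.
by move=> i; have [di Di] := df i; split=> //; exact: IH.
Qed.

Lemma open_near_eq (n : nat) (U : set 'rV[R]_n) (f g : 'rV[R]_n -> R) x :
  open U -> U x -> {in U, f =1 g} -> \forall y \near x, f y = g y.
Proof.
move=> oU Ux fg; have : nbhs x U by exact: open_nbhs_nbhs.
by apply: filterS => y Uy; apply: fg; rewrite inE.
Qed.

Lemma Cm_on_ext (n m : nat) (U : set 'rV[R]_n) f g :
  open U -> {in U, f =1 g} -> Cm_on m U f -> Cm_on m U g.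
Proof.
move=> oU; elim: m f g => [|m IH] f g fg [cf df].
  split=> // x Ux; have fgx := open_near_eq oU Ux fg.
  rewrite /prop_for /continuous_at -(fg x) ?inE //.
  exact: cvg_trans (near_eq_cvg fgx) (cf _ Ux).
split.
  move=> x Ux; have fgx := open_near_eq oU Ux fg.
  rewrite /prop_for /continuous_at -(fg x) ?inE //.
  exact: cvg_trans (near_eq_cvg fgx) (cf _ Ux).
move=> i; have [di Di] := df i; split.
  by move=> x Ux; exact: near_eq_derivable (open_near_eq oU Ux fg) (di _ Ux).
apply: IH Di => x; rewrite inE => Ux.
exact/near_eq_derive/(open_near_eq oU Ux fg).
Qed.

Lemma Cm_on_cst (n m : nat) (U : set 'rV[R]_n) (a : R) : Cm_on m U (cst a).
Proof.
elim: m a => [|m IH] a; split=> //; try by move=> x _; exact: cst_continuous.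
move=> i; split; first by move=> x _; exact: derivable_cst.
have -> : (fun x => 'D_('d_ i) (cst a) x) = cst (0:R).
  by apply/funext => x; exact: derive_cst.
exact: IH.
Qed.

Lemma derive_coord (n : nat) (j : 'I_n) (x v : 'rV[R]_n) :
  is_derive x v (fun y : 'rV[R]_n => y 0 j) (v 0 j).
Proof.
have dj : differentiable (fun y : 'rV[R]_n => y 0 j) x by exact: differentiable_coord.
split; first exact: diff_derivable.
rewrite /derive; apply: lim_near_cst => //=.
near=> h; rewrite !mxE addrK -[_ *: _]/(_ * _) mulKf //.
by near: h; exact: nbhs_dnbhs_neq.
Unshelve. all: by end_near. Qed.

Lemma Cm_on_coord (n m : nat) (U : set 'rV[R]_n) (j : 'I_n) :
  Cm_on m U (fun y => y 0 j).
Proof.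
case: m => [|m]; split=> //; try by move=> x _; exact: row_coord_continuous.
move=> i; split; first by move=> x _; have [] := derive_coord j x ('d_ i).
have -> : (fun x : 'rV_n => 'D_('d_ i) (fun y : 'rV_n => y 0 j) x) = cst ('d_ i 0 j).
  by apply/funext => x; have [] := derive_coord j x ('d_ i).
exact: Cm_on_cst.
Qed.

Lemma Cm_onD (n m : nat) (U : set 'rV[R]_n) f g : open U ->
  Cm_on m U f -> Cm_on m U g -> Cm_on m U (fun x => f x + g x).
Proof.
move=> oU; elim: m f g => [|m IH] f g [cf df] [cg dg]; split=> //;
  try by move=> x Ux; exact: continuousD (cf _ Ux) (cg _ Ux).
move=> i; have [di Di] := df i; have [ei Ei] := dg i; split.
  by move=> x Ux; exact: derivableD (di _ Ux) (ei _ Ux).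
apply: (Cm_on_ext oU _ (IH _ _ Di Ei)) => x; rewrite inE => Ux.
by rewrite -deriveD //; [exact: di|exact: ei].
Qed.

Lemma Cm_onM (n m : nat) (U : set 'rV[R]_n) f g : open U ->
  Cm_on m U f -> Cm_on m U g -> Cm_on m U (fun x => f x * g x).
Proof.
move=> oU; elim: m f g => [|m IH] f g Cf Cg; have [cf df] := Cf;
  have [cg dg] := Cg; split=> //;
  try by move=> x Ux; exact: continuousM (cf _ Ux) (cg _ Ux).
move=> i; have [di Di] := df i; have [ei Ei] := dg i; split.
  by move=> x Ux; exact: derivableM (di _ Ux) (ei _ Ux).
apply: (Cm_on_ext oU _ (Cm_onD oU (IH _ _ (Cm_on_pred Cf) Ei)
  (IH _ _ (Cm_on_pred Cg) Di))) => x; rewrite inE => Ux.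
by rewrite -[_ + _](deriveM (di _ Ux) (ei _ Ux)).
Qed.

Lemma Cm_on_sum (n m : nat) (U : set 'rV[R]_n) (I : Type) (r : seq I)
    (f : I -> 'rV[R]_n -> R) : open U ->
  (forall i, Cm_on m U (f i)) -> Cm_on m U (fun x => \sum_(i <- r) f i x).
Proof.
move=> oU Cf; elim: r => [|i r IH].
  by under eq_fun do rewrite big_nil; exact: Cm_on_cst.
by under eq_fun do rewrite big_cons; exact: Cm_onD.
Qed.

Lemma Cm_on_prod (n m : nat) (U : set 'rV[R]_n) (I : Type) (r : seq I)
    (f : I -> 'rV[R]_n -> R) : open U ->
  (forall i, Cm_on m U (f i)) -> Cm_on m U (fun x => \prod_(i <- r) f i x).
Proof.
move=> oU Cf; elim: r => [|i r IH].
  by under eq_fun do rewrite big_nil; exact: Cm_on_cst.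
by under eq_fun do rewrite big_cons; exact: Cm_onM.
Qed.

Lemma Cm_on_differentiable (n m : nat) (U : set 'rV[R]_n) f x : open U ->
  Cm_on m.+1 U f -> U x -> differentiable f x.
Proof.
move=> oU Cf Ux; apply: continuous_partials_differentiable.
  have : nbhs x U by exact: open_nbhs_nbhs.
  by apply: filterS => y Uy i; exact: Cm_on_derivable Cf Uy.
by move=> i; have [_ /(_ i)[_ Di]] := Cf; exact: Cm_on_continuous Di Ux.
Qed.

Lemma row_continuous (k n : nat) (phi : 'rV[R]_k -> 'rV[R]_n) x :
  (forall j, {for x, continuous (fun y => phi y 0 j)}) -> {for x, continuous phi}.
Proof.
move=> c; apply/(@cvgrPdist_le _ _ _ (nbhs x) (nbhs_filter x)) => e e0; near=> y.
rewrite [leLHS]/Num.norm /= mx_normrE; apply: bigmax_le => [|[a j] _ /=];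
  first exact: ltW.
rewrite !mxE [a]ord1 {a}; move: j.
near: y; apply: (@filter_forall _ _ _ (nbhs x) (nbhs_filter x)) => j.
by have /cvgrPdist_le /(_ _ e0) := c j.
Unshelve. all: by end_near. Qed.

Lemma Cm_on_comp (k n m : nat) (U : set 'rV[R]_k) (V : set 'rV[R]_n)
    (phi : 'rV[R]_k -> 'rV[R]_n) (g : 'rV[R]_n -> R) :
  open U -> open V -> (forall x, U x -> V (phi x)) ->
  (forall j, Cm_on m U (fun x => phi x 0 j)) -> Cm_on m V g ->
  Cm_on m U (fun x => g (phi x)).
Proof.
move=> oU oV UV; elim: m g => [|m IH] g Cphi Cg.
  split=> // x Ux; apply: (@continuous_comp _ _ _ phi g).
    by apply: row_continuous => j; exact: Cm_on_continuous (Cphi j) Ux.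
  exact: Cm_on_continuous Cg (UV _ Ux).
have chain i x : U x -> is_derive x ('d_ i) (fun x => g (phi x))
    (\sum_j 'D_('d_ j) g (phi x) * 'D_('d_ i) (fun y => phi y 0 j) x).
  move=> Ux; apply: chain_rule; last exact: Cm_on_differentiable Cg (UV _ Ux).
  by move=> j; exact: Cm_on_derivable (Cphi j) Ux.
split.
  move=> x Ux; apply: (@continuous_comp _ _ _ phi g).
    by apply: row_continuous => j; exact: Cm_on_continuous (Cphi j) Ux.
  exact: Cm_on_continuous Cg (UV _ Ux).
move=> i; split; first by move=> x /(chain i)[].
pose D x := \sum_j 'D_('d_ j) g (phi x) * 'D_('d_ i) (fun y => phi y 0 j) x.
apply: (@Cm_on_ext _ _ _ D) => //.
  by move=> x; rewrite inE => /(chain i)[].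
apply: Cm_on_sum => // j; apply: Cm_onM => //.
  apply: (IH (fun y => 'D_('d_ j) g y)).
    by move=> l; exact: Cm_on_pred.
  by have [_ /(_ j)[]] := Cg.
by have [_ /(_ i)[]] := Cphi j.
Qed.

End Cm.

(** * Smooth functions of one variable *)

Section Smooth1.
Variable R : realType.
Implicit Types u v w : R -> R.

(** Peels off the first derivative rather than the last, so that the product and chain rules go by
    induction on the order. *)
Fixpoint D1 (m : nat) u : Prop :=
  if m is m'.+1 then (forall x, derivable u x 1) /\ D1 m' (derive1 u) else True.

Definition smooth1 u := forall m x, derivable (derive1n m u) x 1.

Lemma smooth1P u : smooth1 u <-> forall m, D1 m u.
Proof.
split=> [su m|Du m].
  elim: m u su => // m IH u su; split; first exact: (su 0%N).
  by apply: IH => k x; rewrite -derive1Sn; exact: su.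
elim: m u Du => [|m IH] u Du x; first by have [] := Du 1%N.
by rewrite derive1Sn; apply: IH => k; have [] := Du k.+1.
Qed.

Lemma smooth1_derive u : smooth1 u -> smooth1 (derive1 u).
Proof. by move=> su m x; rewrite -derive1Sn; exact: su. Qed.

Lemma D1_pred m u : D1 m.+1 u -> D1 m u.
Proof. by elim: m u => // m IH u [du Du]; split=> //; exact: IH. Qed.

Lemma D1_is_derive m u (x : R) : D1 m.+1 u -> is_derive x (1:R) u ((derive1 u) x).
Proof. by case=> du _; rewrite derive1E; exact: derivableP. Qed.

Lemma D1_step m u w : (forall x, is_derive x (1:R) u (w x)) -> D1 m w -> D1 m.+1 u.
Proof.
move=> uw Dw; split; first by move=> x; have [] := uw x.
suff -> : (derive1 u) = w by [].
by apply/funext => x; rewrite derive1E; have [] := uw x.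
Qed.

Lemma D1_cst m (a : R) : D1 m (cst a).
Proof.
elim: m a => // m IH a; apply: (@D1_step m (cst a) (cst 0)); exact: IH.
Qed.

Lemma D1D m u v : D1 m u -> D1 m v -> D1 m (fun x => u x + v x).
Proof.
elim: m u v => // m IH u v Du Dv.
apply: (@D1_step _ _ (fun x => (derive1 u) x + (derive1 v) x)) => [x|].
  exact: is_deriveD (D1_is_derive _ Du) (D1_is_derive _ Dv).
by apply: IH; [case: Du|case: Dv].
Qed.

Lemma D1M m u v : D1 m u -> D1 m v -> D1 m (fun x => u x * v x).
Proof.
elim: m u v => // m IH u v Du Dv.
apply: (@D1_step _ _ (fun x => u x * (derive1 v) x + v x * (derive1 u) x)) => [x|].
  exact: is_deriveM (D1_is_derive _ Du) (D1_is_derive _ Dv).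
apply: D1D; apply: IH; do ?exact: D1_pred; [by case: Dv|by case: Du].
Qed.

Lemma D1_comp m u v : D1 m u -> D1 m v -> D1 m (fun x => u (v x)).
Proof.
elim: m u v => // m IH u v Du Dv.
apply: (@D1_step _ _ (fun x => (derive1 u) (v x) * (derive1 v) x)) => [x|].
  have du := D1_is_derive (v x) Du; have dv := D1_is_derive x Dv.
  split.
    apply/derivable1_diffP/(@differentiable_comp _ _ _ _ v u);
      by apply/derivable1_diffP; case: Du; case: Dv.
  by rewrite -derive1E (@derive1_comp _ v u).
apply: D1M; last by case: Dv.
by apply: (IH (derive1 u) v); [case: Du|exact: D1_pred].
Qed.

Lemma D1V m u : (forall x, u x != 0) -> D1 m u -> D1 m (fun x => (u x)^-1).
Proof.
move=> u0; elim: m => // m IH Du.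
have IHm := IH (D1_pred Du).
apply: (@D1_step _ _ (fun x => - (derive1 u) x * ((u x)^-1 * (u x)^-1))) => [x|].
  have := is_deriveV (u0 x) (D1_is_derive x Du).
  move=> h; apply: is_derive_eq h _.
  by rewrite -[_ *: _]/(_ * _) -exprVn expr2 mulNr mulrC mulNr.
apply: D1M; last exact: D1M.
under eq_fun do rewrite -mulN1r.
by apply: D1M; [exact: D1_cst|case: Du].
Qed.

Lemma D1_id m : D1 m id.
Proof.
case: m => // m; apply: (@D1_step m id (cst 1)); exact: D1_cst.
Qed.

(** Each difference quotient of [F] at [x] is one of [f] or one of [g], and both kinds tend to [d].
    This is the differentiability of a function defined by cases at its seam. *)
Lemma is_derive_either (f g F : R -> R) (x d : R) :
  is_derive x (1:R) f d -> is_derive x (1:R) g d -> F x = f x -> F x = g x ->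
  (\forall y \near x, F y = f y \/ F y = g y) -> is_derive x (1:R) F d.
Proof.
move=> [df fd] [dg gd] Ff Fg E.
have cf : h^-1 *: (f (h *: 1 + x) - f x) @[h --> 0^'] --> d by rewrite -fd.
have cg : h^-1 *: (g (h *: 1 + x) - g x) @[h --> 0^'] --> d by rewrite -gd.
have cF : h^-1 *: (F (h *: 1 + x) - F x) @[h --> 0^'] --> d.
  apply/cvgrPdist_le => e e0.
  have /cvgrPdist_le /(_ _ e0) Hf := cf.
  have /cvgrPdist_le /(_ _ e0) Hg := cg.
  have HE : \forall h \near 0^', F (h *: 1 + x) = f (h *: 1 + x) \/
      F (h *: 1 + x) = g (h *: 1 + x).
    apply: nbhs_dnbhs => /=.
    have c : (fun h : R => h *: (1:R) + x) @ 0 --> x.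
      rewrite -{2}[x]add0r -{2}[0](mul0r 1).
      by apply: cvgD; [apply: cvgM; [exact: cvg_id|exact: cvg_cst]|exact: cvg_cst].
    exact: (c _ E).
  near=> h.
  have [->|->] : F (h *: 1 + x) = f (h *: 1 + x) \/
      F (h *: 1 + x) = g (h *: 1 + x) by near: h.
    by rewrite Ff; near: h.
  by rewrite Fg; near: h.
split; first by apply/cvg_ex; exists d.
exact: (cvg_lim _ cF).
Unshelve. all: by end_near. Qed.

(** The counterpart of [Cm_on_comp] for an outer function on R, differentiated with [derive1],
    instead of one on row vectors. *)
Lemma Cm_on_comp1 (n m : nat) (U : set 'rV[R]_n) (f : 'rV[R]_n -> R) u :
  open U -> Cm_on m U f -> smooth1 u -> Cm_on m U (fun x => u (f x)).
Proof.
move=> oU; elim: m u => [|m IH] u Cf su.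
  split=> // x Ux; apply: continuous_comp; first exact: Cm_on_continuous Cf Ux.
  by apply: differentiable_continuous; apply/derivable1_diffP/(su 0%N).
have chain i x : U x -> is_derive x (basis_vec R i) (fun x => u (f x))
    ((derive1 u) (f x) * 'D_(basis_vec R i) f x).
  move=> Ux; have df := Cm_on_differentiable oU Cf Ux.
  have /derivable1_diffP du := su 0%N (f x).
  have duf := differentiable_comp df du.
  split; first exact: diff_derivable.
  rewrite (deriveE _ duf) diff_comp //= (deriveE _ df) derive1E (deriveE _ du).
  by rewrite -[X in 'd u (f x) X = _]mulr1 linearZ /= mulrC.
split.
  move=> x Ux; apply: continuous_comp; first exact: Cm_on_continuous Cf Ux.
  by apply: differentiable_continuous; apply/derivable1_diffP/(su 0%N).
move=> i; split; first by move=> x /(chain i)[].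
apply: (@Cm_on_ext _ _ _ _ (fun x => (derive1 u) (f x) * 'D_(basis_vec R i) f x)) => //.
  by move=> x; rewrite inE => /(chain i)[].
apply: Cm_onM => //; last by have [_ /(_ i)[]] := Cf.
by apply: IH; [exact: Cm_on_pred|exact: smooth1_derive].
Qed.

End Smooth1.

(** * Constant extension of flat reparametrizations *)

Section Clamp.
Variable R : realType.

(** The right-hand value is a parameter because smoothness is proved by passing from [tau], with [c]
    = 1, to its derivatives, with [c] = 0. *)
Definition cut (c : R) (u : R -> R) (t : R) : R :=
  if t <= 0 then 0 else if 1 <= t then c else u t.

Lemma cut_in c (u : R -> R) t : u 0 = 0 -> u 1 = c -> 0 <= t <= 1 -> cut c u t = u t.
Proof.
move=> u0 u1 /andP[t0 t1]; rewrite /cut.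
case: ifPn => [tn|_]; first by have -> : t = 0 by lra.
by case: ifPn => [t1'|//]; have -> : t = 1 by lra.
Qed.

Lemma cut_le0 c (u : R -> R) t : t <= 0 -> cut c u t = 0.
Proof. by rewrite /cut => ->. Qed.

Lemma cut_ge1 c (u : R -> R) t : 1 <= t -> cut c u t = c.
Proof.
by move=> t1; rewrite /cut t1; case: ifPn => // t0; exfalso; lra.
Qed.

(** At 0 and 1 the constant piece and [u] agree to first order, as [is_derive_either] requires; the
    derivative is again a cut function, which makes [D1_cut] an induction. *)
Lemma is_derive_cut c (u : R -> R) (x : R) :
  (forall x, derivable u x 1) -> u 0 = 0 -> u 1 = c -> (derive1 u) 0 = 0 -> (derive1 u) 1 = 0 ->
  is_derive x (1:R) (cut c u) (cut 0 (derive1 u) x).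
Proof.
move=> du u0 u1 d0 d1.
have du' y : is_derive y (1:R) u ((derive1 u) y) by rewrite derive1E; exact: derivableP.
have [x0|x0|x0] := ltrgtP x 0.
- rewrite cut_le0 ?ltW //; apply: (near_eq_is_derive _ (is_derive_cst (0:R) x 1)).
  near=> y; rewrite cut_le0 // ltW //; near: y; exact: lt_nbhsl.
- have [x1|x1|x1] := ltrgtP x 1.
  + rewrite cut_in ?ltW //; apply: near_eq_is_derive (du' x).
    near=> y; rewrite cut_in //; apply/andP; split; apply/ltW; near: y.
      exact: lt_nbhsr.
    exact: lt_nbhsl.
  + rewrite cut_ge1 ?ltW //; apply: (near_eq_is_derive _ (is_derive_cst c x 1)).
    near=> y; rewrite cut_ge1 // ltW //; near: y; exact: lt_nbhsr.
  + rewrite x1 cut_ge1 //.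
    apply: (is_derive_either (f := cst c) (g := u)).
    * by rewrite -d1.
    * by rewrite cut_ge1.
    * by rewrite cut_ge1.
    near=> y; have [y1|y1] := leP 1 y; [left|right]; first by rewrite cut_ge1.
    rewrite cut_in // (ltW y1) andbT; apply/ltW; near: y.
    by apply: lt_nbhsr.
- rewrite x0 cut_le0 //.
  apply: (is_derive_either (f := cst 0) (g := u)).
  + by have := du' 0; rewrite d0.
  + by rewrite cut_le0.
  + by rewrite cut_le0.
  near=> y; have [y1|y1] := leP y 0; [left|right]; first by rewrite cut_le0.
  rewrite cut_in // (ltW y1) /=; apply/ltW; near: y.
  by apply: lt_nbhsl.
Unshelve. all: by end_near. Qed.

Lemma D1_cut m c (u : R -> R) : smooth1 u -> u 0 = 0 -> u 1 = c ->
  (forall k, derive1n k.+1 u 0 = 0 /\ derive1n k.+1 u 1 = 0) -> D1 m (cut c u).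
Proof.
elim: m c u => // m IH c u su u0 u1 fu.
have [d0 d1] := fu 0%N; rewrite !derive1n1 in d0 d1.
apply: (@D1_step _ _ _ (cut 0 (derive1 u))).
  by move=> x; apply: is_derive_cut => //; exact: (su 0%N).
apply: IH => //; first exact: smooth1_derive.
by move=> k; rewrite -!derive1Sn; exact: fu.
Qed.

Definition clamp (tau : R -> R) := cut 1 tau.

Lemma smooth1_clamp (tau : R -> R) : flat_reparam tau -> smooth1 (clamp tau).
Proof. by move=> [dt _ t0 t1 ft]; apply/smooth1P => m; exact: D1_cut. Qed.

Lemma derive_clamp (tau : R -> R) t : flat_reparam tau -> 0 <= t <= 1 ->
  derive1 (clamp tau) t = (derive1 tau) t.
Proof.
move=> [dt _ t0 t1 ft] t01; have [d0 d1] := ft 0%N; rewrite !derive1n1 in d0 d1.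
have [_] := is_derive_cut t (dt 0%N) t0 t1 d0 d1.
by rewrite -derive1E => ->; rewrite cut_in.
Qed.

Lemma derive_clamp_out (tau : R -> R) t : flat_reparam tau -> t <= 0 \/ 1 <= t ->
  derive1 (clamp tau) t = 0.
Proof.
move=> [dt _ t0 t1 ft] tt; have [d0 d1] := ft 0%N; rewrite !derive1n1 in d0 d1.
have [_] := is_derive_cut t (dt 0%N) t0 t1 d0 d1.
by rewrite -derive1E => ->; case: tt => ?; [rewrite cut_le0|rewrite cut_ge1].
Qed.

Lemma clamp01 (tau : R -> R) t : flat_reparam tau -> 0 <= clamp tau t <= 1.
Proof.
move=> [_ t01 t0 t1 _]; rewrite /clamp /cut; case: ifPn => [|tp]; first by lra.
by case: ifPn => [|t1']; [lra|apply: t01; lra].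
Qed.

End Clamp.

(** * A flat reparametrization built from exp(-1/t) *)

Section FlatStep.
Variable R : realType.

Lemma D1N m (u : R -> R) : D1 m u -> D1 m (fun x => - u x).
Proof.
move=> Du; have -> : (fun x => - u x) = (fun x => -1 * u x).
  by apply/funext => x; rewrite mulN1r.
by apply: D1M => //; exact: D1_cst.
Qed.

(** The powers of 1/t make the family closed, up to linear combinations, under differentiation;
    [psi 0] is the classical flat function. *)
Definition psi (k : nat) (t : R) : R :=
  if t <= 0 then 0 else t^-1 ^+ k * expR (- t^-1).

Lemma psi_le0 k t : t <= 0 -> psi k t = 0.
Proof. by rewrite /psi => ->. Qed.

Lemma psi_gt0E k t : 0 < t -> psi k t = t^-1 ^+ k * expR (- t^-1).
Proof. by rewrite /psi leNgt => ->. Qed.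

Lemma psi_ge0 k t : 0 <= psi k t.
Proof.
have [t0|t0] := leP t 0; first by rewrite psi_le0.
by rewrite psi_gt0E // mulr_ge0 ?expR_ge0 // exprn_ge0 // invr_ge0 ltW.
Qed.

Lemma psi_gt0 t : (0 < psi 0 t) = (0 < t).
Proof.
have [t0|t0] := leP t 0; first by rewrite psi_le0 // ltxx.
by rewrite psi_gt0E // expr0 mul1r expR_gt0.
Qed.

(** For t > 0 and u = 1/t this says u^(k+1) e^(-u) <= (k+1)^(k+1), which is the power k+1 of v <=
    e^v at v = u/(k+1). *)
Lemma psi_le k t : psi k t <= k.+1%:R ^+ k.+1 * `|t|.
Proof.
have [t0|t0] := leP t 0; first by rewrite psi_le0 // mulr_ge0 // exprn_ge0.
rewrite psi_gt0E // gtr0_norm //; set u := t^-1.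
have u0 : 0 < u by rewrite invr_gt0.
have -> : t = u^-1 by rewrite invrK.
rewrite ler_pdivlMr // mulrAC -exprSr expRN ler_pdivrMr ?expR_gt0 //.
have n0 : 0 < k.+1%:R :> R by [].
have -> : expR u = expR (u / k.+1%:R) ^+ k.+1.
  by rewrite -expRM_natl mulrC divfK ?gt_eqF.
rewrite -exprMn lerXn2r ?nnegrE ?mulr_ge0 ?expR_ge0 ?(ltW u0) ?(ltW n0) //.
rewrite mulrC -ler_pdivrMr //; apply: le_trans (expR_ge1Dx _).
by rewrite lerDr.
Qed.

Lemma is_derive_psi k (t : R) :
  is_derive t (1:R) (psi k) (psi k.+2 t - k%:R * psi k.+1 t).
Proof.
have [t0|t0|->] := ltrgtP t 0.
- rewrite !psi_le0 ?ltW // mulr0 subr0.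
  apply: (near_eq_is_derive _ (is_derive_cst (0:R) t (1:R))).
  near=> y; rewrite psi_le0 // ltW //; near: y; exact: lt_nbhsl.
- have dV : is_derive t (1:R) (fun y => y^-1) (- t ^- 2).
    have tn : id t != 0 :> R by rewrite gt_eqF.
    have := is_deriveV tn (is_derive_id t 1).
    by rewrite [_ *: 1]mulr1.
  have dN : is_derive t (1:R) (fun y => - y^-1) (t ^- 2).
    by apply: is_derive_eq (is_deriveN dV) _; rewrite opprK.
  have dE : is_derive t (1:R) (fun y => expR (- y^-1)) (expR (- t^-1) * t ^- 2).
    exact: (@is_derive1_comp _ expR (fun y => - y^-1) t _ _ (is_derive_expR _) dN).
  have dX := @is_deriveX _ _ (fun y : R => y^-1) k t 1 _ dV.
  have eX : ((fun y : R => y^-1) : R -> R) ^+ k = (fun y : R => y^-1 ^+ k).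
    by apply/funext => y; rewrite exprfctE.
  rewrite eX in dX.
  have dM := is_deriveM dX dE.
  apply: (near_eq_is_derive (f := (fun y : R => y^-1 ^+ k * expR (- y^-1) : R))).
    near=> y; rewrite psi_gt0E //; near: y; exact: lt_nbhsr.
  apply: (is_derive_eq (V := R) (W := R) dM).
  rewrite !psi_gt0E // -!exprVn.
  move: (expR (- t^-1)) (t^-1) => e u; rewrite /GRing.scale /=.
  case: k {dX eX dM} => [|k] /=.
    by rewrite !expr0 !(mul0r, mulr0, mul1r, subr0, addr0) mulrC.
  by rewrite !exprS; ring.
- rewrite !psi_le0 // mulr0 subr0.
  suff c : h^-1 *: (psi k (h *: 1 + 0) - psi k 0) @[h --> 0^'] --> (0:R).
    by split; [apply/cvg_ex; exists 0|exact: (cvg_lim _ c)].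
  apply/cvgrPdist_le => e e0.
  near=> h.
  have h0 : h != 0 by near: h; exact: nbhs_dnbhs_neq.
  rewrite addr0 [_%:A]mulr1 [psi k 0]psi_le0 // subr0 sub0r normrN.
  (* The difference quotient at 0 is the next function of the family, which tends to 0 by
     [psi_le]. *)
  have -> : h^-1 *: psi k h = psi k.+1 h.
    rewrite /psi; case: ifP => _; first by rewrite scaler0.
    by rewrite -[_ *: _]/(_ * _) mulrA -exprS.
  rewrite ger0_norm ?psi_ge0 //; apply: le_trans (psi_le _ _) _.
  have C0 : 0 < k.+2%:R ^+ k.+2 :> R by rewrite exprn_gt0.
  rewrite -ler_pdivlMl // mulrC; near: h; apply: dnbhs0_le.
  by rewrite divr_gt0.
Unshelve. all: by end_near. Qed.

Lemma smooth1_psi k : smooth1 (psi k).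
Proof.
apply/smooth1P => m; elim: m k => // m IH k.
apply: D1_step (is_derive_psi k) _.
apply: D1D; first exact: IH.
under eq_fun do rewrite -mulNr.
by apply: D1M; [exact: D1_cst|exact: IH].
Qed.

(** The denominator never vanishes, as [t] and [1 - t] are not both nonpositive. *)
Definition flat_step (t : R) : R := psi 0 t / (psi 0 t + psi 0 (1 - t)).

Lemma psi_sum_gt0 t : 0 < psi 0 t + psi 0 (1 - t).
Proof.
have [t0|t0] := leP t 0.
  by rewrite ltr_wpDl ?psi_ge0 // psi_gt0; lra.
by rewrite ltr_pwDl ?psi_ge0 // psi_gt0.
Qed.

Lemma smooth1_flat_step : smooth1 flat_step.
Proof.
apply/smooth1P => m.
have /smooth1P/(_ m) Dp := @smooth1_psi 0%N.
apply: D1M => //; apply: D1V => [t|]; first by rewrite gt_eqF // psi_sum_gt0.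
apply: D1D => //; apply: D1_comp => //.
by apply: D1D; [exact: D1_cst|apply: (@D1N m id); exact: D1_id].
Qed.

Lemma flat_step_le0 t : t <= 0 -> flat_step t = 0.
Proof. by move=> t0; rewrite /flat_step psi_le0 // mul0r. Qed.

Lemma flat_step_ge1 t : 1 <= t -> flat_step t = 1.
Proof.
move=> t1; rewrite /flat_step [psi 0 (1 - t)]psi_le0 ?subr_le0 // addr0 divff //.
by rewrite gt_eqF // psi_gt0; lra.
Qed.

Lemma derive1n_near_cst (u : R -> R) (c t : R) m :
  (\forall y \near t, u y = c) -> derive1n m.+1 u t = 0.
Proof.
have base v b y : (\forall z \near y, v z = b) -> derive1 v y = 0.
  by move=> vb; rewrite derive1E (@near_eq_derive _ _ _ v (cst b)) ?derive_cst.
elim: m u c t => [|m IH] u c t uc; first by rewrite derive1n1; exact: base uc.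
rewrite derive1Sn; apply: (IH _ 0).
(* Local constancy near [t] gives local constancy near every nearby point, so the first derivative
   vanishes on a neighbourhood of [t] and the induction applies to it. *)
have : \forall y \near t, \forall z \near y, u z = c by exact/near_join.
by apply: filterS => y; exact: base.
Qed.

Lemma continuous_near_eq0 (u : R -> R) (t : R) :
  {for t, continuous u} -> (forall e, 0 < e -> exists2 y, `|t - y| < e & u y = 0) ->
  u t = 0.
Proof.
move=> cu H; apply/eqP/negPn/negP => ut0.
have /cvgrPdist_lt /(_ `|u t|) := cu; rewrite normr_gt0 => /(_ ut0).
move=> /nbhs_ballP[e /= e0 He]; have [y ty uy] := H e e0.
have := He y; rewrite -ball_normE /= => /(_ ty).
by rewrite uy subr0 ltxx.
Qed.

(** The function is not locally constant at 0 and 1 themselves. It is so just outside [0, 1], and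
    its derivatives at the end points vanish by continuity. *)
Lemma flat_reparam_flat_step : flat_reparam flat_step.
Proof.
have cont m t : {for t, continuous (derive1n m flat_step)}.
  apply: differentiable_continuous; apply/derivable1_diffP.
  exact: smooth1_flat_step.
split.
- exact: smooth1_flat_step.
- move=> t _; have s0 := psi_sum_gt0 t; apply/andP; split.
    by rewrite divr_ge0 ?psi_ge0 // ltW.
  by rewrite ler_pdivrMr // mul1r lerDl psi_ge0.
- exact: flat_step_le0.
- exact: flat_step_ge1.
move=> m; split; apply: continuous_near_eq0; first exact: cont.
(* A point to the left of 0 within distance [e]; for the end point 1 below, a point to its right. *)
- move=> e e0; exists (- (e / 2)); first by rewrite opprK add0r ger0_norm; lra.
  apply: (@derive1n_near_cst _ 0); near=> y; apply: flat_step_le0.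
  apply/ltW; near: y; apply: lt_nbhsl; lra.
- exact: cont.
- move=> e e0; exists (1 + e / 2).
    by rewrite opprD addrA subrr sub0r normrN ger0_norm; lra.
  apply: (@derive1n_near_cst _ 1); near=> y; apply: flat_step_ge1.
  apply/ltW; near: y; apply: lt_nbhsr; lra.
Unshelve. all: by end_near. Qed.

End FlatStep.

(** * Smooth functions on the cube *)

Section SmoothOn.
Variable R : realType.

Lemma smooth_on_subset (n : nat) (U V : set 'rV[R]_n) f :
  V `<=` U -> smooth_on U f -> smooth_on V f.
Proof. by move=> VU sf m; exact: Cm_on_subset VU (sf m). Qed.

Lemma smooth_on_comp (k n : nat) (U : set 'rV[R]_k) (V : set 'rV[R]_n)
    (phi : 'rV[R]_k -> 'rV[R]_n) (g : 'rV[R]_n -> R) :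
  open U -> open V -> (forall x, U x -> V (phi x)) ->
  (forall j, smooth_on U (fun x => phi x 0 j)) -> smooth_on V g ->
  smooth_on U (fun x => g (phi x)).
Proof. by move=> oU oV UV sp sg m; apply: (Cm_on_comp oU oV UV) => // j; exact: sp. Qed.

Lemma smooth_on_continuous (n : nat) (U : set 'rV[R]_n) f x :
  smooth_on U f -> U x -> {for x, continuous f}.
Proof. by move=> sf; exact: Cm_on_continuous (sf 0%N). Qed.

Lemma smooth_on_derivable (n : nat) (U : set 'rV[R]_n) f i x :
  smooth_on U f -> U x -> derivable f x (basis_vec R i).
Proof. by move=> sf; exact: Cm_on_derivable (sf 1%N). Qed.

Lemma smooth_on_derive (n : nat) (U : set 'rV[R]_n) f i :
  smooth_on U f -> smooth_on U (fun x => 'D_(basis_vec R i) f x).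
Proof. by move=> sf m; have [_ /(_ i)[]] := sf m.+1. Qed.

Lemma smooth_on_differentiable (n : nat) (U : set 'rV[R]_n) f x : open U ->
  smooth_on U f -> U x -> differentiable f x.
Proof. by move=> oU sf; exact: Cm_on_differentiable (sf 1%N). Qed.

Lemma smooth_onD (n : nat) (U : set 'rV[R]_n) f g : open U ->
  smooth_on U f -> smooth_on U g -> smooth_on U (fun x => f x + g x).
Proof. by move=> oU sf sg m; exact: Cm_onD. Qed.

Lemma smooth_onM (n : nat) (U : set 'rV[R]_n) f g : open U ->
  smooth_on U f -> smooth_on U g -> smooth_on U (fun x => f x * g x).
Proof. by move=> oU sf sg m; exact: Cm_onM. Qed.

Lemma smooth_on_cst (n : nat) (U : set 'rV[R]_n) (a : R) :
  smooth_on U (fun _ : 'rV[R]_n => a).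
Proof. by move=> m; exact: Cm_on_cst. Qed.

Lemma smooth_on_coord (n : nat) (U : set 'rV[R]_n) (i : 'I_n) :
  smooth_on U (fun x => x 0 i).
Proof. by move=> m; exact: Cm_on_coord. Qed.

Lemma smooth_on_comp1 (n : nat) (U : set 'rV[R]_n) (f : 'rV[R]_n -> R) u :
  open U -> smooth_on U f -> smooth1 u -> smooth_on U (fun x => u (f x)).
Proof. by move=> oU sf su m; exact: Cm_on_comp1. Qed.

End SmoothOn.

(** * Functions with local smooth extensions *)

Section SmoothWithin.
Variable R : realType.

Lemma open_preimage_row (k n : nat) (U : set 'rV[R]_k) (V : set 'rV[R]_n)
    (G : 'rV[R]_k -> 'rV[R]_n) :
  open U -> open V -> (forall x, U x -> {for x, continuous G}) ->
  open (U `&` G @^-1` V).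
Proof.
move=> oU oV cG; rewrite openE => x [Ux Vx]; apply: filterI.
  exact: open_nbhs_nbhs.
by apply: cG => //; exact: open_nbhs_nbhs.
Qed.

Lemma smooth_within_comp (k n : nat) (D : set 'rV[R]_k) (V : set 'rV[R]_n)
    (Phi : 'rV[R]_k -> 'rV[R]_n) (g : 'rV[R]_n -> R) :
  open V -> smooth_on V g -> (forall x, D x -> V (Phi x)) ->
  (forall j, smooth_within D (fun x => Phi x 0 j)) ->
  smooth_within D (fun x => g (Phi x)).
Proof.
move=> oV sg DV sP x Dx.
have /choice[U] : forall j, exists U : set 'rV[R]_k, exists h : 'rV[R]_k -> R,
    [/\ open U, U x, smooth_on U h & forall y, D y -> U y -> Phi y 0 j = h y].
  by move=> j; have [U [h H]] := sP j x Dx; exists U, h.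
move=> /choice[h H].
pose W := [set y | forall j, U j y].
have oW : open W.
  rewrite openE => y Wy; apply: (@filter_forall _ _ _ (nbhs y) (nbhs_filter y)) => j.
  by have [oU _ _ _] := H j; apply: open_nbhs_nbhs; split=> //; exact: Wy.
pose G y : 'rV[R]_n := \row_j h j y.
have GE y : D y -> W y -> Phi y = G y.
  move=> Dy Wy; apply/rowP => j; rewrite mxE.
  by have [_ _ _] := H j; apply=> //; exact: Wy.
have Wx : W x by move=> j; have [] := H j.
have sG j : smooth_on W (fun y => G y 0 j).
  have [_ _ sh _] := H j; rewrite (_ : (fun y => _) = h j).
    by apply: smooth_on_subset sh => y; apply.
  by apply/funext => y; rewrite mxE.
(* The extension [G] of [Phi] may leave [V] away from [D], so the neighbourhood is shrunk to where
   [g] may be applied to it. *)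
have oWV : open (W `&` G @^-1` V).
  apply: open_preimage_row => // y Wy; apply: row_continuous => j.
  exact: smooth_on_continuous (sG j) Wy.
exists (W `&` G @^-1` V), (fun y => g (G y)); split=> //.
- by split=> //; rewrite /preimage /= -GE //; exact: DV.
- apply: (smooth_on_comp oWV oV) => //; first by move=> y [].
  by move=> j; apply: smooth_on_subset (sG j) => y [].
- by move=> y Dy [Wy _]; rewrite GE.
Qed.

Lemma smooth_within_subset (k : nat) (D E : set 'rV[R]_k) f :
  E `<=` D -> smooth_within D f -> smooth_within E f.
Proof.
move=> ED sf x Ex; have [U [g [oU Ux sg fg]]] := sf x (ED _ Ex).
by exists U, g; split=> // y /ED; exact: fg.
Qed.

Lemma smooth_within_ext (k : nat) (D : set 'rV[R]_k) f g :
  (forall x, D x -> f x = g x) -> smooth_within D f -> smooth_within D g.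
Proof.
move=> fg sf x Dx; have [U [h [oU Ux sh fh]]] := sf x Dx.
by exists U, h; split=> // y Dy Uy; rewrite -fg // fh.
Qed.

Lemma smooth_within_local (k : nat) (D : set 'rV[R]_k) f :
  (forall x, D x -> exists V : set 'rV[R]_k,
     [/\ open V, V x & smooth_within (D `&` V) f]) -> smooth_within D f.
Proof.
move=> H x Dx; have [V [oV Vx sf]] := H x Dx.
have [U [g [oU Ux sg fg]]] := sf x (conj Dx Vx).
exists (U `&` V), g; split=> //; first exact: openI.
  by apply: smooth_on_subset sg => y [].
by move=> y Dy [Uy Vy]; exact: fg.
Qed.

Lemma smooth_within_precomp (m k : nat) (E : set 'rV[R]_m) (D : set 'rV[R]_k)
    (phi : 'rV[R]_m -> 'rV[R]_k) f :
  (forall j, smooth_on setT (fun x => phi x 0 j)) ->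
  (forall x, E x -> D (phi x)) -> smooth_within D f ->
  smooth_within E (fun x => f (phi x)).
Proof.
move=> sp ED sf x Ex; have [U [g [oU Ux sg fg]]] := sf _ (ED _ Ex).
have cp y : {for y, continuous phi}.
  by apply: row_continuous => j; exact: smooth_on_continuous (sp j) _.
have oW : open (phi @^-1` U).
  by rewrite -[_ @^-1` _]setTI; apply: open_preimage_row => //; exact: openT.
exists (phi @^-1` U), (fun y => g (phi y)); split=> //.
  apply: (smooth_on_comp oW oU) => // j; exact: smooth_on_subset (sp j).
by move=> y Ey Uy; apply: fg => //; exact: ED.
Qed.

Lemma smooth_on_within (k : nat) (D : set 'rV[R]_k) f :
  smooth_on setT f -> smooth_within D f.
Proof. by move=> sf x Dx; exists setT, f; split=> //; exact: openT. Qed.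

Lemma smooth_withinD (k : nat) (D : set 'rV[R]_k) f g :
  smooth_within D f -> smooth_within D g -> smooth_within D (fun x => f x + g x).
Proof.
move=> sf sg x Dx; have [U [f' [oU Ux sf' ff']]] := sf x Dx.
have [V [g' [oV Vx sg' gg']]] := sg x Dx.
have oUV : open (U `&` V) by exact: openI.
exists (U `&` V), (fun x => f' x + g' x); split=> //.
  apply: smooth_onD => //.
    by apply: smooth_on_subset sf' => y [].
  by apply: smooth_on_subset sg' => y [].
by move=> y Dy [Uy Vy]; rewrite ff' // gg'.
Qed.

Lemma smooth_withinM (k : nat) (D : set 'rV[R]_k) f g :
  smooth_within D f -> smooth_within D g -> smooth_within D (fun x => f x * g x).
Proof.
move=> sf sg x Dx; have [U [f' [oU Ux sf' ff']]] := sf x Dx.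
have [V [g' [oV Vx sg' gg']]] := sg x Dx.
have oUV : open (U `&` V) by exact: openI.
exists (U `&` V), (fun x => f' x * g' x); split=> //.
  apply: smooth_onM => //.
    by apply: smooth_on_subset sf' => y [].
  by apply: smooth_on_subset sg' => y [].
by move=> y Dy [Uy Vy]; rewrite ff' // gg'.
Qed.

Lemma smooth_within_cst (k : nat) (D : set 'rV[R]_k) (a : R) :
  smooth_within D (fun _ : 'rV[R]_k => a).
Proof. by apply: smooth_on_within; exact: smooth_on_cst. Qed.

Lemma smooth_within_sum (k : nat) (D : set 'rV[R]_k) (I : Type) (r : seq I) f :
  (forall i, smooth_within D (f i)) ->
  smooth_within D (fun x => \sum_(i <- r) f i x).
Proof.
move=> sf; elim: r => [|i r IH].
  by under eq_fun do rewrite big_nil; exact: smooth_within_cst.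
by under eq_fun do rewrite big_cons; exact: smooth_withinD.
Qed.

End SmoothWithin.

(** * One-sided partial derivatives on the cube *)

Section Partial.
Variables (R : realType) (n : nat).
Implicit Types (f g : 'rV[R]_n -> R) (x : 'rV[R]_n) (i : 'I_n).

Let dir i x := within [set h : R | cube (x + h *: basis_vec R i)] (0 : R)^'.

Lemma shift_coord x (h : R) i j :
  (x + h *: basis_vec R i) 0 j = x 0 j + h * (j == i)%:R.
Proof. by rewrite !mxE. Qed.

(** A limit along [dir] is determined only if arbitrarily small nonzero increments stay in the cube.
    From any point there is room of length 1/2 on one side. *)
Lemma dir_proper i x : cube x -> ProperFilter (dir i x).
Proof.
move=> cx; split; last exact: within_filter.
rewrite /dir /within /= => H.
have [e /= e0 He] : \forall h \near (0:R), h != 0 ->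
    ~ cube (x + h *: basis_vec R i).
  by move: H; rewrite /within /= => H; exact: H.
have xi := cx i.
have [d [d0 de dc]] : exists d : R, [/\ d != 0, `|d| < e & 0 <= x 0 i + d <= 1].
  (* Move to the right by [a] if the coordinate is at most 1/2, otherwise to the left. *)
  pose a := Num.min (e / 2) (1 / 2).
  have a0 : 0 < a by rewrite lt_min; apply/andP; split; lra.
  have ae : a < e by rewrite gt_min; apply/orP; left; lra.
  have a2 : a <= 1 / 2 by rewrite ge_min lexx orbT.
  have [h|h] := leP (x 0 i) (1 / 2).
    by exists a; rewrite gt_eqF // gtr0_norm //; split=> //; lra.
  by exists (- a); rewrite oppr_eq0 gt_eqF // normrN gtr0_norm //; split=> //; lra.
apply: (He d) => //=; first by rewrite sub0r normrN.
move=> j; rewrite shift_coord; have := cx j.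
by have [->|ji] := eqVneq j i; rewrite ?mulr1 ?mulr0 ?addr0.
Qed.

(** The one-sided limit runs along a finer filter than the derivative of the extension [g], on whose
    domain the two quotients are eventually equal. Hence any local extension computes [partial]. *)
Lemma partialE (U : set 'rV[R]_n) f g i x : open U -> U x -> cube x ->
  (forall y, cube y -> U y -> f y = g y) ->
  derivable g x (basis_vec R i) -> partial i f x = 'D_(basis_vec R i) g x.
Proof.
move=> oU Ux cx fg dg; have P := dir_proper i cx.
apply: cvg_lim => //.
have dg' : h^-1 * (g (x + h *: basis_vec R i) - g x) @[h --> dir i x] -->
    'D_(basis_vec R i) g x.
  apply: cvg_trans dg.
  apply: (@cvg_trans _ ((fun h => h^-1 *: ((g \o shift x) (h *: basis_vec R i) - g x)) @ dir i x)).
    apply: near_eq_cvg; near=> h; by rewrite /= [_ + x]addrC.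
  by move=> P' HP'; apply: (@filterS _ (0:R)^' _ _ _ _ HP') => h Ph _.
apply: cvg_trans dg'; apply: near_eq_cvg.
have c : (fun h : R => x + h *: basis_vec R i) @ (0:R) --> x.
  suff: (fun h : R => x + h *: basis_vec R i) @ (0:R) --> x + 0 *: basis_vec R i.
    by rewrite scale0r addr0.
  by apply: cvgD; [exact: cvg_cst|apply: cvgZr_tmp; exact: cvg_id].
have nU : \forall h \near dir i x, U (x + h *: basis_vec R i).
  apply: cvg_within; apply: nbhs_dnbhs.
  by apply: c; exact: open_nbhs_nbhs.
have nc : \forall h \near dir i x, cube (x + h *: basis_vec R i).
  exact: withinT.
near=> h; rewrite (fg x) // fg //; near: h; [exact: nc|exact: nU].
Unshelve. all: by end_near. Qed.

Lemma smooth_within_partial f x : smooth_within (@cube R n) f -> cube x ->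
  exists (U : set 'rV[R]_n) g, [/\ open U, U x, smooth_on U g,
    forall y, cube y -> U y -> f y = g y &
    forall i y, cube y -> U y -> partial i f y = 'D_(basis_vec R i) g y].
Proof.
move=> sf cx; have [U [g [oU Ux sg fg]]] := sf x cx.
exists U, g; split=> // i y cy Uy.
by apply: (partialE oU) => //; exact: smooth_on_derivable sg Uy.
Qed.

Lemma eq_partial f g i x : cube x -> (forall y, cube y -> f y = g y) ->
  partial i f x = partial i g x.
Proof.
move=> cx fg; have P := dir_proper i cx.
have E : {near dir i x, (fun h => h^-1 * (f (x + h *: basis_vec R i) - f x))
    =1 (fun h => h^-1 * (g (x + h *: basis_vec R i) - g x))}.
  have nc : \forall h \near dir i x, cube (x + h *: basis_vec R i).
    exact: withinT.
  by apply: filterS nc => h ch; rewrite !fg.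
rewrite /partial; congr (lim _); rewrite eqEsubset; split; apply: near_eq_cvg => //.
by apply: filterS E => h /esym.
Qed.

Lemma partialD f g i x : cube x -> smooth_within (@cube R n) f ->
  smooth_within (@cube R n) g ->
  partial i (fun y => f y + g y) x = partial i f x + partial i g x.
Proof.
move=> cx sf sg.
have [U [f' [oU Ux sf' ff' ->//]]] := smooth_within_partial sf cx.
have [V [g' [oV Vx sg' gg' ->//]]] := smooth_within_partial sg cx.
have df := @smooth_on_derivable _ _ _ _ i _ sf' Ux.
have dg := @smooth_on_derivable _ _ _ _ i _ sg' Vx.
rewrite -deriveD //; apply: (@partialE (U `&` V)) => //; first exact: openI.
  by move=> y cy [Uy Vy]; rewrite ff' // gg'.
exact: derivableD.
Qed.

Lemma partialN f i x : cube x -> smooth_within (@cube R n) f ->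
  partial i (fun y => - f y) x = - partial i f x.
Proof.
move=> cx sf; have [U [f' [oU Ux sf' ff' ->//]]] := smooth_within_partial sf cx.
have df := @smooth_on_derivable _ _ _ _ i _ sf' Ux.
rewrite -deriveN //; apply: (@partialE U) => //; last exact: derivableN.
by move=> y cy Uy; rewrite ff'.
Qed.

End Partial.

(** * Smooth functions on manifolds *)

Section ManifoldCharts.
Variables (R : realType) (M : manifold R).
Implicit Types (W : set M) (h : M -> R).

Lemma chart_img_openI c W : open W ->
  open (@chart R M c @` (@chart_dom R M c `&` W)).
Proof.
move=> oW; rewrite openE => _ [x [dx Wx] <-].
have oI : nbhs (chart c x) (chart c @` chart_dom c).
  by apply: open_nbhs_nbhs; split; [exact: chart_img_open|exists x].
have cW : nbhs (chart c x) (@chart_inv R M c @^-1` W).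
  apply: (chart_inv_continuous dx); rewrite chartK //; exact: open_nbhs_nbhs.
apply: filterS2 oI cW => _ [z dz <-]; rewrite /preimage /= chartK // => Wz.
by exists z.
Qed.

Lemma within_continuous_open (T U : topologicalType) (D : set T) (f : T -> U) x
    (B : set U) : {within D, continuous f} -> D x -> open B -> B (f x) ->
  exists V : set T, [/\ open V, V x & forall y, D y -> V y -> B (f y)].
Proof.
move=> /subspace_continuousP cf Dx oB Bx.
have nB : nbhs (f x) B by exact: open_nbhs_nbhs.
have := cf x Dx B nB; rewrite /= nbhsE => -[V [oV Vx] VB].
by exists V; split=> // y Dy Vy; exact: VB.
Qed.

Lemma smooth_fun_on_comp (k : nat) (D : set 'rV[R]_k) (gamma : 'rV[R]_k -> M) W h :
  {within D, continuous gamma} ->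
  (forall c j, smooth_within (D `&` [set x | @chart_dom R M c (gamma x)])
     (fun x => chart c (gamma x) 0 j)) ->
  open W -> smooth_fun_on W h ->
  smooth_within (D `&` [set x | W (gamma x)]) (fun x => h (gamma x)).
Proof.
move=> cg sg oW sh; apply: smooth_within_local => x [Dx Wx].
have [c dc] := chart_cover (gamma x).
have [V [oV Vx VD]] := within_continuous_open cg Dx (chart_dom_open c) dc.
exists V; split=> //.
have oI := @chart_img_openI c _ oW.
apply: (@smooth_within_ext _ _ _ (fun y => (h \o chart_inv c) (chart c (gamma y)))).
  by move=> y [[Dy Wy] Vy] /=; rewrite chartK //; exact: VD.
apply: (smooth_within_comp oI (sh c)).
  by move=> y [[Dy Wy] Vy]; exists (gamma y) => //; split=> //; exact: VD.
move=> j; apply: smooth_within_subset (sg c j) => y [[Dy Wy] Vy].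
by split=> //; exact: VD.
Qed.

Lemma Cm_on_local (n m : nat) (U : set 'rV[R]_n) f :
  (forall x, U x -> exists V : set 'rV[R]_n, V x /\ Cm_on m V f) -> Cm_on m U f.
Proof.
elim: m f => [|m IH] f H; split=> //; try by
  move=> x /H[V [Vx Cf]]; exact: Cm_on_continuous Cf Vx.
move=> i; split; first by move=> x /H[V [Vx Cf]]; exact: Cm_on_derivable Cf Vx.
by apply: IH => x /H[V [Vx [_ /(_ i)[_ Di]]]]; exists V.
Qed.

(** A product over coordinates because the norm on row vectors is the sup norm: the bump is nonzero
    exactly where every coordinate is within [r] of that of [y0]. *)
Definition bump (n : nat) (r : R) (y0 y : 'rV[R]_n) : R :=
  \prod_j psi 0 (r ^+ 2 - (y 0 j - y0 0 j) ^+ 2).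

Lemma bump_center_gt0 (n : nat) (r : R) (y0 : 'rV[R]_n) : 0 < r -> 0 < bump r y0 y0.
Proof.
move=> r0; apply: prodr_gt0 => j _.
by rewrite psi_gt0 subrr expr0n subr0 exprn_gt0.
Qed.

Lemma bump_neq0 (n : nat) (r : R) (y0 y : 'rV[R]_n) :
  0 < r -> bump r y0 y != 0 -> `|y0 - y| <= r.
Proof.
move=> r0 /prodf_neq0 H.
rewrite [leLHS]/Num.norm /= mx_normrE; apply: bigmax_le => [|[a j] _ /=].
  exact: ltW.
rewrite [a]ord1 !mxE distrC; have := H j isT.
have [/psi_le0 -> /eqP//|h _] := leP (r ^+ 2 - (y 0 j - y0 0 j) ^+ 2) 0.
rewrite -(ler_pXn2r (n := 2)) ?nnegrE ?(ltW r0) //.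
by rewrite real_normK ?num_real //; lra.
Qed.

Lemma smooth_bump (n : nat) (r : R) (y0 : 'rV[R]_n) : smooth_on setT (bump r y0).
Proof.
move=> m; apply: Cm_on_prod => [|j]; first exact: openT.
apply: Cm_on_comp1; [exact: openT| |exact: smooth1_psi].
have sj : Cm_on m setT (fun y : 'rV[R]_n => y 0 j - y0 0 j).
  by apply: Cm_onD; [exact: openT|exact: Cm_on_coord|exact: Cm_on_cst].
apply: Cm_onD; [exact: openT|exact: Cm_on_cst|].
have -> : (fun y : 'rV[R]_n => - (y 0 j - y0 0 j) ^+ 2) =
    (fun y => -1 * ((y 0 j - y0 0 j) * (y 0 j - y0 0 j))).
  by apply/funext => y; rewrite mulN1r expr2.
apply: Cm_onM; [exact: openT|exact: Cm_on_cst|].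
by apply: Cm_onM => //; exact: openT.
Qed.

Lemma compact_ball (n : nat) (y0 : 'rV[R]_n) (r : R) : 0 < r ->
  compact [set y | `|y0 - y| <= r].
Proof.
move=> r0; have -> : [set y | `|y0 - y| <= r] = closed_ball y0 r.
  by rewrite closed_ballE.
apply: bounded_closed_compact; last exact: closed_ball_closed.
rewrite closed_ballE //; exists (`|y0| + r); split; first exact: num_real.
move=> x xr y; rewrite /closed_ball_ /= => yr.
apply: le_trans (ltW xr); rewrite -[y](subKr y0).
by apply: le_trans (ler_normB _ _) _; rewrite lerD2l.
Qed.

(** A bump in a chart, extended by zero. Its support lies in the image [K] of a compact ball, closed
    since M is Hausdorff, so the chart domain and the complement of [K] form an open cover on each
    part of which the function is smooth. *)
Lemma smooth_bump_fun c (p : M) (r : R) :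
  chart_dom c p -> 0 < r ->
  [set y | `|chart c p - y| <= r] `<=` chart c @` chart_dom c ->
  exists2 h : M -> R, smooth_fun h &
    [/\ h p != 0, forall q, ~ chart_dom c q -> h q = 0 &
        forall q, chart_dom c q -> h q != 0 -> `|chart c p - chart c q| <= r].
Proof.
move=> dp r0 rV; pose y0 := chart c p.
pose h (x : M) := if `[< chart_dom c x >] then bump r y0 (chart c x) else 0.
pose K := @chart_inv R M c @` [set y | `|y0 - y| <= r].
have cK : closed K.
  apply: compact_closed; first exact: manifold_hausdorff.
  apply: continuous_compact; last exact: compact_ball.
  apply/subspace_continuousP => y /rV[x dx <-].
  by apply: cvg_within_filter; exact: chart_inv_continuous.
have hK x : ~ K x -> h x = 0.
  move=> Kx; rewrite /h; case: ifPn => // /asboolP dx; apply/eqP/negPn/negP.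
  by move=> /(bump_neq0 r0) b; apply: Kx; exists (chart c x) => //; exact: chartK.
exists h.
  move=> c' m; apply: Cm_on_local => _ [x [dx _] <-].
  have [dcx|dcx] := pselect (chart_dom c x).
    have oI := @chart_img_openI c' _ (chart_dom_open c).
    exists (chart c' @` (chart_dom c' `&` chart_dom c)); split; first by exists x.
    apply: (@Cm_on_ext _ _ _ _ (fun y => bump r y0 (chart c (chart_inv c' y)))) => //.
      move=> y; rewrite inE => -[z [dz dcz] <-] /=.
      by rewrite chartK // /h asboolT.
    apply: (Cm_on_comp oI openT) => //; last exact: smooth_bump.
    by move=> j; exact: chart_transition.
  have oK : open (~` K) by exact: closed_openC.
  have oI := @chart_img_openI c' _ oK.
  have xK : ~ K x.
    by case=> y /rV[z dz <-]; rewrite chartK // => zx; apply: dcx; rewrite -zx.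
  exists (chart c' @` (chart_dom c' `&` ~` K)); split; first by exists x.
  apply: (@Cm_on_ext _ _ _ _ (cst 0)) => //; last exact: Cm_on_cst.
  by move=> y; rewrite inE => -[z [dz Kz] <-] /=; rewrite chartK // hK.
split.
- by rewrite /h asboolT // gt_eqF // bump_center_gt0.
- by move=> q dq; rewrite /h asboolF.
- by move=> q dq; rewrite /h asboolT //; exact: bump_neq0.
Qed.

(** Otherwise a bump at [p], of radius too small to reach [q], would take different values at the
    two points. *)
Lemma smooth_fun_separates (p q : M) :
  (forall h, smooth_fun h -> h p = h q) -> p = q.
Proof.
move=> H; have [c dp] := chart_cover p.
have : nbhs (chart c p) (chart c @` chart_dom c).
  by apply: open_nbhs_nbhs; split; [exact: chart_img_open|exists p].
move=> /nbhs_closedballP[r rV].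
apply: contrapT => pq.
have [r' [r'0 r'V qr']] : exists r' : R, [/\ 0 < r',
    [set y | `|chart c p - y| <= r'] `<=` chart c @` chart_dom c &
    chart_dom c q -> r' < `|chart c p - chart c q|].
  have rV' r' : r' <= r%:num ->
      [set y | `|chart c p - y| <= r'] `<=` chart c @` chart_dom c.
    move=> rr y /= yr; apply: rV; rewrite closed_ballE // /closed_ball_ /=.
    exact: le_trans rr.
  have [dq|dq] := pselect (chart_dom c q); last first.
    by exists r%:num; split=> //; exact: rV'.
  have d0 : 0 < `|chart c p - chart c q|.
    rewrite normr_gt0 subr_eq0; apply/eqP => E; apply: pq.
    by rewrite -(chartK dp) E chartK.
  exists (Num.min r%:num (`|chart c p - chart c q| / 2)); split.
  - by rewrite lt_min /=; apply/andP; split=> //; rewrite divr_gt0.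
  - by apply: rV'; rewrite ge_min lexx.
  - by move=> _; rewrite gt_min; apply/orP; right; lra.
have [h sh [hp hq1 hq2]] := smooth_bump_fun dp r'0 r'V.
have hq0 : h q = 0.
  have [dq|dq] := pselect (chart_dom c q); last exact: hq1.
  apply/eqP/negPn/negP => /(hq2 _ dq); have := qr' dq; lra.
by move: hp; rewrite (H _ sh) hq0 eqxx.
Qed.

End ManifoldCharts.

(** * Symmetry of second derivatives *)

Section Schwarz.
Variables (R : realType) (n : nat).
Implicit Types (f : 'rV[R]_n -> R) (x : 'rV[R]_n) (i j : 'I_n).
Local Notation "''d_' i" := (basis_vec R i) (at level 10, i at level 2).

(** The mean value theorem, first along i for the difference in direction j, then along j. The
    left-hand side is symmetric in i and j, the right-hand side tends to a mixed derivative after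
    division by t^2. *)
Lemma second_difference f x i j (t : R) : smooth_on setT f ->
  exists s u : R, [/\ `|s| <= `|t|, `|u| <= `|t| &
    f (x + t *: 'd_ i + t *: 'd_ j) - f (x + t *: 'd_ i) - f (x + t *: 'd_ j) + f x
    = t * (t * 'D_('d_ j) (fun y => 'D_('d_ i) f y) (x + s *: 'd_ i + u *: 'd_ j))].
Proof.
move=> sf.
have df k y : derivable f y ('d_ k) by exact: smooth_on_derivable sf _.
have shift_derive k z y : is_derive y ('d_ k) (fun y => f (y + z)) ('D_('d_ k) f (y + z)).
  have E : (fun h : R => h^-1 *: (((fun y => f (y + z)) \o shift y) (h *: 'd_ k) - f (y + z)))
    = (fun h => h^-1 *: ((f \o shift (y + z)) (h *: 'd_ k) - f (y + z))).
    by apply/funext => h /=; rewrite addrA.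
  by split; [rewrite /derivable E; exact: df|rewrite /derive E].
pose G y := f (y + t *: 'd_ j) - f y.
have dG y : is_derive y ('d_ i) G ('D_('d_ i) f (y + t *: 'd_ j) - 'D_('d_ i) f y).
  exact: is_deriveB (shift_derive i _ y) (derivableP (df i y)).
have [s st Es] := @line_mvt R n G x ('d_ i) t (fun s _ => @ex_derive _ _ _ _ _ _ _ (dG _)).
have dd k y : derivable (fun y => 'D_('d_ i) f y) y ('d_ k).
  by apply: smooth_on_derivable (smooth_on_derive i sf) _.
have [u ut Eu] := @line_mvt R n (fun y => 'D_('d_ i) f y) (x + s *: 'd_ i) ('d_ j) t
  (fun s _ => dd _ _).
exists s, u; split=> //.
rewrite -Eu -(@derive_val _ _ _ _ _ _ _ (dG _)) -Es /G opprB.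
by rewrite (addrAC (f (x + t *: 'd_ i + t *: 'd_ j) - f (x + t *: 'd_ i))) addrA.
Qed.

Lemma schwarz f x i j : smooth_on setT f ->
  'D_('d_ i) (fun y => 'D_('d_ j) f y) x = 'D_('d_ j) (fun y => 'D_('d_ i) f y) x.
Proof.
move=> sf; apply/eqP; rewrite -subr_eq0 -normr_le0; apply/ler_addgt0Pr => e e0.
rewrite add0r.
have tri (a b c : R) : `|a - c| < e / 2 -> `|c - b| < e / 2 -> `|a - b| <= e.
  move=> h h'; rewrite -(subrKA c); apply: le_trans (ler_normD _ _) _.
  by apply/ltW; rewrite [e]splitr ltrD.
have c k l : {for x, continuous (fun y => 'D_('d_ k) (fun y => 'D_('d_ l) f y) y)}.
  exact: smooth_on_continuous (smooth_on_derive k (smooth_on_derive l sf)) _.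
have e2 : 0 < e / 2 by lra.
have /cvgrPdist_lt /(_ _ e2) /nbhs_ballP[r1 /= r10 H1] := c i j.
have /cvgrPdist_lt /(_ _ e2) /nbhs_ballP[r2 /= r20 H2] := c j i.
(* The intermediate points lie within 2 t of [x], hence within both radii of continuity. *)
pose t := Num.min r1 r2 / 4.
have t0 : 0 < t by rewrite divr_gt0 // lt_min r10.
have tr1 : 2 * t < r1.
  by rewrite /t; have : Num.min r1 r2 <= r1 by [rewrite ge_min lexx]; lra.
have tr2 : 2 * t < r2.
  by rewrite /t; have : Num.min r1 r2 <= r2 by [rewrite ge_min lexx orbT]; lra.
have nb (k : 'I_n) : `|'d_ k| <= 1 :> R.
  rewrite [leLHS]/Num.norm /= mx_normrE; apply: bigmax_le => // -[a b] _ /=.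
  by rewrite mxE; case: (_ && _); rewrite ?normr1 ?normr0.
have near_x (s u : R) k l : `|s| <= `|t| -> `|u| <= `|t| ->
    `|x - (x + s *: 'd_ k + u *: 'd_ l)| <= 2 * t.
  rewrite (gtr0_norm t0) => st ut.
  rewrite opprD addrA opprD addrA subrr add0r -opprD normrN.
  apply: le_trans (ler_normD _ _) _; rewrite !normrZ.
  have := ler_pM (normr_ge0 s) (normr_ge0 ('d_ k)) st (nb k).
  have := ler_pM (normr_ge0 u) (normr_ge0 ('d_ l)) ut (nb l).
  by lra.
have [s [u [st ut E]]] := second_difference x i j t sf.
have [s' [u' [st' ut' E']]] := second_difference x j i t sf.
have EE : 'D_('d_ j) (fun y => 'D_('d_ i) f y) (x + s *: 'd_ i + u *: 'd_ j) =
    'D_('d_ i) (fun y => 'D_('d_ j) f y) (x + s' *: 'd_ j + u' *: 'd_ i).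
  have tt (a b : R) : t * (t * a) = t * (t * b) -> a = b.
    by move=> /(mulfI (lt0r_neq0 t0))/(mulfI (lt0r_neq0 t0)).
  apply: tt; refine (etrans (esym E) (etrans _ E')).
  by rewrite (addrAC x (t *: 'd_ j)) (addrAC (f (x + t *: 'd_ i + t *: 'd_ j))).
have h1 := H1 (x + s' *: 'd_ j + u' *: 'd_ i).
have h2 := H2 (x + s *: 'd_ i + u *: 'd_ j).
rewrite -ball_normE /= in h1; rewrite -ball_normE /= in h2.
have {}h1 := h1 (le_lt_trans (near_x _ _ _ _ st' ut') tr1).
have {}h2 := h2 (le_lt_trans (near_x _ _ _ _ st ut) tr2).
rewrite EE distrC in h2.
exact: tri h1 h2.
Qed.

End Schwarz.

(** * Product and chain rules on the cube *)

Section PartialCalculus.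
Variables (R : realType).

Definition smooth_map (m k : nat) (phi : 'rV[R]_m -> 'rV[R]_k) :=
  forall j, smooth_on setT (fun x => phi x 0 j).

Definition jac (m k : nat) (phi : 'rV[R]_m -> 'rV[R]_k) (x : 'rV[R]_m)
    (i : 'I_m) (j : 'I_k) : R :=
  'D_(basis_vec R i) (fun y => phi y 0 j) x.

Lemma partial_smooth (n : nat) f i (x : 'rV[R]_n) : cube x -> smooth_on setT f ->
  partial i f x = 'D_(basis_vec R i) f x.
Proof.
move=> cx sf; apply: (@partialE _ _ setT) => //; first exact: openT.
exact: smooth_on_derivable sf _.
Qed.

Lemma partialM (n : nat) f g i (x : 'rV[R]_n) : cube x ->
  smooth_within (@cube R n) f -> smooth_within (@cube R n) g ->
  partial i (fun y => f y * g y) x = f x * partial i g x + g x * partial i f x.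
Proof.
move=> cx sf sg.
have [U [f' [oU Ux sf' ff' ->//]]] := smooth_within_partial sf cx.
have [V [g' [oV Vx sg' gg' ->//]]] := smooth_within_partial sg cx.
have df := @smooth_on_derivable _ _ _ _ i _ sf' Ux.
have dg := @smooth_on_derivable _ _ _ _ i _ sg' Vx.
rewrite ff' // gg' // -[_ + _](deriveM df dg); apply: (@partialE _ _ (U `&` V)) => //.
- exact: openI.
- by move=> y cy [Uy Vy]; rewrite ff' // gg'.
- exact: derivableM.
Qed.

Lemma partial_cst (n : nat) (a : R) i (x : 'rV[R]_n) : cube x ->
  partial i (fun=> a) x = 0.
Proof.
by move=> cx; rewrite partial_smooth ?derive_cst //; exact: smooth_on_cst.
Qed.

Lemma partial_sum (n : nat) (I : Type) (r : seq I) f i (x : 'rV[R]_n) : cube x ->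
  (forall l, smooth_within (@cube R n) (f l)) ->
  partial i (fun y => \sum_(l <- r) f l y) x = \sum_(l <- r) partial i (f l) x.
Proof.
move=> cx sf; elim: r => [|l r IH].
  under eq_fun do rewrite big_nil; by rewrite partial_cst // big_nil.
under eq_fun do rewrite big_cons.
by rewrite partialD ?IH ?big_cons //; exact: smooth_within_sum.
Qed.

Lemma partial_comp (m k : nat) (phi : 'rV[R]_m -> 'rV[R]_k) F i x :
  smooth_map phi -> (forall y, cube y -> cube (phi y)) ->
  smooth_within (@cube R k) F -> cube x ->
  partial i (fun y => F (phi y)) x = \sum_l jac phi x i l * partial l F (phi x).
Proof.
move=> sp cp sF cx.
have [U [g [oU Ux sg Fg Dg]]] := smooth_within_partial sF (cp _ cx).
have cphi y : {for y, continuous phi}.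
  by apply: row_continuous => j; exact: smooth_on_continuous (sp j) _.
have oW : open (phi @^-1` U).
  by rewrite -[_ @^-1` _]setTI; apply: open_preimage_row => //; exact: openT.
have [||dgp E] := @chain_rule R m k phi g x (basis_vec R i).
- by move=> j; exact: smooth_on_derivable (sp j) _.
- exact: smooth_on_differentiable oU sg Ux.
rewrite (@partialE _ _ (phi @^-1` U) _ (g \o phi)) //; last first.
  by move=> y cy Uy; rewrite Fg //; exact: cp.
rewrite E; apply: eq_bigr => l _; rewrite mulrC Dg //; exact: cp.
Qed.

End PartialCalculus.

(** * Pulling back and gluing Lie algebroid morphisms *)

Section Bundles.
Variables (R : realType) (M : manifold R) (E : vector_bundle M).

Lemma triv_sum t x (I : Type) (r : seq I) (a : I -> R) (v : I -> E x) :
  triv_dom t x ->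
  triv t (\sum_(i <- r) a i *: v i) = \sum_(i <- r) a i *: triv t (v i).
Proof.
move=> tx; elim: r => [|i r IH]; last by rewrite !big_cons triv_linear // IH.
rewrite !big_nil; have := triv_linear tx 1 (0 : E x) 0.
by rewrite !scale1r addr0 => /eqP; rewrite -subr_eq subrr eq_sym => /eqP.
Qed.

Lemma linear_form_sum (V : lmodType R) (w : V -> R) (I : Type) (r : seq I)
    (a : I -> R) (v : I -> V) :
  (forall (c : R) (u u' : V), w (c *: u + u') = c * w u + w u') ->
  w (\sum_(i <- r) a i *: v i) = \sum_(i <- r) a i * w (v i).
Proof.
move=> lw; elim: r => [|i r IH]; last by rewrite !big_cons lw IH.
rewrite !big_nil; have := lw 1 0 0.
by rewrite scale1r addr0 mul1r => /eqP; rewrite -subr_eq subrr eq_sym => /eqP.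
Qed.

Lemma frame_decomposition t x (v : E x) : triv_dom t x ->
  v = \sum_j triv t v 0 j *: triv_inv t x (delta_mx 0 j).
Proof.
move=> tx; apply: (can_inj (trivK tx)).
rewrite triv_sum // {1}(row_sum_delta (triv t v)).
by apply: eq_bigr => j _; rewrite triv_invK.
Qed.

End Bundles.

Section Frames.
Variables (R : realType) (M : manifold R) (A : lie_algebroid M).

(** Precomposition of a linear map R^k -> A_x with the linear map of matrix [C]. Faces, scalings and
    substitutions all act on frames in this way, so their composites reduce to matrix products. *)
Definition lin (m k : nat) (C : 'I_m -> 'I_k -> R) (p : frame A k) : frame A m :=
  existT _ (base p) (fun i => \sum_j C i j *: vec p j).

(** The composite of the bundle map with the tangent map of [phi]. *)
Definition pull (m k : nat) (phi : 'rV[R]_m -> 'rV[R]_k) (f : cube_map A k) :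
  cube_map A m := fun x => lin (jac phi x) (f (phi x)).

Lemma anchor_sum x h (I : Type) (r : seq I) (a : I -> R) (v : I -> A x) :
  smooth_fun h ->
  anchor (\sum_(i <- r) a i *: v i) h = \sum_(i <- r) a i * anchor (v i) h.
Proof.
move=> sh; apply: (@linear_form_sum _ _ (fun v => anchor v h)) => c u u'.
exact: anchor_linear.
Qed.

Lemma alternating_sum (V : lmodType R) (e : V -> V -> R) (I J : Type)
    (r : seq I) (s : seq J) (a : I -> R) (b : J -> R) u v : alternating e ->
  e (\sum_(i <- r) a i *: u i) (\sum_(j <- s) b j *: v j) =
  \sum_(i <- r) \sum_(j <- s) a i * b j * e (u i) (v j).
Proof.
move=> [el er _].
rewrite (@linear_form_sum _ _ (fun x => e x _)); last by move=> c y y'; exact: el.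
apply: eq_bigr => i _.
rewrite (@linear_form_sum _ _ (e (u i))); last by move=> c y y'; exact: er.
by rewrite big_distrr /=; apply: eq_bigr => j _; rewrite mulrA.
Qed.

Section Smooth.
Variables (k : nat) (f : cube_map A k).
Hypothesis sf : smooth_cube_map f.

Lemma smooth_within_fun W h : open W -> smooth_fun_on W h ->
  smooth_within (@cube R k `&` [set x | W (base (f x))]) (fun x => h (base (f x))).
Proof. by have [cf df _] := sf; exact: smooth_fun_on_comp. Qed.

Lemma smooth_within_base h : smooth_fun h ->
  smooth_within (@cube R k) (fun x => h (base (f x))).
Proof.
move=> sh; apply: smooth_within_subset (smooth_within_fun openT sh) => x cx.
by split.
Qed.

Lemma base_near W x : cube x -> open W -> W (base (f x)) ->
  exists V : set 'rV[R]_k,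
    [/\ open V, V x & forall y, cube y -> V y -> W (base (f y))].
Proof. by have [cf _ _] := sf => cx oW Wx; exact: within_continuous_open cf cx oW Wx. Qed.

Lemma smooth_within_form w i : is_form1 w ->
  smooth_within (@cube R k) (fun x => w _ (vec (f x) i)).
Proof.
move=> [lw sw]; apply: smooth_within_local => x cx.
have [t tx] := triv_cover A (base (f x)).
have [V [oV Vx VT]] := base_near cx (triv_dom_open t) tx.
exists V; split=> //.
apply: (@smooth_within_ext _ _ _ (fun y => \sum_j triv t (vec (f y) i) 0 j *
  w _ (triv_inv t (base (f y)) (delta_mx 0 j)))).
  move=> y [cy Vy]; rewrite [in RHS](frame_decomposition (vec (f y) i) (VT _ cy Vy)).
  by rewrite -linear_form_sum.
have sub : cube (n:=k) `&` V `<=` cube (n:=k) `&` [set x | triv_dom t (base (f x))].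
  by move=> y [cy Vy]; split=> //; exact: VT.
apply: smooth_within_sum => j; apply: smooth_withinM.
  by have [_ _ st] := sf; exact: smooth_within_subset sub (st t i j).
apply: smooth_within_subset sub _.
exact: smooth_within_fun (triv_dom_open t) (sw t (delta_mx 0 j)).
Qed.

End Smooth.

Section Pull.
Variables (m k : nat) (phi : 'rV[R]_m -> 'rV[R]_k) (f : cube_map A k).
Hypotheses (sphi : smooth_map phi) (cphi : forall x, cube x -> cube (phi x)).

Let smooth_jac i l : smooth_on setT (fun x => jac phi x i l).
Proof. exact: smooth_on_derive (sphi l). Qed.

Lemma pull_smooth : smooth_cube_map f -> smooth_cube_map (pull phi f).
Proof.
move=> [cf df tf]; split.
- apply/subspace_continuousP => x cx B nB.
  have cp : {for x, continuous phi}.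
    by apply: row_continuous => j; exact: smooth_on_continuous (sphi j) _.
  have /subspace_continuousP/(_ _ (cphi cx) _ nB) nf := cf.
  apply: (@filterS _ (nbhs x) (nbhs_filter x) _ _ _ (cp _ nf)) => y H cy.
  by apply: H; exact: cphi.
- move=> c j; apply: (smooth_within_precomp sphi _ (df c j)) => x [cx dx].
  by split => //; exact: cphi.
- move=> t i j; apply: (@smooth_within_ext _ _ _ (fun x => \sum_l jac phi x i l *
    triv t (vec (f (phi x)) l) 0 j)).
    move=> x [cx tx] /=; rewrite triv_sum // summxE.
    by apply: eq_bigr => l _; rewrite !mxE.
  apply: smooth_within_sum => l; apply: smooth_withinM.
    exact: smooth_on_within.
  apply: (smooth_within_precomp sphi _ (tf t l j)) => x [cx dx].
  by split => //; exact: cphi.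
Qed.

Lemma pull_morphism : is_morphism f -> is_morphism (pull phi f).
Proof.
move=> [sf bf ff]; split; first exact: pull_smooth.
- move=> h sh i x cx /=.
  rewrite (@partial_comp _ _ _ phi (fun y => h (base (f y)))) //; last first.
    exact: smooth_within_base.
  by rewrite anchor_sum //; apply: eq_bigr => l _; rewrite bf //; exact: cphi.
- move=> w e fw fe dwe i j x cx.
  pose W l y := w _ (vec (f y) l).
  have sW l : smooth_within (@cube R k) (W l) by exact: smooth_within_form.
  have sWp l : smooth_within (@cube R m) (fun y => W l (phi y)).
    exact: smooth_within_precomp sphi cphi (sW l).
  have wE y a : w _ (vec (pull phi f y) a) = \sum_l jac phi y a l * W l (phi y).
    by rewrite /= linear_form_sum //; case: fw.
  under eq_fun do rewrite wE.
  under [X in _ - partial j X x]eq_fun do rewrite wE.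
  (* The product rule leaves a term in second derivatives of [phi]; it is symmetric in [a] and [b]
     and cancels in the exterior derivative. *)
  have pE a b : partial a (fun y => \sum_l jac phi y b l * W l (phi y)) x =
     \sum_l (jac phi x b l * (\sum_p jac phi x a p * partial p (W l) (phi x))
       + W l (phi x) * 'D_(basis_vec R a) (fun y => jac phi y b l) x).
    rewrite partial_sum //; last first.
      by move=> l; apply: smooth_withinM => //; exact: smooth_on_within.
    apply: eq_bigr => l _.
    have sJ := smooth_on_within (D := @cube R m) (smooth_jac b l).
    rewrite (@partialM _ _ (fun y => jac phi y b l) (fun y => W l (phi y)) a x cx sJ (sWp l)).
    rewrite (@partial_comp _ _ _ phi (W l) a x sphi cphi (sW l) cx).
    by rewrite (@partial_smooth _ _ (fun y => jac phi y b l) a x cx (smooth_jac b l)).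
  rewrite !pE /= alternating_sum; last by case: fe.
  have sym l : 'D_(basis_vec R i) (fun y => jac phi y j l) x =
      'D_(basis_vec R j) (fun y => jac phi y i l) x.
    exact: schwarz.
  rewrite -sumrB.
  under eq_bigr => l _ do rewrite sym opprD addrACA subrr addr0.
  rewrite sumrB.
  under eq_bigr => l _ do rewrite big_distrr.
  rewrite exchange_big /=.
  under [X in _ - X]eq_bigr => l _ do rewrite big_distrr.
  rewrite -sumrB; apply: eq_bigr => p _; rewrite -sumrB; apply: eq_bigr => q _.
  rewrite -(ff _ _ fw fe dwe p q (phi x) (cphi cx)) /W mulrBr; congr (_ - _).
    by rewrite mulrCA mulrA.
  exact: mulrA.
Qed.

Lemma pull_thin : thin f -> thin (pull phi f).
Proof.
move=> tf x i j cx e ae; rewrite /= alternating_sum // big1 // => p _.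
rewrite big1 // => q _; rewrite tf ?mulr0 //; exact: cphi.
Qed.

End Pull.

(** At each point all images are multiples of the single vector of [f]. *)
Lemma pull_path_thin (m : nat) (phi : 'rV[R]_m -> 'rV[R]_1) (f : cube_map A 1) :
  thin (pull phi f).
Proof.
move=> x i j cx e ae /=; rewrite alternating_sum // big1 // => p _.
rewrite big1 // => q _; rewrite (ord1 p) (ord1 q).
by case: ae => _ _ ->; rewrite mulr0.
Qed.

End Frames.

(** * Gluing of morphisms *)

Section Glue.
Variables (R : realType) (M : manifold R) (A : lie_algebroid M) (k : nat).

(** At each point [F] follows one of [P] and [Q] while the other one rests at [N]. Where the switch
    takes place is left open, so any shape of seam is covered. *)
Definition glued (P Q N F : cube_map A k) :=
  forall x, cube x -> (F x = P x /\ Q x = N x) \/ (F x = Q x /\ P x = N x).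

Variables P Q N F : cube_map A k.
Hypothesis gF : glued P Q N F.

Lemma glued_eval (theta : frame A k -> R) x : cube x ->
  theta (F x) = theta (P x) + theta (Q x) - theta (N x).
Proof.
by move=> cx; case: (gF cx) => -[-> ->]; [rewrite addrK|rewrite addrAC subrr add0r].
Qed.

Section Smooth.
Hypotheses (sP : smooth_cube_map P) (sQ : smooth_cube_map Q) (sN : smooth_cube_map N).

(* The case where the three base points differ uses that M is Hausdorff. *)
Lemma glued_local x : cube x ->
  [\/ exists V : set 'rV[R]_k, [/\ open V, V x & forall y, cube y -> V y -> F y = P y],
      exists V : set 'rV[R]_k, [/\ open V, V x & forall y, cube y -> V y -> F y = Q y] |
      [/\ base (P x) = base (F x), base (Q x) = base (F x) & base (N x) = base (F x)]].
Proof.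
move=> cx.
have sep (p q : M) : p <> q -> exists B C : set M,
    [/\ open B, open C, B p, C q & B `&` C `<=` set0].
  move=> /eqP pq; have := @manifold_hausdorff R M; rewrite open_hausdorff.
  move=> /(_ _ _ pq)[[B C] /= [pB qC] [oB oC /eqP BC]].
  by exists B, C; split=> //; [rewrite inE in pB|rewrite inE in qC|rewrite BC].
(* If [P] and [N] lie over different points at [x], they do so near [x]. This excludes the
   alternative in which [P] rests at [N], so [F] is [P] there. *)
have [E|E] := pselect (base (P x) = base (N x)); last first.
  have [B [C [oB oC Bp Cq BC]]] := sep _ _ E.
  have [V [oV Vx VB]] := base_near sP cx oB Bp.
  have [W [oW Wx WC]] := base_near sN cx oC Cq.
  constructor 1; exists (V `&` W); split=> //; first exact: openI.
  move=> y cy [Vy Wy]; case: (gF cy) => -[E1 E2] //.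
  by case: (BC (base (N y))); split; [rewrite -E2; exact: VB|exact: WC].
have [E'|E'] := pselect (base (Q x) = base (N x)); last first.
  have [B [C [oB oC Bp Cq BC]]] := sep _ _ E'.
  have [V [oV Vx VB]] := base_near sQ cx oB Bp.
  have [W [oW Wx WC]] := base_near sN cx oC Cq.
  constructor 2; exists (V `&` W); split=> //; first exact: openI.
  move=> y cy [Vy Wy]; case: (gF cy) => -[E1 E2] //.
  by case: (BC (base (N y))); split; [rewrite -E2; exact: VB|exact: WC].
by constructor 3; case: (gF cx) => -[-> _]; rewrite ?E ?E'.
Qed.

(** [theta] is typically a coordinate over a chart or trivialization domain [W], so [glued_eval]
    helps only where all three maps lie over [W]. In the last case of [glued_local] this is so near
    [x]; in the others [F] is locally [P] or [Q]. *)
Lemma glued_smooth_within (W : set M) (theta : frame A k -> R) : open W ->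
  smooth_within (@cube R k `&` [set x | W (base (P x))]) (fun x => theta (P x)) ->
  smooth_within (@cube R k `&` [set x | W (base (Q x))]) (fun x => theta (Q x)) ->
  smooth_within (@cube R k `&` [set x | W (base (N x))]) (fun x => theta (N x)) ->
  smooth_within (@cube R k `&` [set x | W (base (F x))]) (fun x => theta (F x)).
Proof.
move=> oW tP tQ tN; apply: smooth_within_local => x [cx Wx].
have one (G : cube_map A k) :
    smooth_within (@cube R k `&` [set x | W (base (G x))]) (fun x => theta (G x)) ->
    (exists V : set 'rV[R]_k, [/\ open V, V x & forall y, cube y -> V y -> F y = G y]) ->
    exists V : set 'rV[R]_k, [/\ open V, V x & smooth_within
      (@cube R k `&` [set x | W (base (F x))] `&` V) (fun x => theta (F x))].
  move=> tG [V [oV Vx FG]]; exists V; split=> //.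
  apply: (@smooth_within_ext _ _ _ (fun x => theta (G x))).
    by move=> y [[cy _] Vy]; rewrite FG.
  by apply: smooth_within_subset tG => y [[cy Wy] Vy]; split=> //; rewrite /= -FG.
have [HP|HQ|[EP EQ EN]] := glued_local cx; [exact: one HP|exact: one HQ|].
have nearW (G : cube_map A k) : smooth_cube_map G -> base (G x) = base (F x) ->
    exists V : set 'rV[R]_k, [/\ open V, V x & forall y, cube y -> V y -> W (base (G y))].
  by move=> sG EG; apply: (base_near sG) => //; rewrite EG.
have [V1 [oV1 xV1 W1]] := nearW P sP EP.
have [V2 [oV2 xV2 W2]] := nearW Q sQ EQ.
have [V3 [oV3 xV3 W3]] := nearW N sN EN.
exists (V1 `&` (V2 `&` V3)); split=> //; first by do 2?apply: openI.
apply: (@smooth_within_ext _ _ _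
    (fun x => theta (P x) + theta (Q x) + -1 * theta (N x))).
  by move=> y [[cy _] _]; rewrite mulN1r (glued_eval theta cy).
apply: smooth_withinD; first apply: smooth_withinD.
- by apply: smooth_within_subset tP => y [[cy _] [y1 _]]; split=> //; exact: W1.
- by apply: smooth_within_subset tQ => y [[cy _] [_ [y2 _]]]; split=> //; exact: W2.
- apply: smooth_withinM; first exact: smooth_within_cst.
  by apply: smooth_within_subset tN => y [[cy _] [_ [_ y3]]]; split=> //; exact: W3.
Qed.

Lemma glued_smooth : smooth_cube_map F.
Proof.
have [cP dP vP] := sP; have [cQ dQ vQ] := sQ; have [cN dN vN] := sN.
split.
- apply/subspace_continuousP => x cx B nB.
  have cvg1 (G : cube_map A k) : smooth_cube_map G -> base (G x) = base (F x) ->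
      nbhs x [set y | cube y -> B (base (G y))].
    move=> [/subspace_continuousP cG _ _] EG.
    have nB' : nbhs (base (G x)) B by rewrite EG.
    exact: (cG _ cx _ nB').
  have one (G : cube_map A k) : smooth_cube_map G ->
      (exists V : set 'rV[R]_k, [/\ open V, V x & forall y, cube y -> V y -> F y = G y]) ->
      nbhs x [set y | cube y -> B (base (F y))].
    move=> sG [V [oV Vx FG]].
    have nV : nbhs x V by exact: open_nbhs_nbhs.
    have nG := cvg1 G sG (congr1 (@base R M A k) (esym (FG x cx Vx))).
    apply: (@filterS2 _ (nbhs x) (nbhs_filter x) _ _ _ _ nV nG) => y Vy H cy.
    by rewrite FG //; exact: H.
  have [HP|HQ|[EP EQ EN]] := glued_local cx; [exact: one HP|exact: one HQ|].
  apply: (@filterS2 _ (nbhs x) (nbhs_filter x) _ _ _ _ (cvg1 P sP EP) (cvg1 Q sQ EQ)).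
  move=> y hP hQ cy; suff: B (base (F y)) by [].
  by case: (gF cy) => -[-> _]; [exact: hP|exact: hQ].
- move=> c j; apply: (@glued_smooth_within _ (fun p => chart c (base p) 0 j)) => //.
  exact: chart_dom_open.
- move=> t i j; apply: (@glued_smooth_within _ (fun p => triv t (vec p i) 0 j)) => //.
  exact: triv_dom_open.
Qed.

End Smooth.

(** Both sides of each morphism equation, the partial derivatives and the values of the anchor or of
    the 2-form, split as P + Q - N: [glued_eval] holds for every function of frames. *)
Lemma glue_morphism : is_morphism P -> is_morphism Q -> is_morphism N -> is_morphism F.
Proof.
move=> [sP bP fP] [sQ bQ fQ] [sN bN fN].
have partial_glued (theta : frame A k -> R) i x : cube x ->
    smooth_within (@cube R k) (fun y => theta (P y)) ->
    smooth_within (@cube R k) (fun y => theta (Q y)) ->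
    smooth_within (@cube R k) (fun y => theta (N y)) ->
    partial i (fun y => theta (F y)) x = partial i (fun y => theta (P y)) x
      + partial i (fun y => theta (Q y)) x - partial i (fun y => theta (N y)) x.
  move=> cx tP tQ tN.
  rewrite (@eq_partial _ _ _ (fun y => theta (P y) + theta (Q y) + - theta (N y)) i x cx);
    last by move=> y cy; rewrite (glued_eval theta cy).
  have tN' : smooth_within (@cube R k) (fun y => - theta (N y)).
    apply: (@smooth_within_ext _ _ _ (fun y => -1 * theta (N y))).
      by move=> y _; rewrite mulN1r.
    by apply: smooth_withinM => //; exact: smooth_within_cst.
  rewrite (@partialD _ _ (fun y => theta (P y) + theta (Q y)) _ i x cx (smooth_withinD tP tQ) tN').
  by rewrite (partialD i cx tP tQ) (partialN i cx tN).
split; first exact: glued_smooth.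
- move=> h sh i x cx.
  rewrite (@partial_glued (fun p => h (base p)) i x cx); try exact: smooth_within_base.
  by rewrite bP // bQ // bN // -(glued_eval (fun p => anchor (vec p i) h) cx).
- move=> w e fw fe dwe i j x cx.
  have pg a b := @partial_glued (fun p => w _ (vec p b)) a x cx
    (smooth_within_form sP b fw) (smooth_within_form sQ b fw) (smooth_within_form sN b fw).
  rewrite (pg i j) (pg j i) (glued_eval (fun p => e _ (vec p i) (vec p j)) cx).
  rewrite -(fP _ _ fw fe dwe i j x cx) -(fQ _ _ fw fe dwe i j x cx).
  rewrite -(fN _ _ fw fe dwe i j x cx).
  set a1 := partial _ _ _; set a2 := partial _ _ _; set a3 := partial _ _ _.
  set a4 := partial _ _ _; set a5 := partial _ _ _; set a6 := partial _ _ _.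
  by move: a1 a2 a3 a4 a5 a6 => *; ring.
Qed.

Lemma glue_thin : thin P -> thin Q -> thin F.
Proof.
move=> tP tQ x i j cx; case: (gF cx) => -[-> _]; [exact: tP|exact: tQ].
Qed.

End Glue.

Section Morphisms.
Variables (R : realType) (M : manifold R) (A : lie_algebroid M).

(** The degenerate gluing P = Q = N = f: changes outside of the cube are invisible. *)
Lemma eq_morphism k (f g : cube_map A k) :
  eq_on_cube f g -> is_morphism f -> is_morphism g.
Proof.
move=> fg mf; apply: (@glue_morphism _ _ _ _ f f f) => // x cx.
by left; rewrite fg.
Qed.

Definition constant_map k (x : M) : cube_map A k := fun=> existT _ x (fun=> 0).

Lemma constant_morphism k x : is_morphism (constant_map x : cube_map A k).
Proof.
split; first split.
- by apply: continuous_subspaceT => y; exact: cst_continuous.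
- by move=> c j; exact: (@smooth_within_cst R k _ (chart c x 0 j)).
- by move=> t i j; exact: (@smooth_within_cst R k _ (triv t (0 : A x) 0 j)).
- move=> h sh i y cy; apply: etrans (@partial_cst R k (h x) i y cy) _.
  have := anchor_sum (nil : seq 'I_0) (fun=> 0) (fun=> 0 : A x) sh.
  by rewrite !big_nil => ->.
- move=> w e _ [fe _] _ i j y cy.
  have p0 a b : partial a (fun z => w _ (vec (constant_map x z : frame A k) b)) y = 0.
    exact: (@partial_cst R k (w x 0) a y cy).
  by rewrite !p0 subrr; have [_ _ ->] := fe x.
Qed.

End Morphisms.

(** * Linear changes of frames *)

Section Lin.
Variables (R : realType) (M : manifold R) (A : lie_algebroid M).

Lemma frame_eq k (x : M) (v v' : 'I_k -> A x) :
  v =1 v' -> existT _ x v = existT _ x v' :> frame A k.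
Proof. by move=> /funext ->. Qed.

Lemma eq_lin m k (C D : 'I_m -> 'I_k -> R) (p : frame A k) :
  (forall i j, C i j = D i j) -> lin C p = lin D p.
Proof.
by move=> CD; apply: frame_eq => i; apply: eq_bigr => j _; rewrite CD.
Qed.

Lemma lin_diag k (d : 'I_k -> R) (p : frame A k) :
  lin (fun i j => (i == j)%:R * d i) p = existT _ (base p) (fun i => d i *: vec p i).
Proof.
apply: frame_eq => i; rewrite (bigD1 i) //= eqxx mul1r big1 ?addr0 // => j ji.
by rewrite eq_sym (negbTE ji) mul0r scale0r.
Qed.

Lemma lin_id k (p : frame A k) : lin (fun i j => (i == j)%:R) p = p.
Proof.
transitivity (lin (fun i j => (i == j)%:R * 1) p).
  by apply: eq_lin => i j; rewrite mulr1.
rewrite lin_diag; case: p => x v; apply: frame_eq => i /=; exact: scale1r.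
Qed.

Lemma lin_lin l m k (D : 'I_l -> 'I_m -> R) (C : 'I_m -> 'I_k -> R) (p : frame A k) :
  lin D (lin C p) = lin (fun i j => \sum_a D i a * C a j) p.
Proof.
apply: frame_eq => i /=.
under eq_bigr => a _ do rewrite scaler_sumr.
rewrite exchange_big /=; apply: eq_bigr => j _.
by rewrite scaler_suml; apply: eq_bigr => a _; rewrite scalerA.
Qed.

Lemma lin_zero m k (C : 'I_m -> 'I_k -> R) (p : frame A k) :
  (forall i j, C i j *: vec p j = 0) -> lin C p = existT _ (base p) (fun=> 0).
Proof. by move=> H; apply: frame_eq => i; rewrite big1. Qed.

Lemma scale_atE k (i : 'I_k) c (p : frame A k) :
  scale_at i c p = lin (fun a b => (a == b)%:R * (if a == i then c else 1)) p.
Proof.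
rewrite lin_diag; apply: frame_eq => j.
by case: ifP => // _; rewrite scale1r.
Qed.

Lemma faceE k (i : 'I_k.+1) c (f : cube_map A k.+1) x :
  face i c f x = lin (fun a b => (lift i a == b)%:R) (f (face_point i c x)).
Proof.
apply: frame_eq => a; rewrite (bigD1 (lift i a)) //= eqxx scale1r big1 ?addr0 // => j ji.
by rewrite eq_sym (negbTE ji) scale0r.
Qed.

End Lin.

(** * Substitution in one coordinate *)

Section Substitution.
Variable R : realType.

Lemma derive_comp_coord k (u : R -> R) (i : 'I_k) (x v : 'rV[R]_k) : smooth1 u ->
  'D_v (fun y : 'rV[R]_k => u (y ord0 i)) x = derive1 u (x ord0 i) * v ord0 i.
Proof.
move=> su.
have [dx ex] := derive_coord i x v.
have df : differentiable (fun y : 'rV[R]_k => y ord0 i) x by exact: differentiable_coord.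
have /derivable1_diffP du := su 0%N (x ord0 i).
have duf := differentiable_comp df du.
rewrite (deriveE _ duf) diff_comp //= -(deriveE _ df) ex derive1E (deriveE _ du).
by rewrite -[X in 'd u _ X = _]mulr1 linearZ /= mulrC.
Qed.

Definition sub k (i : 'I_k) (u : R -> R) (x : 'rV[R]_k) : 'rV[R]_k :=
  set_coord i (u (x ord0 i)) x.

Lemma subE k (i : 'I_k) u (x : 'rV[R]_k) j :
  sub i u x ord0 j = if j == i then u (x ord0 i) else x ord0 j.
Proof. by rewrite mxE. Qed.

Lemma smooth_sub k (i : 'I_k) u : smooth1 u -> smooth_map (sub i u).
Proof.
move=> su j; rewrite [X in smooth_on _ X](_ : _ =
  (fun x : 'rV[R]_k => if j == i then u (x ord0 i) else x ord0 j)); last first.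
  by apply/funext => x; rewrite subE.
case: (j == i); last exact: smooth_on_coord.
by apply: smooth_on_comp1 => //; [exact: openT|exact: smooth_on_coord].
Qed.

Lemma jac_sub k (i : 'I_k) u (x : 'rV[R]_k) a b : smooth1 u ->
  jac (sub i u) x a b = (a == b)%:R * (if a == i then derive1 u (x ord0 i) else 1).
Proof.
move=> su; rewrite /jac.
have -> : (fun y => sub i u y 0 b) =
    (fun y : 'rV[R]_k => if b == i then u (y ord0 i) else y ord0 b).
  by apply/funext => y; rewrite subE.
have [->|bi] := eqVneq b i.
  rewrite derive_comp_coord // mxE eqxx /= eq_sym mulrC.
  by case: eqP => _; rewrite ?mul0r ?mul1r.
have [_ ->] := derive_coord b x (basis_vec R a); rewrite mxE eqxx /= eq_sym.
have [->|_] := eqVneq a b; last by rewrite mul0r.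
by rewrite (negbTE bi) mulr1.
Qed.

Lemma cube_sub k (i : 'I_k) u (x : 'rV[R]_k) :
  (forall t, 0 <= t <= 1 -> 0 <= u t <= 1) -> cube x -> cube (sub i u x).
Proof. by move=> u01 cx j; rewrite subE; case: ifP => _; [exact: u01|]. Qed.

Lemma cube_set_coord k (i : 'I_k) c (x : 'rV[R]_k) :
  0 <= c <= 1 -> cube x -> cube (set_coord i c x).
Proof. by move=> c01 cx j; rewrite mxE; case: ifP. Qed.

Lemma smooth1D (u v : R -> R) : smooth1 u -> smooth1 v -> smooth1 (fun t => u t + v t).
Proof. by move=> /smooth1P su /smooth1P sv; apply/smooth1P => m; exact: D1D. Qed.

Lemma smooth1M (u v : R -> R) : smooth1 u -> smooth1 v -> smooth1 (fun t => u t * v t).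
Proof. by move=> /smooth1P su /smooth1P sv; apply/smooth1P => m; exact: D1M. Qed.

Lemma smooth1_comp (u v : R -> R) : smooth1 u -> smooth1 v -> smooth1 (fun t => u (v t)).
Proof. by move=> /smooth1P su /smooth1P sv; apply/smooth1P => m; exact: D1_comp. Qed.

Lemma smooth1_cst (a : R) : smooth1 (fun=> a).
Proof. by apply/smooth1P => m; exact: D1_cst. Qed.

Lemma smooth1_id : smooth1 (id : R -> R).
Proof. by apply/smooth1P => m; exact: D1_id. Qed.

Lemma smooth1_affine (a b : R) : smooth1 (fun t => a * t + b).
Proof.
apply: smooth1D; last exact: smooth1_cst.
by apply: smooth1M; [exact: smooth1_cst|exact: smooth1_id].
Qed.

Lemma smooth1_is_derive (u : R -> R) (t : R) : smooth1 u ->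
  is_derive t (1:R) u (derive1 u t).
Proof. by move=> su; rewrite derive1E; apply: derivableP; exact: (su 0%N). Qed.

Lemma derive1_affine_comp (u : R -> R) (a b t : R) : smooth1 u ->
  derive1 (fun t => u (a * t + b)) t = a * derive1 u (a * t + b).
Proof.
move=> su.
have da : derive1 (fun t : R => a * t + b) t = a.
  have E : is_derive t (1:R) (fun t : R => a * t + b) a.
    have := is_deriveD (is_deriveM (is_derive_cst a t 1) (is_derive_id t 1)) (is_derive_cst b t 1).
    move=> h; apply: is_derive_eq h _.
    by rewrite -[_ *: (0:R)]/(_ * 0) mulr0 -[_ *: (1:R)]/(_ * 1) mulr1 !addr0.
  by rewrite derive1E; case: E.
rewrite (@derive1_comp _ (fun t => a * t + b) u).
- by rewrite da mulrC.
- exact: (@smooth1_affine a b 0%N t).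
- exact: (su 0%N).
Qed.

End Substitution.

(** * Concatenation as a gluing of pullbacks *)

Section PullSub.
Variables (R : realType) (M : manifold R) (A : lie_algebroid M) (k : nat).

Lemma pull_sub (i : 'I_k) u (f : cube_map A k) x : smooth1 u ->
  pull (sub i u) f x = scale_at i (derive1 u (x ord0 i)) (f (set_coord i (u (x ord0 i)) x)).
Proof.
by move=> su; rewrite scale_atE; apply: eq_lin => a b; exact: jac_sub.
Qed.

Lemma scale_at_scale_at (i : 'I_k) c d (p : frame A k) :
  scale_at i c (scale_at i d p) = scale_at i (c * d) p.
Proof.
apply: frame_eq => j; rewrite /scale_at /vec /=.
by case: (j == i); first exact: scalerA.
Qed.

Lemma set_coord_set_coord (i : 'I_k) c d (x : 'rV[R]_k) :
  set_coord i c (set_coord i d x) = set_coord i c x.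
Proof. by apply/rowP => j; rewrite !mxE; case: (j == i). Qed.

Lemma set_coordK (i : 'I_k) c (x : 'rV[R]_k) : set_coord i c x ord0 i = c.
Proof. by rewrite mxE eqxx. Qed.

Variables (i : 'I_k) (tau : R -> R).
Hypothesis ftau : flat_reparam tau.

(** Smooth on the whole line and equal to 1 from 1/2 on, as [second_half] is 0 up to 1/2. The
    summand 0 gives both the shape expected by [derive1_affine_comp]. *)
Definition first_half (t : R) : R := clamp tau (2 * t + 0).
Definition second_half (t : R) : R := clamp tau (2 * t + -1).

Lemma smooth1_first_half : smooth1 first_half.
Proof. exact: (@smooth1_comp _ _ _ (@smooth1_clamp _ _ ftau) (@smooth1_affine _ 2 0)). Qed.

Lemma smooth1_second_half : smooth1 second_half.
Proof. exact: (@smooth1_comp _ _ _ (@smooth1_clamp _ _ ftau) (@smooth1_affine _ 2 (-1))). Qed.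

Lemma derive_first_half t : derive1 first_half t = 2 * derive1 (clamp tau) (2 * t + 0).
Proof. exact/derive1_affine_comp/smooth1_clamp. Qed.

Lemma derive_second_half t : derive1 second_half t = 2 * derive1 (clamp tau) (2 * t + -1).
Proof. exact/derive1_affine_comp/smooth1_clamp. Qed.

Lemma first_half_ge t : 2^-1 <= t -> first_half t = 1.
Proof. by move=> t1; rewrite /first_half /clamp cut_ge1 //; lra. Qed.

Lemma second_half_le t : t <= 2^-1 -> second_half t = 0.
Proof. by move=> t1; rewrite /second_half /clamp cut_le0 //; lra. Qed.

Lemma derive_first_half_ge t : 2^-1 <= t -> derive1 first_half t = 0.
Proof.
move=> t1; rewrite derive_first_half derive_clamp_out ?mulr0 //; right; lra.
Qed.

Lemma derive_second_half_le t : t <= 2^-1 -> derive1 second_half t = 0.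
Proof.
move=> t1; rewrite derive_second_half derive_clamp_out ?mulr0 //; left; lra.
Qed.

Lemma first_half01 t : 0 <= first_half t <= 1.
Proof. exact: clamp01. Qed.

Lemma second_half01 t : 0 <= second_half t <= 1.
Proof. exact: clamp01. Qed.

Lemma first_half0 : first_half 0 = 0.
Proof. by rewrite /first_half /clamp cut_le0 // mulr0 addr0. Qed.

Lemma second_half1 : second_half 1 = 1.
Proof. by rewrite /second_half /clamp cut_ge1 //; lra. Qed.

(** The factor 2 of [concat] and the factor tau' of [reparam] multiply to the derivative of the
    half, by the chain rule; on the cube [clamp tau] is [tau]. *)
Lemma smooth_concatE (g f : cube_map A k) x : cube x ->
  smooth_concat i tau g f x = if x ord0 i <= 2^-1 then pull (sub i first_half) f x
                              else pull (sub i second_half) g x.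
Proof.
move=> cx; have [x0 x1] := andP (cx i).
have [_ _ t0 t1 _] := ftau.
rewrite /smooth_concat /concat /reparam; case: ifPn => [xh|].
  rewrite pull_sub; last exact: smooth1_first_half.
  have xx : 0 <= 2 * x ord0 i <= 1 by apply/andP; split; lra.
  rewrite scale_at_scale_at set_coord_set_coord set_coordK derive1n1.
  by rewrite derive_first_half addr0 derive_clamp // /first_half /clamp addr0 cut_in.
rewrite -ltNge => xh; rewrite pull_sub; last exact: smooth1_second_half.
have xx : 0 <= 2 * x ord0 i - 1 <= 1 by apply/andP; split; lra.
rewrite scale_at_scale_at set_coord_set_coord set_coordK derive1n1.
by rewrite derive_second_half derive_clamp // /second_half /clamp cut_in.
Qed.

Lemma pull_sub_cst (f : cube_map A k) u (x : 'rV[R]_k) (c : R) : smooth1 u ->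
  u (x ord0 i) = c -> derive1 u (x ord0 i) = 0 ->
  pull (sub i u) f x = pull (sub i (fun=> c)) f x.
Proof.
move=> su ux du; rewrite !pull_sub //; last exact: smooth1_cst.
by rewrite ux du derive1_cst.
Qed.

Variables g f : cube_map A k.
Hypothesis fg : forall x, cube x ->
  pull (sub i (fun=> 0)) g x = pull (sub i (fun=> 1)) f x.

(** Beyond the seam the first pullback rests at the end face of [f], before it the second rests at
    the initial face of [g]; by [fg] these resting maps coincide. Pulling back along a constant
    kills the i-th vector, so [fg] compares only what is tangent to the face. *)
Lemma smooth_concat_glued : glued (pull (sub i first_half) f)
  (pull (sub i second_half) g) (pull (sub i (fun=> 1)) f) (smooth_concat i tau g f).
Proof.
move=> x cx; rewrite smooth_concatE //; case: ifPn => [xh|].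
  left; split=> //; rewrite -fg //; apply: pull_sub_cst.
  - exact: smooth1_second_half.
  - exact: second_half_le.
  - exact: derive_second_half_le.
rewrite -ltNge => /ltW xh; right; split=> //; apply: pull_sub_cst.
- exact: smooth1_first_half.
- exact: first_half_ge.
- exact: derive_first_half_ge.
Qed.

Lemma smooth_concat_morphism : is_morphism f -> is_morphism g ->
  is_morphism (smooth_concat i tau g f).
Proof.
move=> mf mg; apply: (glue_morphism smooth_concat_glued).
- apply: pull_morphism => //; first exact/smooth_sub/smooth1_first_half.
  by move=> x; apply: cube_sub => t _; exact: first_half01.
- apply: pull_morphism => //; first exact/smooth_sub/smooth1_second_half.
  by move=> x; apply: cube_sub => t _; exact: second_half01.
- apply: pull_morphism => //; first exact/smooth_sub/smooth1_cst.
  by move=> x; apply: cube_sub => t _; rewrite ler01 lexx.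
Qed.

Lemma smooth_concat_thin : thin f -> thin g -> thin (smooth_concat i tau g f).
Proof.
move=> mf mg; apply: (glue_thin smooth_concat_glued); apply: pull_thin => // x.
- by apply: cube_sub => t _; exact: first_half01.
- by apply: cube_sub => t _; exact: second_half01.
Qed.

End PullSub.

(** * Homotopies of A-paths *)

Section HomotopyRelation.
Variables (R : realType) (M : manifold R) (A : lie_algebroid M).
Implicit Types (a b c : cube_map A 1) (u v : R -> R).

Lemma sum_delta n (i : 'I_n) (F : 'I_n -> R) : \sum_a (i == a)%:R * F a = F i.
Proof.
rewrite (bigD1 i) //= eqxx mul1r big1 ?addr0 // => j ji.
by rewrite eq_sym (negbTE ji) mul0r.
Qed.

Lemma face_point_lift k (i : 'I_k.+1) (c : R) x j :
  face_point i c x ord0 (lift i j) = x ord0 j.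
Proof. by rewrite mxE liftK. Qed.

Lemma face_point_at k (i : 'I_k.+1) (c : R) x : face_point i c x ord0 i = c.
Proof. by rewrite mxE unlift_none. Qed.

Lemma cube_face_point k (i : 'I_k.+1) (c : R) x :
  0 <= c <= 1 -> cube x -> cube (face_point i c x).
Proof.
move=> c01 cx j; have [->|] := eqVneq j i; first by rewrite face_point_at.
by rewrite eq_sym => /unlift_some[j' -> _]; rewrite face_point_lift.
Qed.

Lemma t_dirE : t_dir = lift s_dir ord0.
Proof. exact: val_inj. Qed.

Lemma vec_scale_at_eq0 k (i j : 'I_k) (c : R) (p : frame A k) :
  vec p j = 0 -> vec (scale_at i c p) j = 0.
Proof.
by rewrite /scale_at /vec /= => ->; case: ifP => // _; exact: scaler0.
Qed.

Lemma not_s_dir (i : 'I_2) : i != s_dir -> i = t_dir.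
Proof.
case: i => [[|[|//]] p] im; apply: val_inj => //=.
Qed.

Lemma cube1P (x : 'rV[R]_1) : cube x -> 0 <= x ord0 ord0 <= 1.
Proof. by move=> /(_ ord0). Qed.

(** Homotopy for [false], thin homotopy for [true], so that each construction is carried out once
    for both. *)
Definition hrel (thinness : bool) a b := [/\ Apath a, Apath b &
  exists s : cube_map A 2, homotopy s a b /\ (thinness -> thin s)].

Lemma homotopicE a b : homotopic a b <-> hrel false a b.
Proof.
split=> [[pa pb [s hs]]|[pa pb [s [hs _]]]]; split=> //; first by exists s.
by exists s.
Qed.

Lemma thin_homotopicE a b : thin_homotopic a b <-> hrel true a b.
Proof.
split=> [[pa pb [s [hs ts]]]|[pa pb [s [hs ts]]]]; split=> //; exists s; split=> //.
exact: ts.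
Qed.

Lemma hrel_thin th a b : hrel true a b -> hrel th a b.
Proof.
by move=> [pa pb [s [hs ts]]]; split=> //; exists s; split=> // _; exact: ts.
Qed.

Lemma eq_hrel th a a' b b' : hrel th a b -> eq_on_cube a a' -> eq_on_cube b b' ->
  hrel th a' b'.
Proof.
move=> [pa pb [s [[ms s0 s1 sv] ts]]] aa bb; split.
- exact: eq_morphism pa.
- exact: eq_morphism pb.
- exists s; split=> //; split=> // x cx; [by rewrite s0 // aa|by rewrite s1 // bb].
Qed.

Definition interp u v (x : 'rV[R]_2) : 'rV[R]_1 :=
  \row_j ((1 + -1 * x ord0 s_dir) * u (x ord0 t_dir) + x ord0 s_dir * v (x ord0 t_dir)).

Lemma smooth_interp u v : smooth1 u -> smooth1 v -> smooth_map (interp u v).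
Proof.
move=> su sv j; rewrite [X in smooth_on _ X](_ : _ = fun x : 'rV[R]_2 =>
  (1 + -1 * x ord0 s_dir) * u (x ord0 t_dir) + x ord0 s_dir * v (x ord0 t_dir)); last first.
  by apply/funext => x; rewrite mxE.
have oT := @openT 'rV[R]_2.
have sc i : smooth_on setT (fun x : 'rV[R]_2 => x ord0 i) by exact: smooth_on_coord.
apply: smooth_onD => //; apply: smooth_onM => //; try exact: smooth_on_comp1.
apply: smooth_onD => //; first exact: smooth_on_cst.
by apply: smooth_onM => //; exact: smooth_on_cst.
Qed.

Lemma jac_interp u v x (i : 'I_2) j : smooth1 u -> smooth1 v ->
  jac (interp u v) x i j =
  (i == s_dir)%:R * (v (x ord0 t_dir) - u (x ord0 t_dir)) +
  (i == t_dir)%:R * ((1 - x ord0 s_dir) * derive1 u (x ord0 t_dir)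
                     + x ord0 s_dir * derive1 v (x ord0 t_dir)).
Proof.
move=> su sv; rewrite /jac.
have -> : (fun y => interp u v y 0 j) = (fun y : 'rV[R]_2 =>
    (1 + -1 * y ord0 s_dir) * u (y ord0 t_dir) + y ord0 s_dir * v (y ord0 t_dir)).
  by apply/funext => y; rewrite mxE.
set e := basis_vec R i.
have eE l : e ord0 l = (i == l)%:R by rewrite mxE eqxx /= eq_sym.
have ds : is_derive x e (fun y : 'rV[R]_2 => y ord0 s_dir) ((i == s_dir)%:R).
  by rewrite -eE; exact: derive_coord.
have dc w : smooth1 w -> is_derive x e (fun y : 'rV[R]_2 => w (y ord0 t_dir))
    (derive1 w (x ord0 t_dir) * (i == t_dir)%:R).
  move=> sw; rewrite -eE -derive_comp_coord //; apply: derivableP.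
  apply: (@smooth_on_derivable _ _ setT) => //.
  by apply: smooth_on_comp1 => //; [exact: openT|exact: smooth_on_coord].
have d1 := is_deriveD (is_derive_cst (1:R) x e) (is_deriveM (is_derive_cst (-1:R) x e) ds).
have [_] := is_deriveD (is_deriveM d1 (dc u su)) (is_deriveM ds (dc v sv)).
move=> ->; rewrite /GRing.scale /= /cst.
rewrite -[X in X * (_ * (i == t_dir)%:R) + _]/(1 + -1 * x ord0 s_dir).
by move: (derive1 u _) (derive1 v _) (u _) (v _) => p q r s; ring.
Qed.

Lemma cube_interp u v x : (forall t, 0 <= t <= 1 -> 0 <= u t <= 1) ->
  (forall t, 0 <= t <= 1 -> 0 <= v t <= 1) -> cube x -> cube (interp u v x).
Proof.
move=> u01 v01 cx j; rewrite mxE.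
have := cx s_dir; have /u01 := cx t_dir; have /v01 := cx t_dir.
move: (u (x ord0 t_dir)) (v (x ord0 t_dir)) (x ord0 s_dir) => p q s.
move=> /andP[p0 p1] /andP[q0 q1] /andP[s0 s1].
by apply/andP; split; nra.
Qed.

Definition path_sub u a : cube_map A 1 := pull (sub ord0 u) a.

Lemma path_sub_path u a : smooth1 u -> (forall t, 0 <= t <= 1 -> 0 <= u t <= 1) ->
  Apath a -> Apath (path_sub u a).
Proof.
move=> su u01 pa; apply: pull_morphism => //; first exact: smooth_sub.
by move=> x; exact: cube_sub.
Qed.

Lemma face_interp u v a (c : R) (x : 'rV[R]_1) : smooth1 u -> smooth1 v ->
  forall w, smooth1 w ->
  (forall t, (1 + -1 * c) * u t + c * v t = w t) ->
  (forall t, (1 - c) * derive1 u t + c * derive1 v t = derive1 w t) ->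
  face s_dir c (pull (interp u v) a) x = path_sub w a x.
Proof.
move=> su sv w sw uvw duvw; rewrite faceE /pull lin_lin.
have fs : face_point s_dir c x ord0 s_dir = c by exact: face_point_at.
have ft : face_point s_dir c x ord0 t_dir = x ord0 ord0.
  by rewrite t_dirE face_point_lift.
have -> : interp u v (face_point s_dir c x) = sub ord0 w x.
  by apply/rowP => j; rewrite mxE subE [j]ord1 eqxx fs ft uvw.
apply: eq_lin => i j; rewrite [i]ord1 [j]ord1.
rewrite (sum_delta _ (fun l => jac (interp u v) (face_point s_dir c x) l ord0)).
rewrite jac_interp // jac_sub // fs ft eqxx mul1r /= mul0r add0r mul1r.
exact: duvw.
Qed.

(** The s-derivative of the interpolation is v - u, which vanishes at t = 0 and t = 1. So the end
    points stay fixed, and thinness is automatic for a pullback of a path. *)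
Lemma path_sub_hrel th u v a : smooth1 u -> smooth1 v ->
  (forall t, 0 <= t <= 1 -> 0 <= u t <= 1) ->
  (forall t, 0 <= t <= 1 -> 0 <= v t <= 1) ->
  u 0 = v 0 -> u 1 = v 1 -> Apath a -> hrel th (path_sub u a) (path_sub v a).
Proof.
move=> su sv u01 v01 uv0 uv1 pa; split; try exact: path_sub_path.
exists (pull (interp u v) a); split; last by move=> _; exact: pull_path_thin.
split.
- apply: pull_morphism => //; first exact: smooth_interp.
  by move=> x; exact: cube_interp.
- move=> x cx; apply: face_interp => // t; first by rewrite mulr0 addr0 mul1r mul0r addr0.
  by rewrite subr0 mul1r mul0r addr0.
- move=> x cx; apply: face_interp => // t; first by rewrite mulr1 subrr mul0r mul1r add0r.
  by rewrite subrr mul0r mul1r add0r.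
move=> x i cx im xi; rewrite /= big1 // => j _.
rewrite (not_s_dir im) in xi.
have E : u (x ord0 t_dir) = v (x ord0 t_dir) by case: xi => ->.
rewrite jac_interp // (_ : (ord_max == t_dir) = false) // mul0r addr0.
by rewrite E subrr mulr0 scale0r.
Qed.

Lemma path_sub_id a x : path_sub id a x = a x.
Proof.
have dx : derive1 (id : R -> R) (x ord0 ord0) = 1 by rewrite derive1E derive_id.
rewrite /path_sub /pull; have -> : sub ord0 id x = x.
  by apply/rowP => j; rewrite subE; case: eqP => // ->.
rewrite -[RHS]lin_id; apply: eq_lin => i j; rewrite jac_sub; last exact: smooth1_id.
by rewrite [i]ord1 eqxx dx mulr1.
Qed.

Lemma hrel_refl th a : Apath a -> hrel th a a.
Proof.
move=> pa; apply: (@eq_hrel _ (path_sub id a) _ (path_sub id a));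
  try by move=> x _; exact: path_sub_id.
by apply: path_sub_hrel => //; exact: smooth1_id.
Qed.

Lemma hrel_sym th a b : hrel th a b -> hrel th b a.
Proof.
move=> [pa pb [s [[ms s0 s1 sv] ts]]]; split=> //.
pose u (t : R) := -1 * t + 1.
have su : smooth1 u by exact: smooth1_affine.
have u01 t : 0 <= t <= 1 -> 0 <= u t <= 1 by rewrite /u => ?; lra.
have fE (c : R) (x : 'rV[R]_1) : face s_dir c (pull (sub s_dir u) s) x = face s_dir (u c) s x.
  rewrite !faceE /pull lin_lin.
  have -> : sub s_dir u (face_point s_dir c x) = face_point s_dir (u c) x.
    apply/rowP => j; rewrite subE; have [->|] := eqVneq j s_dir.
      by rewrite !face_point_at.
    by rewrite eq_sym => /unlift_some[j' -> _]; rewrite !face_point_lift.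
  apply: eq_lin => i j; rewrite (sum_delta _ (fun l => jac (sub s_dir u) _ l j)).
  have li : (lift s_dir i == s_dir) = false by rewrite eq_sym; exact/negbTE/neq_lift.
  by rewrite jac_sub // li mulr1.
exists (pull (sub s_dir u) s); split; last first.
  by move=> tt; apply: pull_thin; [move=> x; exact: cube_sub|exact: ts].
split.
- by apply: pull_morphism => //; [exact: smooth_sub|move=> x; exact: cube_sub].
- by move=> x cx; rewrite fE /u mulr0 add0r s1.
- by move=> x cx; rewrite fE /u mulr1 addNr s0.
move=> x i cx im xi; rewrite pull_sub //; apply: vec_scale_at_eq0.
apply: (sv _ i) => //; first by apply: cube_set_coord => //; exact: u01.
by rewrite mxE (negbTE im).
Qed.

End HomotopyRelation.

(** * Faces of cube maps *)

Section Faces.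
Variables (R : realType) (M : manifold R) (A : lie_algebroid M).

Lemma eq_pull m k (phi : 'rV[R]_m -> 'rV[R]_k) (f g : cube_map A k) x :
  f (phi x) = g (phi x) -> pull phi f x = pull phi g x.
Proof. by rewrite /pull => ->. Qed.

Lemma smooth_face_point k (i : 'I_k.+1) (c : R) : smooth_map (face_point i c).
Proof.
move=> j; have [->|] := eqVneq j i.
  under eq_fun do rewrite (face_point_at i c); exact: smooth_on_cst.
rewrite eq_sym => /unlift_some[j' -> _].
under eq_fun do rewrite (face_point_lift i c); exact: smooth_on_coord.
Qed.

Lemma face_pull k (i : 'I_k.+1) (c : R) (f : cube_map A k.+1) x :
  face i c f x = pull (face_point i c) f x.
Proof.
rewrite faceE; apply: eq_lin => a j; rewrite /jac; have [->|] := eqVneq j i.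
  rewrite eq_sym (negbTE (neq_lift _ _)).
  under eq_fun do rewrite (face_point_at i c).
  by rewrite derive_cst.
rewrite eq_sym => /unlift_some[j' -> _].
under eq_fun do rewrite (face_point_lift i c).
have [_ ->] := derive_coord j' x (basis_vec R a); rewrite mxE eqxx /=.
by rewrite (inj_eq (@lift_inj _ i)) eq_sym.
Qed.

Lemma face_morphism k (i : 'I_k.+1) (c : R) (f : cube_map A k.+1) :
  0 <= c <= 1 -> is_morphism f -> is_morphism (face i c f).
Proof.
move=> c01 mf; apply: (@eq_morphism _ _ _ _ (pull (face_point i c) f)).
  by move=> x _; rewrite face_pull.
apply: pull_morphism => //; first exact: smooth_face_point.
by move=> x; exact: cube_face_point.
Qed.

Lemma eq_face k (i : 'I_k.+1) (c : R) (f g : cube_map A k.+1) x :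
  f (face_point i c x) = g (face_point i c x) -> face i c f x = face i c g x.
Proof. by rewrite /face => ->. Qed.

(** The derivative of [u] does not enter, as it scales only the vector that the face forgets. *)
Lemma face_pull_sub k (i : 'I_k.+1) (c : R) u (f : cube_map A k.+1) x : smooth1 u ->
  face i c (pull (sub i u) f) x = face i (u c) f x.
Proof.
move=> su; rewrite !faceE /pull lin_lin.
have -> : sub i u (face_point i c x) = face_point i (u c) x.
  apply/rowP => j; rewrite subE; have [->|] := eqVneq j i.
    by rewrite !face_point_at.
  by rewrite eq_sym => /unlift_some[j' -> _]; rewrite !face_point_lift.
apply: eq_lin => a j; rewrite (sum_delta _ (fun l => jac (sub i u) _ l j)).
have li : (lift i a == i) = false by rewrite eq_sym; exact/negbTE/neq_lift.
by rewrite jac_sub // li mulr1.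
Qed.

Lemma face_pull_sub_t (c : R) u (f : cube_map A 2) x : smooth1 u ->
  face s_dir c (pull (sub t_dir u) f) x = pull (sub ord0 u) (face s_dir c f) x.
Proof.
move=> su; rewrite faceE /pull faceE !lin_lin.
have -> : sub t_dir u (face_point s_dir c x) = face_point s_dir c (sub ord0 u x).
  apply/rowP => j; rewrite subE; have [->|/not_s_dir ->] := eqVneq j s_dir.
    by rewrite !face_point_at.
  by rewrite eqxx t_dirE !face_point_lift subE eqxx.
apply: eq_lin => a j; rewrite (sum_delta _ (fun l => jac (sub t_dir u) _ l j)).
rewrite big_ord1 !jac_sub // [a]ord1 -t_dirE eqxx t_dirE face_point_lift /= mul1r.
exact: mulrC.
Qed.

(** Reduces the matching hypothesis of a concatenation to an equality of faces. *)
Lemma pull_sub_cst_face k (f : cube_map A k.+1) (i : 'I_k.+1) (c : R) x :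
  pull (sub i (fun=> c)) f x =
  lin (fun a b => (a == lift i b)%:R) (face i c f (\row_j x ord0 (lift i j))).
Proof.
rewrite faceE lin_lin /pull.
have -> : sub i (fun=> c) x = face_point i c (\row_j x ord0 (lift i j)).
  apply/rowP => j; rewrite subE; have [->|] := eqVneq j i.
    by rewrite face_point_at.
  by rewrite eq_sym => /unlift_some[j' -> _]; rewrite face_point_lift mxE.
apply: eq_lin => a b; rewrite jac_sub; last exact: smooth1_cst.
rewrite derive1_cst; have [->|] := eqVneq a i.
  rewrite mulr0 big1 // => l _.
  by rewrite (negbTE (neq_lift _ _)) mul0r.
rewrite eq_sym mulr1 => /unlift_some[a' -> _].
under eq_bigr do rewrite (inj_eq (@lift_inj _ i)).
by rewrite (sum_delta _ (fun l => (lift i l == b)%:R)).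
Qed.

Lemma eq_smooth_concat k (i : 'I_k) tau (f f' g g' : cube_map A k) : flat_reparam tau ->
  eq_on_cube f f' -> eq_on_cube g g' ->
  eq_on_cube (smooth_concat i tau g f) (smooth_concat i tau g' f').
Proof.
move=> ft ff gg x cx; rewrite !smooth_concatE //; case: ifP => _; apply: eq_pull.
  by apply: ff; apply: cube_sub => // t _; exact: first_half01.
by apply: gg; apply: cube_sub => // t _; exact: second_half01.
Qed.

End Faces.

(** * End points of homotopic paths *)

Section Endpoints.
Variables (R : realType) (M : manifold R) (A : lie_algebroid M).
Implicit Types (a b c : cube_map A 1).

Lemma cube_const k (c : R) : 0 <= c <= 1 -> cube (const_mx c : 'rV[R]_k).
Proof. by move=> c01 j; rewrite mxE. Qed.

Lemma partial0_constant (F : 'rV[R]_1 -> R) x y : smooth_within (@cube R 1) F ->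
  (forall z, cube z -> partial ord0 F z = 0) -> cube x -> cube y -> F x = F y.
Proof.
move=> sF dF; suff key (s t : R) : 0 <= s <= 1 -> 0 <= t <= 1 -> s < t ->
    F (const_mx s) = F (const_mx t).
  have row1 (z : 'rV[R]_1) : z = const_mx (z ord0 ord0).
    by apply/rowP => j; rewrite mxE [j]ord1.
  move=> cx cy; rewrite (row1 x) (row1 y).
  have [xy|xy|->//] := ltrgtP (x ord0 ord0) (y ord0 ord0).
    by apply: key => //; exact: cube1P.
  by apply/esym; apply: key => //; exact: cube1P.
move=> /andP[s0 s1] /andP[t0 t1] st.
have lineE (r : R) : (const_mx r : 'rV[R]_1) = 0 + r *: basis_vec R ord0.
  by apply/rowP => j; rewrite !mxE [j]ord1 eqxx mulr1 add0r.
have cr (r : R) : s <= r <= t -> cube (const_mx r : 'rV[R]_1).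
  by move=> /andP[sr rt]; apply: cube_const; apply/andP; split; lra.
have cline (r : R) : {for r, continuous (fun r : R => const_mx r : 'rV[R]_1)}.
  have -> : (fun q : R => const_mx q : 'rV[R]_1) = (fun q => q *: const_mx 1).
    by apply/funext => q; apply/rowP => j; rewrite !mxE mulr1.
  by apply: cvgZr_tmp; exact: cvg_id.
(* [F] is controlled only on the cube, so the mean value theorem is fed with local extensions: their
   derivative in the interior, their continuity also at the ends. *)
have ext (r : R) : s <= r <= t -> exists g : R -> R, exists2 V : set R, nbhs r V &
    is_derive r (1:R) g 0 /\ forall q, s <= q <= t -> V q -> F (const_mx q) = g q.
  move=> sr; have [U [g [oU Ur sg Fg Dg]]] := smooth_within_partial sF (cr r sr).
  exists (fun q => g (0 + q *: basis_vec R ord0)).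
  exists [set q | U (const_mx q)]; first by apply: (cline r); exact: open_nbhs_nbhs.
  split; last by move=> q sq Uq; rewrite -lineE Fg //; exact: cr.
  rewrite -(dF _ (cr r sr)) Dg //; last exact: cr.
  rewrite lineE; apply: derivable_line; rewrite -lineE.
  exact: smooth_on_derivable sg Ur.
apply/esym/eqP; rewrite -subr_eq0; apply/eqP.
have [||r _ ->] := @MVT_segment R (fun q => F (const_mx q)) (fun=> 0) s t (ltW st).
- move=> r; rewrite in_itv /= => /andP[sr rt].
  have [|g [V nV [dg Fg]]] := ext r; first by rewrite !ltW.
  apply: near_eq_is_derive dg; near=> q; rewrite Fg //.
    apply/andP; split; apply/ltW; near: q; [exact: lt_nbhsr|exact: lt_nbhsl].
  by near: q.
- apply/subspace_continuousP => r; rewrite /= in_itv /= => sr.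
  have [g [V nV [dg Fg]]] := ext r sr.
  have cg : {for r, continuous g}.
    by apply: differentiable_continuous; apply/derivable1_diffP; case: dg.
  suff : F (const_mx q) @[q --> within [set` `[s, t]] (nbhs r)] --> F (const_mx r) by [].
  rewrite (Fg r sr (nbhs_singleton nV)).
  apply: (cvg_trans _ (cvg_within_filter _ cg)).
  apply: (@near_eq_cvg _ _ (within [set` `[s, t]] (nbhs r))).
  by apply: filterS nV => q Vq sq; apply/esym/Fg => //; move: sq; rewrite /= in_itv.
by rewrite mul0r.
Unshelve. all: by end_near. Qed.

(** Along the base path every global smooth function has zero derivative, and these functions
    separate points. *)
Lemma constant_base a : Apath a -> (forall x, cube x -> vec (a x) ord0 = 0) ->
  forall x y, cube x -> cube y -> base (a x) = base (a y).
Proof.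
move=> [sa ba _] v0 x y cx cy; apply: smooth_fun_separates => h sh.
apply: (partial0_constant (smooth_within_base sa sh)) => // z cz.
rewrite ba // v0 //.
have := anchor_sum (nil : seq 'I_0) (fun=> 0) (fun=> 0 : A (base (a z))) sh.
by rewrite !big_nil.
Qed.

(** The edge t = c of a homotopy is an A-path in s whose vector vanishes by the boundary
    condition. *)
Lemma homotopy_edge_base a b (s : cube_map A 2) (c : R) x : homotopy s a b ->
  c = 0 \/ c = 1 -> cube x -> x ord0 t_dir = c -> base (s x) = base (a (const_mx c)).
Proof.
move=> [ms s0 _ sv] c01 cx xc.
have cc : 0 <= c <= 1 by case: c01 => ->; rewrite ?lexx ?ler01.
have E : lift t_dir ord0 = s_dir by exact: val_inj.
have xE (r : 'rV[R]_2) : r ord0 t_dir = c -> r = face_point t_dir c (const_mx (r ord0 s_dir)).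
  move=> rc; apply/rowP => j; have [->|/not_s_dir ->] := eqVneq j s_dir.
    by rewrite -E face_point_lift mxE.
  by rewrite face_point_at.
have m1 : is_morphism (face t_dir c s) by exact: face_morphism.
have v0 z : cube z -> vec (face t_dir c s z) ord0 = 0.
  move=> cz; rewrite /face /vec /= -/(vec _ _) E; apply: (sv _ t_dir) => //.
    exact: cube_face_point.
  by rewrite face_point_at.
have c0 : cube (const_mx 0 : 'rV[R]_1) by apply: cube_const; rewrite lexx ler01.
have cxs : cube (const_mx (x ord0 s_dir) : 'rV[R]_1) by apply: cube_const; exact: cx.
have B := constant_base m1 v0 cxs c0.
rewrite [in LHS](xE x xc) -[LHS]/(base (face t_dir c s (const_mx (x ord0 s_dir)))) B.
have cc1 : cube (const_mx c : 'rV[R]_1) by exact: cube_const.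
rewrite -(s0 _ cc1) /face /base /=; congr (projT1 (s _)).
apply/rowP => j; have [->|/not_s_dir ->] := eqVneq j s_dir.
  by rewrite face_point_at -E face_point_lift mxE.
by rewrite face_point_at t_dirE face_point_lift mxE.
Qed.

(** The t-vector is killed by the constant substitution, the s-vector by the boundary condition.
    This is what allows homotopies to be concatenated in the t-direction. *)
Lemma homotopy_edge a b (s : cube_map A 2) (c : R) x : homotopy s a b ->
  c = 0 \/ c = 1 -> cube x ->
  pull (sub t_dir (fun=> c)) s x = existT _ (base (a (const_mx c))) (fun=> 0).
Proof.
move=> hs c01 cx; have [_ _ _ sv] := hs.
have cc : 0 <= c <= 1 by case: c01 => ->; rewrite ?lexx ?ler01.
have cS : cube (sub t_dir (fun=> c) x) by apply: cube_sub.
have xS : sub t_dir (fun=> c) x ord0 t_dir = c by rewrite subE eqxx.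
rewrite /pull lin_zero; last first.
  move=> i j; rewrite jac_sub; last exact: smooth1_cst.
  have [->|/not_s_dir ->] := eqVneq j s_dir.
    by rewrite (sv _ t_dir) ?scaler0 // xS.
  by rewrite derive1_cst; case: eqP => _; rewrite ?mulr0 ?mul0r scale0r.
by rewrite (homotopy_edge_base hs c01 cS xS).
Qed.

Lemma hrel_ends th a b : hrel th a b -> source a = source b /\ target a = target b.
Proof.
move=> [pa pb [s [hs _]]].
have [_ _ s1 _] := hs.
have key (c : R) : c = 0 \/ c = 1 -> base (a (const_mx c)) = base (b (const_mx c)).
  move=> c01; have cc : 0 <= c <= 1 by case: c01 => ->; rewrite ?lexx ?ler01.
  rewrite -(s1 (const_mx c)); last exact: cube_const.
  apply/esym; apply: (homotopy_edge_base hs c01).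
    by apply: cube_face_point; [rewrite ler01 lexx|exact: cube_const].
  by rewrite t_dirE face_point_lift mxE.
by split; apply: key; [left|right].
Qed.

End Endpoints.

(** * Transitivity, concatenation and reversal of homotopies *)

Section Congruence.
Variables (R : realType) (M : manifold R) (A : lie_algebroid M).
Implicit Types (a b c : cube_map A 1).

Lemma hrel_trans th b a c : hrel th a b -> hrel th b c -> hrel th a c.
Proof.
move=> [pa pb [s [hs ts]]] [_ pc [s' [hs' ts']]]; split=> //.
have [ms s0 s1 sv] := hs; have [ms' s0' s1' sv'] := hs'.
pose tau := @flat_step R; have ft : flat_reparam tau by exact: flat_reparam_flat_step.
have fg x : cube x -> pull (sub s_dir (fun=> 0)) s' x = pull (sub s_dir (fun=> 1)) s x.
  move=> cx; rewrite !pull_sub_cst_face s0' ?s1 // => j; rewrite mxE; exact: cx.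
have z1 : 0 <= (0:R) <= 1 by rewrite lexx ler01.
have o1 : 0 <= (1:R) <= 1 by rewrite lexx ler01.
exists (smooth_concat s_dir tau s' s); split; last first.
  by move=> tt; apply: smooth_concat_thin => //; [exact: ts|exact: ts'].
split.
- exact: smooth_concat_morphism.
- move=> x cx.
  rewrite (@eq_face _ _ _ _ _ _ _ (pull (sub s_dir (first_half tau)) s)); last first.
    rewrite smooth_concatE //; last exact: cube_face_point.
    by rewrite face_point_at invr_ge0 ler0n.
  rewrite face_pull_sub ?first_half0 ?s0 //; exact: smooth1_first_half.
- move=> x cx.
  rewrite (@eq_face _ _ _ _ _ _ _ (pull (sub s_dir (second_half tau)) s')); last first.
    rewrite smooth_concatE //; last exact: cube_face_point.
    by rewrite face_point_at ifF //; apply/negbTE; rewrite -ltNge; lra.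
  rewrite face_pull_sub ?second_half1 ?s1' //; exact: smooth1_second_half.
move=> x i cx im xi; rewrite smooth_concatE //; case: ifP => _.
  rewrite pull_sub; last exact: smooth1_first_half.
  apply: vec_scale_at_eq0; apply: (sv _ i) => //.
    by apply: cube_set_coord => //; exact: first_half01.
  by rewrite mxE (negbTE im).
rewrite pull_sub; last exact: smooth1_second_half.
apply: vec_scale_at_eq0; apply: (sv' _ i) => //.
  by apply: cube_set_coord => //; exact: second_half01.
by rewrite mxE (negbTE im).
Qed.

(** The two homotopies are concatenated side by side: along the seam both are zero frames over the
    common end point. *)
Lemma hrel_concat th tau a a' b b' : flat_reparam tau -> hrel th a a' -> hrel th b b' ->
  target a = source b ->
  hrel th (smooth_concat ord0 tau b a) (smooth_concat ord0 tau b' a').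
Proof.
move=> ft [pa pa' [s [hs ts]]] [pb pb' [s' [hs' ts']]] ab.
have [ms s0 s1 sv] := hs; have [ms' s0' s1' sv'] := hs'.
have fg x : cube x -> pull (sub t_dir (fun=> 0)) s' x = pull (sub t_dir (fun=> 1)) s x.
  move=> cx; rewrite (homotopy_edge hs') //; last by left.
  rewrite (homotopy_edge hs) //; last by right.
  by rewrite -[base (b _)]/(source b) -ab.
have faceS (c : R) x : 0 <= c <= 1 -> cube x ->
    face s_dir c (smooth_concat t_dir tau s' s) x =
    smooth_concat ord0 tau (face s_dir c s') (face s_dir c s) x.
  move=> c01 cx.
  have cf : cube (face_point s_dir c x) by exact: cube_face_point.
  have E := smooth_concatE t_dir ft s' s cf.
  rewrite t_dirE face_point_lift -t_dirE in E.
  rewrite smooth_concatE //; case: ifP E => _ E.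
    rewrite (eq_face E) face_pull_sub_t //; exact: smooth1_first_half.
  rewrite (eq_face E) face_pull_sub_t //; exact: smooth1_second_half.
have z1 : 0 <= (0:R) <= 1 by rewrite lexx ler01.
have o1 : 0 <= (1:R) <= 1 by rewrite lexx ler01.
have mS : is_morphism (smooth_concat t_dir tau s' s) by exact: smooth_concat_morphism.
apply: (@eq_hrel _ _ _ _ (face s_dir 0 (smooth_concat t_dir tau s' s)) _
  (face s_dir 1 (smooth_concat t_dir tau s' s))).
- split; [exact: face_morphism|exact: face_morphism|].
  exists (smooth_concat t_dir tau s' s); split; last first.
    by move=> tt; apply: smooth_concat_thin => //; [exact: ts|exact: ts'].
  split=> // x i cx /not_s_dir -> xt; rewrite smooth_concatE //.
  case: ifPn => [x2|].
    rewrite pull_sub; last exact: smooth1_first_half.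
    apply: vec_scale_at_eq0; apply: (sv _ t_dir) => //.
      by apply: cube_set_coord => //; exact: first_half01.
    rewrite set_coordK; left.
    have -> : x ord0 t_dir = 0 by case: xt => // E; move: x2; rewrite E; lra.
    exact: first_half0.
  rewrite -ltNge => x2; rewrite pull_sub; last exact: smooth1_second_half.
  apply: vec_scale_at_eq0; apply: (sv' _ t_dir) => //.
    by apply: cube_set_coord => //; exact: second_half01.
  rewrite set_coordK; right.
  have -> : x ord0 t_dir = 1 by case: xt => // E; move: x2; rewrite E; lra.
  exact: second_half1.
- by move=> x cx; rewrite faceS //; apply: eq_smooth_concat.
- by move=> x cx; rewrite faceS //; apply: eq_smooth_concat.
Qed.

Definition onem (t : R) : R := -1 * t + 1.

Lemma smooth1_onem : smooth1 onem.
Proof. exact: smooth1_affine. Qed.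

Lemma onem01 t : 0 <= t <= 1 -> 0 <= onem t <= 1.
Proof. by rewrite /onem => ?; lra. Qed.

Lemma derive_onem t : derive1 onem t = -1.
Proof.
have := @derive1_affine_comp R id (-1) 1 t (@smooth1_id R).
by rewrite derive1_id mulr1.
Qed.

Lemma reverse_pull k (i : 'I_k) (f : cube_map A k) x :
  reverse i f x = pull (sub i onem) f x.
Proof.
rewrite pull_sub; last exact: smooth1_onem.
by rewrite derive_onem /reverse /onem mulN1r addrC.
Qed.

Lemma reverse_path a : Apath a -> Apath (reverse ord0 a).
Proof.
move=> pa; apply: (@eq_morphism _ _ _ _ (pull (sub ord0 onem) a)).
  by move=> x _; rewrite reverse_pull.
apply: pull_morphism => //; first exact/smooth_sub/smooth1_onem.
by move=> x; apply: cube_sub => t; exact: onem01.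
Qed.

Lemma hrel_reverse th a a' : hrel th a a' ->
  hrel th (reverse ord0 a) (reverse ord0 a').
Proof.
move=> [pa pa' [s [[ms s0 s1 sv] ts]]].
have cS x : cube x -> cube (sub t_dir onem x).
  by apply: cube_sub => t; exact: onem01.
split; [exact: reverse_path|exact: reverse_path|].
exists (pull (sub t_dir onem) s); split; last by move=> /ts; exact: pull_thin.
have fE (c : R) x : face s_dir c (pull (sub t_dir onem) s) x =
    pull (sub ord0 onem) (face s_dir c s) x.
  by rewrite face_pull_sub_t //; exact: smooth1_onem.
split.
- by apply: pull_morphism => //; exact/smooth_sub/smooth1_onem.
- move=> x cx; rewrite fE reverse_pull; apply: eq_pull; apply: s0.
  by apply: cube_sub => // t; exact: onem01.
- move=> x cx; rewrite fE reverse_pull; apply: eq_pull; apply: s1.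
  by apply: cube_sub => // t; exact: onem01.
move=> x i cx /not_s_dir -> xt; rewrite pull_sub; last exact: smooth1_onem.
apply: vec_scale_at_eq0; apply: (sv _ t_dir) => //.
  by apply: cube_set_coord => //; exact/onem01/cx.
by rewrite set_coordK /onem; case: xt => ->; [right|left]; ring.
Qed.

End Congruence.

(** * The groupoid laws up to thin homotopy *)

Section GroupoidLaws.
Variables (R : realType) (M : manifold R) (A : lie_algebroid M).
Implicit Types (a b c f g h : cube_map A 1) (t d : R).

(* The value of a reparametrized path depends only on the 1-jet (t, d) of the
   reparametrization. *)
Definition jet a t d : frame A 1 := lin (fun _ _ => d) (a (const_mx t)).

Lemma path_subE u a x : smooth1 u ->
  path_sub u a x = jet a (u (x ord0 ord0)) (derive1 u (x ord0 ord0)).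
Proof.
move=> su; rewrite /path_sub /pull /jet; have -> : sub ord0 u x = const_mx (u (x ord0 ord0)).
  by apply/rowP => j; rewrite subE [j]ord1 eqxx mxE.
by apply: eq_lin => i j; rewrite jac_sub // [i]ord1 [j]ord1 eqxx mul1r.
Qed.

Lemma jet_path_sub u a t d : smooth1 u -> jet (path_sub u a) t d = jet a (u t) (d * derive1 u t).
Proof.
move=> su; rewrite {1}/jet path_subE // mxE /jet lin_lin; apply: eq_lin => i j.
by rewrite big_ord1.
Qed.

Lemma jet0 a t : jet a t 0 = existT _ (base (a (const_mx t))) (fun=> 0).
Proof. by apply: lin_zero => i j; rewrite scale0r. Qed.

Lemma jet_constant x t d : jet (constant_path A x) t d = constant_path A x 0.
Proof. by apply: lin_zero => i j; rewrite /vec /= scaler0. Qed.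

Lemma jet_source a : jet a 0 0 = constant_path A (source a) 0.
Proof. exact: jet0. Qed.

Lemma jet_target a : jet a 1 0 = constant_path A (target a) 0.
Proof. exact: jet0. Qed.

Lemma jet_concat tau a b t d : flat_reparam tau -> 0 <= t <= 1 ->
  jet (smooth_concat ord0 tau b a) t d =
  if t <= 2^-1 then jet a (first_half tau t) (d * derive1 (first_half tau) t)
  else jet b (second_half tau t) (d * derive1 (second_half tau) t).
Proof.
move=> ft t01; rewrite {1}/jet smooth_concatE //; last exact: cube_const.
rewrite mxE; case: ifP => _.
  by rewrite -jet_path_sub //; exact: smooth1_first_half.
by rewrite -jet_path_sub //; exact: smooth1_second_half.
Qed.

Lemma concatE tau a b x : flat_reparam tau -> cube x ->
  smooth_concat ord0 tau b a x =
  if x ord0 ord0 <= 2^-1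
  then jet a (first_half tau (x ord0 ord0)) (derive1 (first_half tau) (x ord0 ord0))
  else jet b (second_half tau (x ord0 ord0)) (derive1 (second_half tau) (x ord0 ord0)).
Proof.
move=> ft cx; rewrite smooth_concatE //; case: ifP => _.
  by rewrite -path_subE //; exact: smooth1_first_half.
by rewrite -path_subE //; exact: smooth1_second_half.
Qed.

Lemma jet_reverse a t d : jet (reverse ord0 a) t d = jet a (onem t) (- d).
Proof.
rewrite {1}/jet reverse_pull -/(path_sub _ _ _) -/(jet (path_sub (@onem R) a) t d).
rewrite jet_path_sub; last exact: smooth1_onem.
by rewrite derive_onem mulrN1.
Qed.

Lemma source_concat tau a b : flat_reparam tau ->
  source (smooth_concat ord0 tau b a) = source a.
Proof.
move=> ft; rewrite /source concatE //; last by apply: cube_const; rewrite lexx ler01.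
by rewrite mxE invr_ge0 ler0n first_half0.
Qed.

Lemma target_concat tau a b : flat_reparam tau ->
  target (smooth_concat ord0 tau b a) = target b.
Proof.
move=> ft; rewrite /target concatE //; last by apply: cube_const; rewrite lexx ler01.
rewrite mxE ifF ?second_half1 //; apply/negbTE; rewrite -ltNge; lra.
Qed.

Lemma source_reverse a : source (reverse ord0 a) = target a.
Proof.
rewrite /source /target /reverse /=; congr (base (a _)).
by apply/rowP => j; rewrite !mxE [j]ord1 eqxx subr0.
Qed.

Lemma target_reverse a : target (reverse ord0 a) = source a.
Proof.
rewrite /source /target /reverse /=; congr (base (a _)).
by apply/rowP => j; rewrite !mxE [j]ord1 eqxx subrr.
Qed.

Lemma reverse_reverse a x : reverse ord0 (reverse ord0 a) x = a x.
Proof.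
rewrite /reverse scale_at_scale_at set_coordK set_coord_set_coord subKr mulrNN mulr1.
have -> : set_coord ord0 (x ord0 ord0) x = x.
  by apply/rowP => j; rewrite mxE; case: eqP => // ->.
case: (a x) => y v; apply: frame_eq => j.
by case: ifP => // _; exact: scale1r.
Qed.

Lemma concat_path tau a b : flat_reparam tau -> Apath a -> Apath b ->
  target a = source b -> Apath (smooth_concat ord0 tau b a).
Proof.
move=> ft pa pb ab.
by have [] := hrel_concat ft (hrel_refl true pa) (hrel_refl true pb) ab.
Qed.

Lemma constant_path_Apath x : Apath (constant_path A x).
Proof. exact: (@constant_morphism R M A 1 x). Qed.

Lemma derive1_lin2 (p q : R) (u v : R -> R) t : smooth1 u -> smooth1 v ->
  derive1 (fun t => p * u t + q * v t) t = p * derive1 u t + q * derive1 v t.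
Proof.
move=> su sv.
have du := smooth1_is_derive t su; have dv := smooth1_is_derive t sv.
have E : is_derive t (1:R) (fun t => p * u t + q * v t) (p * derive1 u t + q * derive1 v t).
  have h := is_deriveD (is_deriveM (is_derive_cst p t 1) du) (is_deriveM (is_derive_cst q t 1) dv).
  apply: is_derive_eq h _.
  by rewrite /GRing.scale /= /cst !mulr0 !addr0.
by rewrite derive1E; case: E.
Qed.

Lemma smooth1_lin2 (p q : R) (u v : R -> R) : smooth1 u -> smooth1 v ->
  smooth1 (fun t => p * u t + q * v t).
Proof.
move=> su sv; exact: (@smooth1D _ _ _ (@smooth1M _ _ _ (@smooth1_cst _ p) su)
  (@smooth1M _ _ _ (@smooth1_cst _ q) sv)).
Qed.

Lemma clamp0 (tau : R -> R) : clamp tau 0 = 0.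
Proof. exact: cut_le0. Qed.

Lemma clamp1 (tau : R -> R) : clamp tau 1 = 1.
Proof. exact: cut_ge1. Qed.

Lemma derive_clamp0 (tau : R -> R) : flat_reparam tau -> derive1 (clamp tau) 0 = 0.
Proof. by move=> ft; apply: derive_clamp_out => //; left. Qed.

Lemma derive_clamp1 (tau : R -> R) : flat_reparam tau -> derive1 (clamp tau) 1 = 0.
Proof. by move=> ft; apply: derive_clamp_out => //; right. Qed.

Lemma path_sub_clamp_hrel tau a : flat_reparam tau -> Apath a ->
  hrel true (path_sub (clamp tau) a) a.
Proof.
move=> ft pa; apply: (@eq_hrel _ _ _ _ (path_sub (clamp tau) a) _ (path_sub id a)) => //.
  apply: path_sub_hrel => //; rewrite ?clamp0 ?clamp1 //.
  - exact: smooth1_clamp.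
  - exact: smooth1_id.
  - by move=> t _; exact: clamp01.
by move=> x _; exact: path_sub_id.
Qed.

Section Laws.
Variable tau : R -> R.
Hypothesis ft : flat_reparam tau.
Let fh := first_half tau.
Let sh := second_half tau.
Let sfh : smooth1 fh. Proof. exact: smooth1_first_half. Qed.
Let ssh : smooth1 sh. Proof. exact: smooth1_second_half. Qed.

(* As sh vanishes on the first half of the interval and fh = 1 on the second,
   p fh + q sh runs first through [0, p], then through [p, 1]. *)
Lemma combination_path_sub (p q : R) a : 0 <= p -> 0 <= q -> p + q = 1 -> Apath a ->
  hrel true (path_sub (fun t => p * fh t + q * sh t) a) a.
Proof.
move=> p0 q0 pq pa.
apply: (@eq_hrel _ _ _ _ (path_sub (fun t => p * fh t + q * sh t) a) _ (path_sub id a)).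
  apply: path_sub_hrel; last exact: pa.
  - exact: smooth1_lin2.
  - exact: smooth1_id.
  - move=> t _; have /andP[f0 f1] := first_half01 ft t.
    have /andP[s0 s1] := second_half01 ft t; rewrite -/fh -/sh in f0 f1 s0 s1 *.
    by move: (fh t) (sh t) f0 f1 s0 s1 => y z f0 f1 s0 s1; apply/andP; split; nra.
  - by [].
  - by rewrite /fh /sh first_half0 second_half_le ?invr_ge0 ?ler0n // !mulr0 addr0.
  - by rewrite /fh /sh second_half1 first_half_ge ?mulr1 //; lra.
  - by [].
by move=> x _; exact: path_sub_id.
Qed.

(** Records which half is at rest, together with its derivative, for case analysis on
    [y <= 2^-1]. *)
Variant halves_spec y : bool -> Prop :=
  | FirstHalf of y <= 2^-1 & sh y = 0 & derive1 sh y = 0 : halves_spec y true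
  | SecondHalf of 2^-1 < y & fh y = 1 & derive1 fh y = 0 : halves_spec y false.

Lemma halvesP y : halves_spec y (y <= 2^-1).
Proof.
have [yh|yh] := leP y 2^-1.
  by constructor=> //; [exact: second_half_le|exact: derive_second_half_le].
by constructor=> //; [exact/first_half_ge/ltW|exact/derive_first_half_ge/ltW].
Qed.

(** Running the [tau0]-concatenation along (fh + sh)/2 gives the [tau]-concatenation of the factors
    reparametrized by the clamped [tau0]; these factors are thinly homotopic to [a] and [b]. *)
Lemma concat_tau tau0 a b : flat_reparam tau0 -> Apath a -> Apath b ->
  target a = source b ->
  hrel true (smooth_concat ord0 tau b a) (smooth_concat ord0 tau0 b a).
Proof.
move=> ft0 pa pb ab; pose c0 := clamp tau0.
have sc0 : smooth1 c0 by exact: smooth1_clamp.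
have pE := concat_path ft0 pa pb ab.
apply: (@hrel_trans _ _ _ _ (smooth_concat ord0 tau (path_sub c0 b) (path_sub c0 a))).
  apply: hrel_concat => //; apply: hrel_sym; exact: path_sub_clamp_hrel.
have h2 : 0 <= 2^-1 :> R by rewrite invr_ge0 ler0n.
have e2 : 2^-1 + 2^-1 = 1 :> R by lra.
apply: (eq_hrel (combination_path_sub h2 h2 e2 pE)) => // x cx.
have /andP[x0 x1] := cube1P cx.
rewrite path_subE; last exact: smooth1_lin2.
rewrite derive1_lin2 // concatE // jet_concat //; last first.
  have /andP[f0 f1] := first_half01 ft (x ord0 ord0).
  have /andP[s0 s1] := second_half01 ft (x ord0 ord0).
  rewrite -/fh -/sh in f0 f1 s0 s1 *; apply/andP; split; lra.
rewrite !jet_path_sub //; move: (x ord0 ord0) x0 x1 => y y0 y1.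
rewrite (derive_first_half ft0) (derive_second_half ft0) {1}/first_half {1}/second_half.
rewrite -/fh -/sh -/c0; have [yh s0 ds|yh f1 df] := halvesP y.
  have [_ F1] := andP (first_half01 ft y); rewrite -/fh in F1.
  rewrite s0 ds mulr0 !addr0 ifT; last by rewrite ger_pMr ?invr_gt0.
  rewrite mulrA divff // mul1r; congr jet.
  by move: (derive1 fh y) (derive1 c0 (fh y)) => D D'; field.
have [S0 _] := andP (second_half01 ft y); rewrite -/sh in S0.
rewrite f1 df mulr0 add0r; case: ifPn => ys.
  (* Beyond 1/2 the second half may still be 0, since [tau] may rest there; both sides are then the
     zero frame over the seam. *)
  have -> : sh y = 0 by lra.
  rewrite (_ : 2 * _ + 0 = 1); last by field.
  by rewrite /c0 clamp0 clamp1 derive_clamp1 // derive_clamp0 // !mulr0 jet_target jet_source ab.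
rewrite (_ : 2 * _ + -1 = sh y); last by move: (sh y) => S; field.
congr jet.
by move: (derive1 sh y) (derive1 c0 (sh y)) => D D'; field.
Qed.

(* Both bracketings of a concatenation of three paths are reparametrizations of
   the symmetric concatenation in thirds. *)
Definition step3 (k t : R) : R := clamp tau (3 * t + - k).

Lemma smooth1_step3 k : smooth1 (step3 k).
Proof. exact: (@smooth1_comp _ _ _ (@smooth1_clamp _ _ ft) (@smooth1_affine _ 3 (- k))). Qed.

Lemma derive_step3 k t : derive1 (step3 k) t = 3 * derive1 (clamp tau) (3 * t + - k).
Proof. exact/derive1_affine_comp/smooth1_clamp. Qed.

Definition triple f g h : cube_map A 1 := fun x =>
  if x ord0 ord0 <= 2 / 3 then
    if x ord0 ord0 <= 1 / 3 then path_sub (step3 0) f x else path_sub (step3 1) g x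
  else path_sub (step3 2) h x.

(** [P] rests at [p] from [s] on and [Q] up to [s], so the constant path takes the role of [N]. *)
Lemma path_glue (P Q : cube_map A 1) (s : R) (p : M) : Apath P -> Apath Q ->
  (forall x, cube x -> s <= x ord0 ord0 -> P x = constant_path A p x) ->
  (forall x, cube x -> x ord0 ord0 <= s -> Q x = constant_path A p x) ->
  Apath (fun x => if x ord0 ord0 <= s then P x else Q x).
Proof.
move=> pP pQ Pp Qp.
apply: (@glue_morphism _ _ _ _ P Q (constant_path A p)) => //; last first.
  exact: constant_path_Apath.
move=> x cx; case: ifPn => [xs|]; first by left; rewrite Qp.
by rewrite -ltNge => /ltW xs; right; rewrite Pp.
Qed.

Lemma triple_path f g h : Apath f -> Apath g -> Apath h ->
  target f = source g -> target g = source h -> Apath (triple f g h).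
Proof.
move=> pf pg ph fg gh.
have ps k a : Apath a -> Apath (path_sub (step3 k) a).
  by apply: path_sub_path => [|t _]; [exact: smooth1_step3|exact: clamp01].
have stop1 (k : R) a (x : 'rV[R]_1) : 1 + k <= 3 * x ord0 ord0 ->
    path_sub (step3 k) a x = constant_path A (target a) x.
  move=> kx; rewrite path_subE; last exact: smooth1_step3.
  rewrite derive_step3 /step3 derive_clamp_out //; last by right; lra.
  by rewrite mulr0 /clamp cut_ge1 ?jet_target //; lra.
have stop0 (k : R) a (x : 'rV[R]_1) : 3 * x ord0 ord0 <= k ->
    path_sub (step3 k) a x = constant_path A (source a) x.
  move=> kx; rewrite path_subE; last exact: smooth1_step3.
  rewrite derive_step3 /step3 derive_clamp_out //; last by left; lra.
  by rewrite mulr0 /clamp cut_le0 ?jet_source //; lra.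
apply: (@path_glue (fun x => if x ord0 ord0 <= 1 / 3 then path_sub (step3 0) f x
  else path_sub (step3 1) g x) _ _ (target g)); [|exact: ps| |].
- apply: (@path_glue _ _ _ (target f)); try exact: ps.
    by move=> x cx xs; apply: stop1; lra.
  by move=> x cx xs; rewrite fg; apply: stop0; lra.
- move=> x cx xs; rewrite ifF; last by apply/negbTE; rewrite -ltNge; lra.
  by apply: stop1; lra.
- by move=> x cx xs; rewrite gh; apply: stop0; lra.
Qed.

Lemma jet_triple f g h t d : jet (triple f g h) t d =
  if t <= 2 / 3 then
    if t <= 1 / 3 then jet f (step3 0 t) (d * derive1 (step3 0) t)
    else jet g (step3 1 t) (d * derive1 (step3 1) t)
  else jet h (step3 2 t) (d * derive1 (step3 2) t).
Proof.
rewrite {1}/jet /triple mxE; case: ifP => _; first case: ifP => _.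
- exact: (@jet_path_sub (step3 0) f t d (@smooth1_step3 0)).
- exact: (@jet_path_sub (step3 1) g t d (@smooth1_step3 1)).
- exact: (@jet_path_sub (step3 2) h t d (@smooth1_step3 2)).
Qed.

(** In a bracketing the outer single path is reparametrized once, the inner ones twice.
    Reparametrizing the outer one by [ct] as well makes each bracketing equal to [triple] run along
    a combination of [fh] and [sh]; the inner pair takes the weight 2/3. *)
Lemma concat_assoc f g h : Apath f -> Apath g -> Apath h ->
  target f = source g -> target g = source h ->
  hrel true (smooth_concat ord0 tau h (smooth_concat ord0 tau g f))
            (smooth_concat ord0 tau (smooth_concat ord0 tau h g) f).
Proof.
move=> pf pg ph fg gh; pose ct := clamp tau.
have sct : smooth1 ct by exact: smooth1_clamp.
have pE := triple_path pf pg ph fg gh.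
have pgf := concat_path ft pf pg fg; have phg := concat_path ft pg ph gh.
apply: (@hrel_trans _ _ _ _ (smooth_concat ord0 tau (path_sub ct h) (smooth_concat ord0 tau g f))).
  apply: hrel_concat => //; [exact: hrel_refl|apply: hrel_sym; exact: path_sub_clamp_hrel|].
  by rewrite target_concat.
apply: (@hrel_trans _ _ _ _ (smooth_concat ord0 tau (smooth_concat ord0 tau h g) (path_sub ct f)));
  last first.
  have [_ tf] := hrel_ends (path_sub_clamp_hrel ft pf).
  apply: hrel_concat => //; [exact: path_sub_clamp_hrel|exact: hrel_refl|].
  by rewrite source_concat // -/ct in tf *; rewrite tf.
have p1 : 0 <= 1 / 3 :> R by lra.
have p2 : 0 <= 2 / 3 :> R by lra.
have p12 : 1 / 3 + 2 / 3 = 1 :> R by lra.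
have p21 : 2 / 3 + 1 / 3 = 1 :> R by lra.
apply: (@hrel_trans _ _ _ _ (triple f g h)).
- apply: (eq_hrel (combination_path_sub p2 p1 p21 pE)) => // x cx.
  have /andP[x0 x1] := cube1P cx.
  rewrite path_subE; last exact: smooth1_lin2.
  rewrite derive1_lin2 // concatE // jet_path_sub // jet_triple jet_concat //; last first.
    exact: first_half01.
  move: (x ord0 ord0) x0 x1 => y y0 y1; rewrite -/fh -/sh.
  rewrite !derive_step3 /step3 -/ct !(derive_first_half ft (fh _)) !(derive_second_half ft (fh _)).
  rewrite -!/ct /(fh (fh _)) /(sh (fh _)).
  have [yh s0 ds|yh f1 df] := halvesP y.
    have [_ F1] := andP (first_half01 ft y); rewrite -/fh in F1.
    change (first_half tau (first_half tau y)) with (ct (2 * fh y + 0)).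
    change (second_half tau (fh y)) with (ct (2 * fh y + -1)).
    rewrite s0 ds; move: (fh y) (derive1 fh y) F1 => F DF F1.
    rewrite ifT; last lra.
    rewrite (_ : (2 / 3 * F + 1 / 3 * 0 <= 1 / 3) = (F <= 2^-1)); last first.
      by apply/idP/idP => ?; lra.
    rewrite (_ : 3 * (2 / 3 * F + 1 / 3 * 0) + - 0 = 2 * F + 0); last by field.
    rewrite (_ : 3 * (2 / 3 * F + 1 / 3 * 0) + - 1 = 2 * F + - 1); last by field.
    case: ifP => _; congr jet.
      by move: (derive1 ct (2 * F + 0)) => D; field.
    by move: (derive1 ct (2 * F + -1)) => D; field.
  have [S0 _] := andP (second_half01 ft y); rewrite -/sh in S0.
  rewrite f1 df; move: (sh y) (derive1 sh y) S0 => S DS S0.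
  rewrite (_ : 3 * (2 / 3 * 1 + 1 / 3 * S) + - 2 = S); last by field.
  rewrite (_ : 3 * (2 / 3 * 1 + 1 / 3 * S) + - 1 = 1 + S); last by field.
  case: ifPn => Sh.
    (* As in [concat_tau], the second half is still at rest: the point is the seam between [g] and
       [h]. *)
    have -> : S = 0 by lra.
    rewrite ifF; last by apply/negbTE; rewrite -ltNge; lra.
    by rewrite /ct addr0 clamp0 clamp1 derive_clamp1 // derive_clamp0 // !mulr0
      jet_target jet_source gh.
  by congr jet; move: (derive1 ct S) => D; field.
- apply: hrel_sym.
  apply: (eq_hrel (combination_path_sub p1 p2 p12 pE)) => // x cx.
  have /andP[x0 x1] := cube1P cx.
  rewrite path_subE; last exact: smooth1_lin2.
  rewrite derive1_lin2 // concatE // jet_path_sub // jet_triple jet_concat //; last first.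
    exact: second_half01.
  move: (x ord0 ord0) x0 x1 => y y0 y1; rewrite -/fh -/sh.
  rewrite !derive_step3 /step3 -/ct !(derive_first_half ft (sh _)) !(derive_second_half ft (sh _)).
  rewrite -!/ct.
  have [yh s0 ds|yh f1 df] := halvesP y.
    have [_ F1] := andP (first_half01 ft y); rewrite -/fh in F1.
    rewrite s0 ds; move: (fh y) (derive1 fh y) F1 => F DF F1.
    rewrite ifT; last lra.
    rewrite ifT; last lra.
    rewrite (_ : 3 * (1 / 3 * F + 2 / 3 * 0) + - 0 = F); last by field.
    by congr jet; move: (derive1 ct F) => D; field.
  have [S0 _] := andP (second_half01 ft y); rewrite -/sh in S0.
  change (fh (sh y)) with (ct (2 * sh y + 0)).
  change (second_half tau (second_half tau y)) with (ct (2 * sh y + -1)).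
  rewrite f1 df; move: (sh y) (derive1 sh y) S0 => S DS S0.
  rewrite (_ : (1 / 3 * 1 + 2 / 3 * S <= 2 / 3) = (S <= 2^-1)); last first.
    by apply/idP/idP => ?; lra.
  rewrite (_ : 3 * (1 / 3 * 1 + 2 / 3 * S) + - 0 = 1 + 2 * S); last by field.
  rewrite (_ : 3 * (1 / 3 * 1 + 2 / 3 * S) + - 1 = 2 * S + 0); last by field.
  rewrite (_ : 3 * (1 / 3 * 1 + 2 / 3 * S) + - 2 = 2 * S + - 1); last by field.
  case: ifPn => Sh; last first.
    by congr jet; move: (derive1 ct (2 * S + -1)) => D; field.
  case: ifPn => Sh0; last first.
    by congr jet; move: (derive1 ct (2 * S + 0)) => D; field.
  (* The same situation at the seam between [f] and [g]. *)
  have -> : S = 0 by lra.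
  by rewrite /ct mulr0 !addr0 clamp0 clamp1 derive_clamp1 // derive_clamp0 // !mulr0
    jet_target jet_source fg.
Qed.

(** The concatenation is [a] run along [sh] alone, which waits at 0 during the first half. *)
Lemma concat_constant_r a : Apath a ->
  hrel true (smooth_concat ord0 tau a (constant_path A (source a))) a.
Proof.
move=> pa; apply: (@eq_hrel _ _ _ _ (path_sub (fun t => 0 * fh t + 1 * sh t) a) _ a) => //.
  by apply: combination_path_sub; rewrite ?ler01 ?add0r.
move=> x cx; rewrite concatE // jet_constant path_subE; last exact: smooth1_lin2.
rewrite derive1_lin2 // -/fh -/sh !mul0r !mul1r !add0r.
have [yh s0 ds|yh f1 df] := halvesP (x ord0 ord0) => //.
by rewrite s0 ds jet_source.
Qed.

Lemma concat_constant_l a : Apath a ->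
  hrel true (smooth_concat ord0 tau (constant_path A (target a)) a) a.
Proof.
move=> pa; apply: (@eq_hrel _ _ _ _ (path_sub (fun t => 1 * fh t + 0 * sh t) a) _ a) => //.
  by apply: combination_path_sub; rewrite ?ler01 ?addr0.
move=> x cx; rewrite concatE // jet_constant path_subE; last exact: smooth1_lin2.
rewrite derive1_lin2 // -/fh -/sh !mul0r !mul1r !addr0.
have [yh s0 ds|yh f1 df] := halvesP (x ord0 ord0) => //.
by rewrite f1 df jet_target.
Qed.

(** The concatenation is [a] run along fh - sh, from 0 up to 1 and back. The constant 0 has the same
    end values. *)
Lemma concat_reverse_l a : Apath a ->
  hrel true (smooth_concat ord0 tau (reverse ord0 a) a) (constant_path A (source a)).
Proof.
move=> pa; pose w t := 1 * fh t + -1 * sh t.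
have sw : smooth1 w by exact: smooth1_lin2.
apply: (@eq_hrel _ _ _ _ (path_sub w a) _ (path_sub (fun=> 0) a)).
- apply: path_sub_hrel; last exact: pa.
  + exact: sw.
  + exact: smooth1_cst.
  + move=> t _; rewrite /w; have [yh -> _|yh -> _] := halvesP t.
      by rewrite mulr0 addr0 mul1r; exact: first_half01.
    have := second_half01 ft t; rewrite -/sh; move: (sh t) => S ?; lra.
  + by move=> t _; rewrite lexx ler01.
  + by rewrite /w /fh /sh first_half0 second_half_le ?invr_ge0 ?ler0n // !mulr0 addr0.
  + by rewrite /w /fh /sh second_half1 first_half_ge ?mulr1 ?subrr //; lra.
- move=> x cx; rewrite concatE // jet_reverse path_subE // derive1_lin2 // /w -/fh -/sh.
  rewrite /onem; have [yh s0 ds|yh f1 df] := halvesP (x ord0 ord0).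
    by rewrite s0 ds !mulr0 !addr0 !mul1r.
  rewrite f1 df; congr jet; first by rewrite mul1r addrC.
  by rewrite mulr0 add0r mulN1r.
- move=> x cx; rewrite path_subE ?derive1_cst; last exact: smooth1_cst.
  exact: jet_source.
Qed.

Lemma concat_reverse_r a : Apath a ->
  hrel true (smooth_concat ord0 tau a (reverse ord0 a)) (constant_path A (target a)).
Proof.
move=> pa; have := concat_reverse_l (reverse_path pa); rewrite source_reverse => H.
apply: (eq_hrel H) => //; apply: eq_smooth_concat => // x _.
exact: reverse_reverse.
Qed.

End Laws.

End GroupoidLaws.

(** * Classes of A-paths and the truncation *)

(** Equations in [G] are checked after applying [F]. Closure of the operations is assumed because
    [F] is injective only on each hom set, where both sides of an equation must first be known to
    lie. *)
Lemma groupoid_iso_groupoid (M : Type) (G H : groupoid_data M)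
    (F : arrow G -> arrow H) :
  is_groupoid H -> groupoid_iso_over F ->
  (forall x, hom x x (unit_ G x)) ->
  (forall x y z f g, hom (g := G) x y f -> hom y z g -> hom x z (comp g f)) ->
  (forall x y f, hom (g := G) x y f -> hom y x (inv f)) ->
  is_groupoid G.
Proof.
move=> gH [Fb Fu Fc Fi] hu hc hi.
have Fh x y f : hom (g := G) x y f -> hom x y (F f).
  by move=> hf; have [Ff _ _] := Fb x y; exact: Ff.
have Finj x y f g : hom (g := G) x y f -> hom x y g -> F f = F g -> f = g.
  move=> hf hg; have [_ FI _] := Fb x y.
  by apply: FI; rewrite inE.
split=> //.
- by move=> x y x' y' f /Fh h1 /Fh h2; exact: hom_ends gH _ _ _ _ _ h1 h2.
- move=> x y z w f g h hf hg hh; apply: (Finj x w).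
  + by apply: hc (hc _ _ _ _ _ hf hg) hh.
  + by apply: hc hf (hc _ _ _ _ _ hg hh).
  + rewrite (Fc x z w) //; last exact: hc hg.
    rewrite (Fc x y z) // (Fc x y w) //; last exact: hc hh.
    by rewrite (Fc y z w) //; exact: comp_assoc gH _ _ _ _ _ _ _
      (Fh _ _ _ hf) (Fh _ _ _ hg) (Fh _ _ _ hh).
- move=> x y f hf; apply: (Finj x y) => //; first exact: hc (hu x) hf.
  by rewrite (Fc x x y) // Fu; exact: comp_unit_r gH _ _ _ (Fh _ _ _ hf).
- move=> x y f hf; apply: (Finj x y) => //; first exact: hc hf (hu y).
  by rewrite (Fc x y y) // Fu; exact: comp_unit_l gH _ _ _ (Fh _ _ _ hf).
- move=> x y f hf; have hif := hi _ _ _ hf; apply: (Finj y y) => //; first exact: hc hif hf.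
  by rewrite (Fc y x y) // Fu (Fi x y) //; exact: comp_inv_r gH _ _ _ (Fh _ _ _ hf).
- move=> x y f hf; have hif := hi _ _ _ hf; apply: (Finj x x) => //; first exact: hc hf hif.
  by rewrite (Fc x y x) // Fu (Fi x y) //; exact: comp_inv_l gH _ _ _ (Fh _ _ _ hf).
Qed.

Section PathClasses.
Variables (R : realType) (M : manifold R) (A : lie_algebroid M) (th : bool).
Implicit Types (a b c : cube_map A 1).

Definition path_class a : set (cube_map A 1) := [set b | hrel th a b].

Lemma path_class_eq a b : hrel th a b -> path_class a = path_class b.
Proof.
move=> ab; apply/seteqP; split=> c /= H; first exact: hrel_trans (hrel_sym ab) H.
exact: hrel_trans ab H.
Qed.

Lemma path_class_refl a : Apath a -> path_class a a.
Proof. exact: hrel_refl. Qed.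

Lemma path_class_inj a b : Apath b -> path_class a = path_class b -> hrel th a b.
Proof. by move=> pb E; have := path_class_refl pb; rewrite -E. Qed.

Let G := path_groupoid path_class.

(** The product collects concatenations of all representatives for all flat reparametrizations;
    [hrel_concat] and [concat_tau] show that they fill a single class. *)
Lemma comp_path_class tau a b : flat_reparam tau -> Apath a -> Apath b ->
  target a = source b ->
  comp (g := G) (path_class b) (path_class a) =
  path_class (smooth_concat ord0 tau b a).
Proof.
move=> ft pa pb ab; apply/seteqP; split=> c.
  move=> [tau' [a' [b' [ft' aa bb ab' H]]]].
  have [_ pa' _] := aa; have [_ pb' _] := bb.
  apply: hrel_trans H; apply: hrel_trans (hrel_concat ft aa bb ab) _.
  exact: hrel_thin (concat_tau ft ft' pa' pb' ab').
by move=> H; exists tau, a, b; split=> //; exact: path_class_refl.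
Qed.

Lemma inv_path_class a : Apath a -> inv (g := G) (path_class a) = path_class (reverse ord0 a).
Proof.
move=> pa; apply/seteqP; split=> c.
  by move=> [a' aa H]; apply: hrel_trans H; exact: hrel_reverse.
by move=> H; exists a => //; exact: path_class_refl.
Qed.

Lemma path_groupoid_groupoid : is_groupoid G.
Proof.
have ft := @flat_reparam_flat_step R.
split.
- move=> x y x' y' _ [a [pa <- <-] <-] [a' [pa' <- <-] E].
  have [s t] := hrel_ends (path_class_inj pa E); by rewrite s t.
- by move=> x; exists (constant_path A x) => //; split=> //; exact: constant_path_Apath.
- move=> x y z _ _ [a [pa sa ta] <-] [b [pb sb tb] <-].
  have ab : target a = source b by rewrite ta.
  rewrite (comp_path_class ft) //; exists (smooth_concat ord0 (@flat_step R) b a) => //.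
  by split; [exact: concat_path|rewrite source_concat|rewrite target_concat].
- move=> x y _ [a [pa sa ta] <-]; rewrite inv_path_class //.
  exists (reverse ord0 a) => //.
  by split; [exact: reverse_path|rewrite source_reverse|rewrite target_reverse].
- move=> x y z w _ _ _ [a [pa sa ta] <-] [b [pb sb tb] <-] [c [pc sc tc] <-].
  have ab : target a = source b by rewrite ta.
  have bc : target b = source c by rewrite tb.
  have pba := concat_path ft pa pb ab; have pcb := concat_path ft pb pc bc.
  rewrite (comp_path_class ft pa pb ab) (comp_path_class ft pb pc bc).
  rewrite (comp_path_class ft) ?target_concat //.
  rewrite (comp_path_class ft) ?source_concat //; apply: path_class_eq; apply: hrel_thin.
  exact: concat_assoc.
- move=> x y _ [a [pa sa ta] <-].
  rewrite (comp_path_class ft) //; last exact: constant_path_Apath.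
  by apply: path_class_eq; apply: hrel_thin; rewrite -sa; exact: concat_constant_r.
- move=> x y _ [a [pa sa ta] <-].
  rewrite (comp_path_class ft) //; last exact: constant_path_Apath.
  by apply: path_class_eq; apply: hrel_thin; rewrite -ta; exact: concat_constant_l.
- move=> x y _ [a [pa sa ta] <-].
  rewrite inv_path_class // (comp_path_class ft) ?target_reverse //; last exact: reverse_path.
  by apply: path_class_eq; apply: hrel_thin; rewrite -ta; exact: concat_reverse_r.
- move=> x y _ [a [pa sa ta] <-].
  rewrite inv_path_class // (comp_path_class ft) ?source_reverse //; last exact: reverse_path.
  by apply: path_class_eq; apply: hrel_thin; rewrite -sa; exact: concat_reverse_l.
Qed.

End PathClasses.

(** * The truncation and its isomorphism with the Weinstein groupoid *)

Section Truncation.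
Variables (R : realType) (M : manifold R) (A : lie_algebroid M).
Implicit Types (a b c : cube_map A 1).

Lemma thin_classE : @thin_class R M A = path_class true.
Proof. by apply/funext => a; apply/seteqP; split=> b /thin_homotopicE. Qed.

Lemma homotopy_classE : @homotopy_class R M A = path_class false.
Proof. by apply/funext => a; apply/seteqP; split=> b /homotopicE. Qed.

Let G2 := weinstein_2groupoid A.
Let T := truncation G2.
Let W := weinstein_groupoid A.

Definition trunc_class a : set (set (cube_map A 1)) := one_class (G := G2) (thin_class a).

(** The faces of a 2-morphism are only thinly homotopic to the chosen representatives, so the
    homotopy from [a] to [b] is put together from a thin one, the 2-morphism and another thin
    one. *)
Lemma trunc_classP a Q : Apath a ->
  trunc_class a Q <-> exists2 b, hrel false a b & Q = thin_class b.
Proof.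
move=> pa; split.
  move=> [x [y [_ [b [pb sb tb] <-]
    [_ [s [[a0 [a1 [pa0 pa1 hs]]] /thin_homotopicE h0 /thin_homotopicE h1] _]]]]].
  exists b => //; apply: hrel_trans (hrel_thin false h0) _.
  apply: hrel_trans (hrel_sym (hrel_thin false h1)).
  have [_ e0 e1 _] := hs.
  apply: (@eq_hrel _ _ _ _ a0 _ a1); last 2 first.
  - by move=> x' cx; rewrite e0.
  - by move=> x' cx; rewrite e1.
  by split=> //; exists s.
move=> [b ab ->]; have [s t] := hrel_ends ab.
have [_ pb [S [hS _]]] := ab; have [_ e0 e1 _] := hS.
exists (source a), (target a); split.
- by exists a.
- by exists b; rewrite ?s ?t.
(* Conversely the homotopy itself represents a 2-morphism; its faces equal [a] and [b] on the
   cube. *)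
- exists (class2 S); exists S => //; split.
  + by exists a, b.
  + apply/thin_homotopicE; apply: (eq_hrel (hrel_refl true pa)) => // x cx.
    by rewrite e0.
  + apply/thin_homotopicE; apply: (eq_hrel (hrel_refl true pb)) => // x cx.
    by rewrite e1.
Qed.

Lemma eq_trunc_class a b : hrel false a b -> trunc_class a = trunc_class b.
Proof.
move=> ab; have [pa pb _] := ab; apply/seteqP; split=> Q.
  move=> /(trunc_classP _ pa)[c ac ->]; apply/(trunc_classP _ pb); exists c => //.
  exact: hrel_trans (hrel_sym ab) ac.
move=> /(trunc_classP _ pb)[c bc ->]; apply/(trunc_classP _ pa); exists c => //.
exact: hrel_trans ab bc.
Qed.

Definition members (X : set (set (cube_map A 1))) : set (cube_map A 1) :=
  [set b | exists2 f, X f & f b].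

Lemma members_trunc_class a : Apath a -> members (trunc_class a) = homotopy_class a.
Proof.
move=> pa; apply/seteqP; split=> c.
  move=> [Q /(trunc_classP _ pa)[b ab ->] /thin_homotopicE bc].
  by apply/homotopicE; exact: hrel_trans ab (hrel_thin false bc).
move=> /homotopicE ac; have [_ pc _] := ac; exists (thin_class c).
  by apply/(trunc_classP _ pa); exists c.
by apply/thin_homotopicE; exact: hrel_refl.
Qed.

Lemma comp_trunc_class tau a b : flat_reparam tau -> Apath a -> Apath b ->
  target a = source b ->
  comp (g := T) (trunc_class b) (trunc_class a) = trunc_class (smooth_concat ord0 tau b a).
Proof.
move=> ft pa pb ab.
have compE a' b' : Apath a' -> Apath b' -> target a' = source b' ->
    one_class (G := G2) (comp (g := path_groupoid (@thin_class R M A))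
      (thin_class b') (thin_class a')) =
    trunc_class (smooth_concat ord0 tau b' a').
  move=> pa' pb' ab'; rewrite /trunc_class; congr one_class.
  by rewrite thin_classE; exact: comp_path_class.
apply/seteqP; split=> Q.
  move=> [x [y [z [f [g [/(trunc_classP _ pa)[a' aa ->] /(trunc_classP _ pb)[b' bb ->] _ _]]]]]].
  have [_ pa' _] := aa; have [_ pb' _] := bb.
  have [_ ta] := hrel_ends aa; have [sb _] := hrel_ends bb.
  rewrite compE //; last by rewrite -ta -sb.
  by rewrite (eq_trunc_class (hrel_concat ft aa bb ab)).
move=> H; exists (source a), (target a), (target b), (thin_class a), (thin_class b).
split.
- by apply/(trunc_classP _ pa); exists a => //; exact: hrel_refl.
- by apply/(trunc_classP _ pb); exists b => //; exact: hrel_refl.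
- by exists a.
- by exists b.
- by rewrite compE.
Qed.

Lemma inv_trunc_class a : Apath a -> inv (g := T) (trunc_class a) = trunc_class (reverse ord0 a).
Proof.
move=> pa.
have invE a' : Apath a' ->
    one_class (G := G2) (inv (g := path_groupoid (@thin_class R M A)) (thin_class a')) =
    trunc_class (reverse ord0 a').
  by move=> pa'; rewrite /trunc_class; congr one_class; rewrite thin_classE; exact: inv_path_class.
apply/seteqP; split=> Q.
  move=> [f /(trunc_classP _ pa)[a' aa ->]]; have [_ pa' _] := aa.
  by rewrite invE // (eq_trunc_class (hrel_reverse aa)).
move=> H; exists (thin_class a); last by rewrite invE.
by apply/(trunc_classP _ pa); exists a => //; exact: hrel_refl.
Qed.

Lemma hom_trunc_class x y X : hom (g := T) x y X <->
  exists a, [/\ Apath a, source a = x, target a = y & X = trunc_class a].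
Proof.
split; first by move=> [_ [a [pa sa ta] <-] <-]; exists a.
by move=> [a [pa sa ta ->]]; exists (thin_class a) => //; exists a.
Qed.

Lemma hom_weinstein x y X : hom (g := W) x y X <->
  exists a, [/\ Apath a, source a = x, target a = y & X = homotopy_class a].
Proof.
split; first by move=> [a [pa sa ta] <-]; exists a.
by move=> [a [pa sa ta ->]]; exists a.
Qed.

Lemma weinstein_groupoidP : is_groupoid W.
Proof.
rewrite /W /weinstein_groupoid homotopy_classE; exact: path_groupoid_groupoid.
Qed.

Lemma members_iso : groupoid_iso_over (members : arrow T -> arrow W).
Proof.
have ft := @flat_reparam_flat_step R.
split.
- move=> x y; split.
  + move=> X /hom_trunc_class[a [pa sa ta ->]]; apply/hom_weinstein; exists a.
    by split=> //; exact: members_trunc_class.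
  (* Injectivity: equal unions make the representatives homotopic, and homotopic paths have the same
     class in the truncation. *)
  + move=> X Y; rewrite !inE => /hom_trunc_class[a [pa sa ta ->]] /hom_trunc_class[b [pb sb tb ->]].
    rewrite !members_trunc_class // homotopy_classE => E.
    by apply: eq_trunc_class; exact: path_class_inj pb E.
  + move=> X /hom_weinstein[a [pa sa ta ->]]; exists (trunc_class a).
      by apply/hom_trunc_class; exists a.
    exact: members_trunc_class.
- by move=> x; apply: members_trunc_class; exact: constant_path_Apath.
- move=> x y z X Y /hom_trunc_class[a [pa sa ta ->]] /hom_trunc_class[b [pb sb tb ->]].
  have ab : target a = source b by rewrite ta.
  rewrite (comp_trunc_class ft) // !members_trunc_class //; last exact: concat_path.
  by rewrite /W /weinstein_groupoid homotopy_classE; apply/esym; exact: comp_path_class.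
- move=> x y X /hom_trunc_class[a [pa sa ta ->]].
  rewrite inv_trunc_class // !members_trunc_class //; last exact: reverse_path.
  by rewrite /W /weinstein_groupoid homotopy_classE; apply/esym; exact: inv_path_class.
Qed.

Lemma truncation_groupoid : is_groupoid T.
Proof.
have ft := @flat_reparam_flat_step R.
apply: (groupoid_iso_groupoid weinstein_groupoidP members_iso).
- move=> x; apply/hom_trunc_class; exists (constant_path A x).
  by split=> //; exact: constant_path_Apath.
- move=> x y z X Y /hom_trunc_class[a [pa sa ta ->]] /hom_trunc_class[b [pb sb tb ->]].
  have ab : target a = source b by rewrite ta.
  apply/hom_trunc_class; exists (smooth_concat ord0 (@flat_step R) b a); split.
  + exact: concat_path.
  + by rewrite source_concat.
  + by rewrite target_concat.
  + exact: comp_trunc_class.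
- move=> x y X /hom_trunc_class[a [pa sa ta ->]].
  apply/hom_trunc_class; exists (reverse ord0 a); split.
  + exact: reverse_path.
  + by rewrite source_reverse.
  + by rewrite target_reverse.
  + exact: inv_trunc_class.
Qed.

End Truncation.

(** Every element of a hom set of the truncation is the class of some [thin_class a], so the last
    clause determines [F] there: it is induced by the identity on A-paths. *)
Theorem proposition4p14 (R : realType) (M : manifold R) (A : lie_algebroid M) :
  is_groupoid (truncation (weinstein_2groupoid A)) /\
  is_groupoid (weinstein_groupoid A) /\
  exists F : arrow (truncation (weinstein_2groupoid A)) ->
             arrow (weinstein_groupoid A),
    groupoid_iso_over F /\
    (forall a : cube_map A 1, Apath a ->
       F (@one_class M (weinstein_2groupoid A) (thin_class a)) =
       homotopy_class a).
Proof.
split; first exact: truncation_groupoid.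
split; first exact: weinstein_groupoidP.
exists (@members R M A); split; first exact: members_iso.
by move=> a pa; exact: members_trunc_class.
Qed.
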